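(* Let $X$ be a manifold with an almost $s$-Kähler structure of rank two, $s\ge 2$. On all the bundles of Lie algebras $\mathcal{L}^s_{\mathbb{C}},\mathcal{L}^s_{\mathbb{R}},\mathbf{s}\mathcal{L}^s,\mathbf{u}\mathcal{L}^s,\mathit{Lef}^s$ there are natural flat connections induced by the almost $s$-Kähler structure and compatible with the inclusions among these bundles. In the special case of $s$-Kähler manifolds, all the natural generators $L_{jk},\Lambda_{jk},V_j,A_j$ of these bundles of algebras are parallel tensors with respect to the Levi-Civita connection.
   Context: Fix $s\ge 2$. An almost $s$-Kähler structure of rank two on a smooth manifold $X$ of dimension $2(s+1)$ consists of a Riemannian metric $\mathbf{g}$ and smooth two-forms $\omega_{jk}$, $j,k\in\{0,\dots,s\}$, such that: (i) $\omega_{01},\dots,\omega_{0s}$ are closed and around every point there are coordinates $x_1,x_2,y^j_1,y^j_2$ ($1\le j\le s$) with $\omega_{0j}=\sum_{i=1}^2 dx_i\wedge dy^j_i$ for all $j$; (ii) at every $p\in X$ there is an orthonormal basis $\{v_{ij}: i=1,2,\ j=0,\dots,s\}$ of $T^*_pX$ (an adapted coframe) with $\omega_{jk}=\sum_{i=1}^2 v_{ij}\wedge v_{ik}$ at $p$ for all $j,k$. It is $s$-Kähler if around each $p\in X$ there are coordinates as in (i) in which moreover $\mathbf{g}=\sum_i dx_i\otimes dx_i+\sum_{i,j}dy^j_i\otimes dy^j_i+\mathbf{O}(2)$, the remainder vanishing to second order at $p$. Any two adapted coframes at $p$ are related by $v'_{ij}=\sum_l a_{il}v_{lj}$ with $(a_{il})\in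 \mathbf{O}(2)$; so the distributions $W_j=\langle v_{1j},v_{2j}\rangle$ are canonical. On forms let $E_{ij}$ be the wedge product with $v_{ij}$; $*$ denotes the pointwise adjoint with respect to the metric. Put, for $j\neq k$, $L_{jk}=\sum_{i=1}^2E_{ij}E_{ik}$ (wedge with $\omega_{jk}$), $V_j=E_{1j}E_{2j}$ (wedge with the volume form of $W_j$), $\Lambda_{jk}=L_{jk}^*$, $A_j=V_j^*$. The $V_j,A_j$ are determined locally, on open sets where $W_0$ is oriented; reversing the orientation changes all of them by a sign. The following are bundles of Lie algebras (commutator bracket) of endomorphisms of $\bigwedge^*_{\mathbb{C}}T^*X$, with fibres generated over $\mathbb{R}$ by: all $L_{jk},\Lambda_{jk}$ for $\mathit{Lef}^s$; all $L_{jk},V_j,\Lambda_{jk},A_j$ for $\mathcal{L}^s_{\mathbb{R}}$; all $L_{jk},\sqrt{-1}V_j,\Lambda_{jk},\sqrt{-1}A_j$ for $\mathbf{s}\mathcal{L}^s$; all $\sqrt{-1}$-multiples of $L_{jk},V_j,\Lambda_{jk},A_j$ for $\mathbf{u}\mathcal{L}^s$; and $\mathcal{L}^s_{\mathbb{C}}=\mathcal{L}^s_{\mathbb{R}}\otimes_{\mathbb{R}}\mathbb{C}$. The natural flat connection meant is the one for which, over a connected open set $U$ on which $W_0$ is oriented, the flat sections are the elements of the (finite dimensional) Lie algebra generated (over $\mathbb{R}$, or over $\mathbb{C}$ for $\mathcal{L}^s_{\mathbb{C}}$) by the restrictions to $U$ of the listed generators. *)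

(* Defs.v *)
From HB Require Import structures.
From mathcomp Require Import all_boot all_order all_algebra.
From mathcomp Require Import all_classical all_reals.
From mathcomp Require Import complex.
From mathcomp Require Import topology normedtype derive.

Set Implicit Arguments.
Unset Strict Implicit.
Unset Printing Implicit Defensive.

Import Order.TTheory GRing.Theory Num.Theory.
Import numFieldNormedType.Exports.

Local Open Scope classical_set_scope.
Local Open Scope ring_scope.
Local Open Scope complex_scope.

Section Smoothness.
Variables (R : realType) (n : nat).

(* Meaningful for U open. *)
Fixpoint Ck (V : normedModType R) (k : nat) (U : set 'rV[R]_n)
    (f : 'rV[R]_n -> V) : Prop :=
  match k with
  | 0%N => forall x, U x -> {for x, continuous f}
  | k'.+1 => (forall x, U x -> differentiable f x) /\
      (forall a : 'I_n, Ck k' U (fun x => 'D_(delta_mx 0 a) f x))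
  end.

Definition smooth (V : normedModType R) (U : set 'rV[R]_n)
  (f : 'rV[R]_n -> V) : Prop := forall k, Ck k U f.

End Smoothness.

Section Manifolds.
Variables (R : realType) (n : nat).

(* [icoord] is the inverse of [coord] on [coord @` dom]; elsewhere it is
   arbitrary. *)
Record chart (X : topologicalType) := Chart {
  dom : set X;
  coord :> X -> 'rV[R]_n;
  icoord : 'rV[R]_n -> X;
  dom_open : open dom;
  cod_open : open (coord @` dom);
  coordK : forall p, dom p -> icoord (coord p) = p;
  coord_cts : forall p, dom p -> {for p, continuous coord};
  icoord_cts : forall p, dom p -> {for coord p, continuous icoord} }.

Definition smooth_transition (X : topologicalType) (c d : chart X) : Prop :=
  smooth (c @` (dom c `&` dom d)) (fun x => d (icoord c x)).

Record manifold := Manifold {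
  points :> topologicalType;
  manifold_hausdorff : hausdorff_space points;
  manifold_countable : @second_countable points;
  atlas : set (chart points);
  atlas_smooth : forall c d, atlas c -> atlas d -> smooth_transition c d;
  chart_at : points -> chart points;
  chart_at_atlas : forall p, atlas (chart_at p);
  chart_at_dom : forall p, dom (chart_at p) p }.

Variable X : manifold.

(* Charts of the maximal atlas, i.e. arbitrary smooth local coordinates. *)
Definition smooth_chart (c : chart X) : Prop :=
  forall d, atlas d -> smooth_transition c d /\ smooth_transition d c.

(* The tangent and cotangent spaces at q are both identified with 'rV[R]_n, by
   means of the preferred chart [chart_at q]. A tangent vector w at q has
   components [w *m jac e q] in the chart e. *)
Definition jac (e : chart X) (q : X) : 'M[R]_n :=
  jacobian (fun x => e (icoord (chart_at q) x)) (chart_at q q).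

(* A covector u has components [u *m cojac e q] in the chart e. *)
Definition cojac (e : chart X) (q : X) : 'M[R]_n := (invmx (jac e q))^T.

(* A tensor field enters through its components [comp e q] at q in the chart e,
   for e smooth and q in the domain of e. *)
Definition Ck_field (V : normedModType R) (k : nat) (U : set X)
    (comp : chart X -> X -> V) : Prop :=
  forall e, atlas e -> Ck k (e @` (U `&` dom e)) (fun x => comp e (icoord e x)).

Definition smooth_field (V : normedModType R) (U : set X)
  (comp : chart X -> X -> V) : Prop := forall k, Ck_field k U comp.

(* Derivative at p, in the direction of w, of the components in the chart e. *)
Definition dcomp (V : normedModType R) (comp : chart X -> X -> V)
    (e : chart X) (p : X) (w : 'rV[R]_n) : V :=
  'D_w (fun x => comp e (icoord e x)) (e p).

Definition fun_in (f : X -> R) (e : chart X) (q : X) : R^o := f q.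

Definition vec_in (Y : X -> 'rV[R]_n) (e : chart X) (q : X) : 'rV[R]_n :=
  Y q *m jac e q.

(* Bilinear forms b on the tangent spaces, b(w, w') = w *m b *m w'^T. *)
Definition bil_in (b : X -> 'M[R]_n) (e : chart X) (q : X) : 'M[R]_n :=
  (cojac e q)^T *m b q *m cojac e q.

Definition dfun (f : X -> R) (p : X) (w : 'rV[R]_n) : R :=
  dcomp (fun_in f) (chart_at p) p w.

Definition lie_bracket (Y Z : X -> 'rV[R]_n) (p : X) : 'rV[R]_n :=
  dcomp (vec_in Z) (chart_at p) p (Y p) - dcomp (vec_in Y) (chart_at p) p (Z p).

(* d w = 0, for a two-form w = sum_(a < b) w a b dx_a /\ dx_b. *)
Definition closed_form2 (w : X -> 'M[R]_n) : Prop :=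
  forall p (a b c : 'I_n),
    let dw d := dcomp (bil_in w) (chart_at p) p (delta_mx 0 d) in
    dw a b c + dw b c a + dw c a b = 0.

End Manifolds.

(* The exterior algebra of 'rV[R]_n has the basis e_S = e_i1 /\ ... /\ e_ik
   for S = {i1 < ... < ik}; its endomorphisms are matrices acting on columns, so
   that *m is composition. *)
Notation extdim n := #|{set 'I_n}|.

Section ExteriorAlgebra.
Variables (R : realType) (n : nat).

Definition index_set (p : 'I_(extdim n)) : {set 'I_n} := enum_val p.

(* x |-> u /\ x. *)
Definition wedge (u : 'rV[R]_n) : 'M[R]_(extdim n) :=
  \matrix_(p, q) \sum_(i | (i \notin index_set q) &&
                           (index_set p == i |: index_set q))
    (-1) ^+ #|[set j in index_set q | (j < i)%N]| * u 0 i.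

(* The two-form u /\ v. *)
Definition wedge2 (u v : 'rV[R]_n) : 'M[R]_n := u^T *m v - v^T *m u.

(* x |-> w /\ x, for the two-form w = sum_(a < b) w a b e_a /\ e_b. *)
Definition wedge_form2 (w : 'M[R]_n) : 'M[R]_(extdim n) :=
  \sum_(a < n) \sum_(b < n | (a < b)%N)
    w a b *: (wedge (delta_mx 0 a) *m wedge (delta_mx 0 b)).

(* The algebra endomorphism extending u |-> u *m M: it maps e_T to the product
   of the row i M, i in T, in increasing order. The entry in row S and column T
   is the minor det (M i j), i in T and j in S, or 0 if #|S| != #|T|. *)
Definition ext_mx (M : 'M[R]_n) : 'M[R]_(extdim n) :=
  \matrix_(p, q) (\big[mulmx/1%:M]_(i in index_set q) wedge (row i M))
    p (enum_rank (finset.set0 : {set 'I_n})).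

(* The derivation extending u |-> u *m M; (wedge e_c)^T is the contraction
   with the c-th basis vector. *)
Definition ext_der (M : 'M[R]_n) : 'M[R]_(extdim n) :=
  \sum_(c < n) wedge (row c M) *m (wedge (delta_mx 0 c))^T.

(* The adjoint for the inner product on the exterior algebra of the cotangent
   space induced by the metric g on the tangent space: the Gram matrix of the
   basis e_S has entries det ((g^-1) i j), i in S and j in T, that is, it is
   [ext_mx (invmx g)]. *)
Definition adjoint (g : 'M[R]_n) (A : 'M[R]_(extdim n)) : 'M[R]_(extdim n) :=
  let H := ext_mx (invmx g) in invmx H *m A^T *m H.

End ExteriorAlgebra.

Section ExteriorBundle.
Variables (R : realType) (n : nat) (X : manifold R n).

Local Notation N := (extdim n).

(* Fields of endomorphisms of the exterior algebras of the cotangent spaces. *)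
Definition end_in (T : X -> 'M[R]_N) (e : chart R n X) (q : X) : 'M[R]_N :=
  let P := ext_mx (cojac e q) in P *m T q *m invmx P.

Definition smooth_end (U : set X) (T : X -> 'M[R]_N) : Prop :=
  smooth_field U (end_in T).

Definition smooth_cend (U : set X) (T : X -> 'M[R[i]]_N) : Prop :=
  smooth_end U (fun p => map_mx (@complex.Re R) (T p)) /\
  smooth_end U (fun p => map_mx (@complex.Im R) (T p)).

(* [christoffel g p a b c] is the symbol Gamma^c_{ab} of the Levi-Civita
   connection at p in the chart [chart_at p]. *)
Definition christoffel (g : X -> 'M[R]_n) (p : X) (a b c : 'I_n) : R :=
  let dg d := dcomp (bil_in g) (chart_at p) p (delta_mx 0 d) in
  2^-1 * \sum_(d < n) invmx (g p) c d * (dg a b d + dg b a d - dg d a b).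

(* The Levi-Civita connection on endomorphisms of the exterior bundle: it acts
   on the exterior algebra by the derivation extending
   nabla_a dx_c = - sum_b Gamma^c_{ab} dx_b, and on endomorphisms by the
   Leibniz rule for the evaluation. *)
Definition levi_civita (g : X -> 'M[R]_n) (T : X -> 'M[R]_N) (p : X)
    (w : 'rV[R]_n) : 'M[R]_N :=
  let G := ext_der (\matrix_(c, b) - \sum_(a < n) w 0 a * christoffel g p a b c)
  in dcomp (end_in T) (chart_at p) p w + (G *m T p - T p *m G).

Definition parallel (g : X -> 'M[R]_n) (U : set X) (T : X -> 'M[R]_N) : Prop :=
  smooth_end U T /\ forall p w, U p -> levi_civita g T p w = 0.

End ExteriorBundle.

Section AlmostSKahler.
Variables (R : realType) (s : nat).

Local Notation n := (2 * s.+1)%N.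
Local Notation N := (extdim n).

(* The differential of the coordinate y^j_i, where y^0_i stands for x_i. *)
Definition dy (j : 'I_s.+1) (i : 'I_2) : 'rV[R]_n := delta_mx 0 (mxvec_index i j).

Definition coframe := 'I_2 -> 'I_s.+1 -> 'rV[R]_n.

Variable X : manifold R n.

Definition orthonormal (g : 'M[R]_n) (v : coframe) : Prop :=
  forall i j i' j', (v i j *m invmx g *m (v i' j')^T) 0 0
                    = ((i == i') && (j == j'))%:R.

Definition adapted (g : X -> 'M[R]_n) (w : 'I_s.+1 -> 'I_s.+1 -> X -> 'M[R]_n)
    (p : X) (v : coframe) : Prop :=
  orthonormal (g p) v /\
  forall j k, w j k p = \sum_(i < 2) wedge2 (v i j) (v i k).

Definition darboux (w : 'I_s.+1 -> 'I_s.+1 -> X -> 'M[R]_n) (e : chart R n X) :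
    Prop :=
  smooth_chart e /\
  forall (j : 'I_s.+1) q, j != ord0 -> dom e q ->
    bil_in (w ord0 j) e q = \sum_(i < 2) wedge2 (dy ord0 i) (dy j i).

Record almost_sKahler := AlmostSKahler {
  metric : X -> 'M[R]_n;
  omega : 'I_s.+1 -> 'I_s.+1 -> X -> 'M[R]_n;
  metric_smooth : smooth_field setT (bil_in metric);
  metric_sym : forall p, (metric p)^T = metric p;
  metric_pos : forall p (w : 'rV[R]_n), w != 0 -> 0 < (w *m metric p *m w^T) 0 0;
  omega_smooth : forall j k, smooth_field setT (bil_in (omega j k));
  omega_alt : forall j k p, (omega j k p)^T = - omega j k p;
  omega_closed : forall j, j != ord0 -> closed_form2 (omega ord0 j);
  omega_darboux : forall p, exists2 e, dom e p & darboux omega e;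
  omega_adapted : forall p, exists v, adapted metric omega p v }.

Variable K : almost_sKahler.

(* The components of the metric have value 1 and vanishing first derivatives
   at p: metric = sum of squares + O(2). *)
Definition sKahler : Prop :=
  forall p, exists e, [/\ dom e p, darboux (omega K) e,
    bil_in (metric K) e p = 1%:M &
    forall w, dcomp (bil_in (metric K)) e p w = 0].

Inductive generator :=
  | GenL of 'I_s.+1 & 'I_s.+1
  | GenLambda of 'I_s.+1 & 'I_s.+1
  | GenV of 'I_s.+1
  | GenA of 'I_s.+1.

Definition L_op (j k : 'I_s.+1) (p : X) : 'M[R]_N := wedge_form2 (omega K j k p).

Definition Lambda_op (j k : 'I_s.+1) (p : X) : 'M[R]_N :=
  adjoint (metric K p) (L_op j k p).

Definition V_op (v : X -> coframe) (j : 'I_s.+1) (p : X) : 'M[R]_N :=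
  wedge (v p ord0 j) *m wedge (v p ord_max j).

Definition A_op (v : X -> coframe) (j : 'I_s.+1) (p : X) : 'M[R]_N :=
  adjoint (metric K p) (V_op v j p).

Definition generator_op (v : X -> coframe) (x : generator) : X -> 'M[R]_N :=
  match x with
  | GenL j k => L_op j k
  | GenLambda j k => Lambda_op j k
  | GenV j => V_op v j
  | GenA j => A_op v j
  end.

(* An orientation of the distribution W_0 over U. It is represented by adapted
   coframes v p at the points p of U, of which only the continuity of the unit
   area form of W_0 is required: by the O(2)-ambiguity of adapted coframes, the
   operators V_j, A_j depend only on that form. *)
Definition orients (U : set X) (v : X -> coframe) : Prop :=
  (forall p, U p -> adapted (metric K) (omega K) p (v p)) /\
  Ck_field 0 U (bil_in (fun p => wedge2 (v p ord0 ord0) (v p ord_max ord0))).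

End AlmostSKahler.

Section LieAlgebras.
Variables (R : realType) (V : lmodType R[i]) (br : V -> V -> V).

(* The Lie algebra generated by S over the subfield F of the complex numbers. *)
Inductive lie_span (F : set R[i]) (S : set V) : V -> Prop :=
  | lie_span_gen x of S x : lie_span F S x
  | lie_span_0 : lie_span F S 0
  | lie_span_add x y of lie_span F S x & lie_span F S y : lie_span F S (x + y)
  | lie_span_scale a x of F a & lie_span F S x : lie_span F S (a *: x)
  | lie_span_br x y of lie_span F S x & lie_span F S y : lie_span F S (br x y).

End LieAlgebras.

Section Bundles.
Variables (R : realType) (s : nat) (X : manifold R (2 * s.+1)).
Variable K : almost_sKahler X.

Local Notation n := (2 * s.+1)%N.
Local Notation N := (extdim n).
Local Notation M := 'M[R[i]]_N.

Definition commutator (A B : M) : M := A *m B - B *m A.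

Definition fcommutator (A B : X -> M) : X -> M := fun p => commutator (A p) (B p).

Inductive bundle := Lef | LR | sL | uL | LC.

Definition reals : set R[i] := range (real_complex R).

Definition scalars (b : bundle) : set R[i] := if b is LC then setT else reals.

Definition listed (b : bundle) (x : generator s) : Prop :=
  match x with
  | GenL j k | GenLambda j k => j != k
  | GenV _ | GenA _ => b <> Lef
  end.

Definition coefficient (b : bundle) (x : generator s) : R[i] :=
  match b, x with
  | uL, _ | sL, GenV _ | sL, GenA _ => 'i
  | _, _ => 1
  end.

Definition generator_section (b : bundle) (v : X -> coframe R s)
    (x : generator s) : X -> M :=
  fun p => coefficient b x *: map_mx (real_complex R) (generator_op K v x p).

(* Generators at p; both orientations of W_0 at p contribute. *)
Definition generators_at (b : bundle) (p : X) : set M :=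
  [set A | exists v x, [/\ adapted (metric K) (omega K) p (v p), listed b x &
                          A = generator_section b v x p]].

Definition real_fibre (b : bundle) (p : X) : set M :=
  lie_span commutator reals (generators_at b p).

(* The generators of LR are real, so its complexification is LR + i LR inside
   the complex endomorphisms. *)
Definition fibre (b : bundle) (p : X) : set M :=
  if b is LC then
    [set C | exists A B, [/\ real_fibre LR p A, real_fibre LR p B & C = A + 'i *: B]]
  else real_fibre b p.

Definition section_over (b : bundle) (U : set X) (f : X -> M) : Prop :=
  smooth_cend U f /\ forall p, U p -> fibre b p (f p).

(* The Lie algebra generated by the restrictions to U of the listed generators;
   two fields are identified when they agree on U. *)
Definition generated_over (b : bundle) (v : X -> coframe R s) (U : set X)
    (f : X -> M) : Prop :=
  exists2 h, lie_span fcommutator (scalars b)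
               [set generator_section b v x | x in [set x | listed b x]] h
           & forall p, U p -> f p = h p.

(* [D p w f] is the covariant derivative at p in the direction w of a local
   section f near p. *)
Definition covariant_derivative := X -> 'rV[R]_n -> (X -> M) -> M.

Record is_connection (b : bundle) (D : covariant_derivative) : Prop :=
  IsConnection {
    conn_fibre : forall U f p w, open U -> U p -> section_over b U f ->
      fibre b p (D p w f);
    conn_local : forall U f h p w, open U -> U p ->
      section_over b U f -> section_over b U h ->
      (forall q, U q -> f q = h q) -> D p w f = D p w h;
    conn_dir : forall U f p a w w', open U -> U p -> section_over b U f ->
      D p (a *: w + w') f = a%:C *: D p w f + D p w' f;
    conn_add : forall U f h p w, open U -> U p ->
      section_over b U f -> section_over b U h ->
      D p w (f + h) = D p w f + D p w h;
    conn_scale : forall U f p w c, open U -> U p -> section_over b U f ->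
      scalars b c -> D p w (c *: f) = c *: D p w f;
    conn_leibniz : forall U f (u : X -> R) p w, open U -> U p ->
      section_over b U f -> smooth_field U (fun_in u) ->
      D p w (fun q => (u q)%:C *: f q)
        = (dfun u p w)%:C *: f p + (u p)%:C *: D p w f;
    conn_smooth : forall U f (Y : X -> 'rV[R]_n), open U -> section_over b U f ->
      smooth_field U (vec_in Y) -> smooth_cend U (fun p => D p (Y p) f) }.

Definition flat (b : bundle) (D : covariant_derivative) : Prop :=
  forall U f (Y Z : X -> 'rV[R]_n) p, open U -> U p -> section_over b U f ->
    smooth_field U (vec_in Y) -> smooth_field U (vec_in Z) ->
    D p (Y p) (fun q => D q (Z q) f) - D p (Z p) (fun q => D q (Y q) f)
      - D p (lie_bracket Y Z p) f = 0.

Definition flat_section (b : bundle) (D : covariant_derivative) (U : set X)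
    (f : X -> M) : Prop :=
  section_over b U f /\ forall p w, U p -> D p w f = 0.

Definition natural (b : bundle) (D : covariant_derivative) : Prop :=
  forall U v, open U -> connected U -> orients K U v ->
    forall f, flat_section b D U f <-> generated_over b v U f.

Definition compatible (b b' : bundle) (D D' : covariant_derivative) : Prop :=
  (forall p, fibre b p `<=` fibre b' p) ->
  forall U f p w, open U -> U p -> section_over b U f -> D' p w f = D p w f.

End Bundles.

(* Main.v *)
(** Two adapted coframes differ by a matrix b of O(2): for s >= 2 the forms
    omega_0j determine W_0, and contraction with them recovers the rest of the
    coframe. In an adapted coframe every generator has constant components, and
    b fixes L_jk, Lambda_jk and multiplies V_j, A_j by det b. Smooth adapted
    coframes exist: in coordinates where the omega_0j are constant,
    orthonormalize dx_1, dx_2 and contract with the omega_0j. Differentiating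
    the components of a section does not depend on the smooth adapted coframe
    used: SO(2) acts trivially on the fibres, and a reflection acts by a constant
    matrix. This is the flat connection, whose flat sections have constant
    components. In the s-Kahler case the coframe obtained from the coordinates
    adapted to p has constant coefficients to first order at p, where moreover
    the Christoffel symbols vanish, so the generators are parallel at p. *)

(* Conjugation by [ext_mx (frame_mx v)] turns a section into a function with values in one fixed
   real subspace [std_fibre b] of complex matrices. A subspace is cut out by linear equations, which
   pass to derivatives; hence the connection preserves the fibres. Its curvature vanishes by the
   symmetry of second derivatives. The coframes of [orients] need not vary smoothly, only their area
   form is continuous. They are therefore never differentiated: near each point they are compared
   with a smooth frame, and the continuity of the area form keeps the two orientations equal or
   opposite. The tensor [levi_civita] is written in the preferred chart at p, not in the chart
   adapted to p, so its Christoffel symbols need not vanish. The derivative of [ext_mx] is a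
   derivation composed with [ext_mx], which reduces the computation to matrices of size n; there the
   Christoffel term and the variation of the frame both come from the Jacobian between the two
   charts, and they cancel. *)
From HB Require Import structures.
Require Import Defs.
From mathcomp Require Import all_boot all_order all_algebra.
From mathcomp Require Import all_classical all_reals.
From mathcomp Require Import complex topology normedtype derive landau realfun.
From mathcomp Require Import ring lra.

Set Implicit Arguments.
Unset Strict Implicit.
Unset Printing Implicit Defensive.

Import Order.TTheory GRing.Theory Num.Theory.
Import numFieldNormedType.Exports.

Local Open Scope classical_set_scope.
Local Open Scope ring_scope.
Local Open Scope complex_scope.

Local Notation orthonormal := Defs.orthonormal.
Local Notation "A %:CM" := (map_mx (real_complex _) A) (at level 2, format "A %:CM").
Local Notation mRe := (map_mx (@complex.Re _)).
Local Notation mIm := (map_mx (@complex.Im _)).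

(** * Endomorphisms of the exterior algebra *)

Section ExteriorAlgebra.
Variables (R : realType) (n : nat).
Local Notation N := (extdim n).
Implicit Types (S : {set 'I_n}) (i j : 'I_n) (u v : 'rV[R]_n) (A B : 'M[R]_n).

Fact mulmx_isLaw : Monoid.isLaw 'M[R]_N 1%:M (@mulmx R N N N).
Proof. by split=> [? ? ?|?|?]; rewrite ?mulmxA ?mul1mx ?mulmx1. Qed.
HB.instance Definition _ := mulmx_isLaw.

(** The sign picked up when e_i, wedged in front of e_S, is moved to its place in increasing
    order. *)
Definition ext_sign i S : R := (-1) ^+ #|[set j in S | (j < i)%N]|.

Definition ext_basis S : 'cV[R]_N := delta_mx (enum_rank S) 0.

Lemma ext_basisP m (Y Z : 'M[R]_(m, N)) :
  (forall S, Y *m ext_basis S = Z *m ext_basis S) -> Y = Z.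
Proof.
move=> YZ; apply/matrixP => i p; have := YZ (enum_val p).
by rewrite /ext_basis enum_valK -!colE => /colP/(_ i); rewrite !mxE.
Qed.

Lemma wedge_is_linear : linear (@wedge R n).
Proof.
move=> a u v; apply/matrixP => p q; rewrite !mxE mulr_sumr -big_split/=.
by apply: eq_bigr => i _; rewrite !mxE mulrDr mulrCA.
Qed.
HB.instance Definition _ := GRing.isLinear.Build R 'rV[R]_n 'M[R]_N _
  (@wedge R n) wedge_is_linear.

Lemma wedge_sum u : wedge u = \sum_i u 0 i *: wedge (delta_mx 0 i).
Proof.
by rewrite {1}[u]row_sum_delta linear_sum/=; apply: eq_bigr => i _; rewrite linearZ.
Qed.

Lemma wedge_basis i S : wedge (delta_mx 0 i) *m ext_basis S =
  if i \in S then 0 else ext_sign i S *: ext_basis (i |: S).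
Proof.
apply/colP => p; rewrite -colE !mxE /index_set enum_rankK.
rewrite big_mkcond (bigD1 i)//= big1 ?addr0; last first.
  by move=> k /negPf ki; rewrite !mxE ki andbF mulr0 if_same.
rewrite !mxE !eqxx mulr1; case: ifPn => [/andP[iS /eqP pE]|].
  by rewrite (negPf iS) !mxE -pE enum_valK !eqxx mulr1.
rewrite negb_and negbK; case: ifPn => [_ _|iS /= pE]; first by rewrite mxE.
rewrite !mxE eqxx andbT; have [pS|_] := eqVneq p; last by rewrite mulr0.
by rewrite pS enum_rankK eqxx in pE.
Qed.

Lemma ext_sign_setU1 i j S : j \notin S ->
  ext_sign i (j |: S) = (-1) ^+ (j < i)%N * ext_sign i S.
Proof.
move=> jS; rewrite /ext_sign; case: ltnP => ji.
  have -> : [set k in j |: S | (k < i)%N] = j |: [set k in S | (k < i)%N].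
    apply/setP => k; rewrite !inE; case: (eqVneq k j) => //= ->.
    by rewrite ji.
  by rewrite cardsU1 inE (negPf jS)/= add1n exprS expr1.
rewrite mul1r; congr (_ ^+ #|pred_of_set _|); apply/setP => k; rewrite !inE.
by case: (eqVneq k j) => //= ->; rewrite ltnNge ji andbF.
Qed.

Lemma ext_signK i S : ext_sign i S * ext_sign i S = 1.
Proof. by rewrite /ext_sign -expr2 sqrr_sign. Qed.

Lemma ext_sign_swap i j S : i != j -> i \notin S -> j \notin S ->
  ext_sign j S * ext_sign i (j |: S) = - (ext_sign i S * ext_sign j (i |: S)).
Proof.
move=> ij iS jS; rewrite !ext_sign_setU1//.
rewrite mulrCA [ext_sign i S * _]mulrCA [ext_sign j S * _]mulrC -mulNr.
by congr (_ * _); case: ltngtP ij => [||/val_inj->]; rewrite ?eqxx// expr0 expr1 ?opprK.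
Qed.

Lemma contract_basis i S : (wedge (delta_mx 0 i))^T *m ext_basis S =
  if i \in S then ext_sign i (S :\ i) *: ext_basis (S :\ i) else 0.
Proof.
(* Row p of the transpose is column p of [wedge], which [wedge_basis] gives. *)
apply/colP => p; rewrite -colE; move: (wedge_basis i (enum_val p)).
rewrite /ext_basis enum_valK -colE => /colP/(_ (enum_rank S)).
rewrite !mxE => ->.
have [pi|pi] := boolP (i \in enum_val p).
  rewrite mxE; case: ifPn => iS; rewrite ?mxE//.
  have -> : (p == enum_rank (S :\ i)) = false.
    by apply/negbTE/eqP => pE; rewrite pE enum_rankK !inE eqxx in pi.
  by rewrite mulr0.
rewrite !mxE (inj_eq enum_rank_inj).
case: ifPn => iS; rewrite ?mxE; last first.
  have -> : (S == i |: enum_val p) = false.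
    by apply/negbTE/eqP => SE; rewrite SE !inE eqxx in iS.
  by rewrite mulr0.
rewrite !andbT.
have -> : (p == enum_rank (S :\ i)) = (S == i |: enum_val p).
  apply/eqP/eqP => [->|->]; first by rewrite enum_rankK finset.setD1K.
  by rewrite finset.setU1K// enum_valK.
case: eqP => [->|_]; rewrite ?mulr0 // finset.setU1K//.
Qed.

Lemma wedge_deltaC i j :
  wedge (delta_mx 0 i) *m wedge (delta_mx 0 j)
    = - (wedge (delta_mx 0 j) *m wedge (delta_mx 0 i)) :> 'M[R]_N.
Proof.
apply: ext_basisP => S; rewrite mulNmx -!mulmxA !wedge_basis.
have [->|ij] := eqVneq i j.
  case: ifPn => jS; first by rewrite mulmx0 oppr0.
  by rewrite -scalemxAr wedge_basis finset.setU11 scaler0 oppr0.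
case: ifPn => jS; case: ifPn => iS; rewrite ?mulmx0 ?oppr0 // -?scalemxAr
  ?wedge_basis ?inE ?iS ?jS ?orbT ?scaler0 ?oppr0//.
rewrite (negPf ij) eq_sym (negPf ij) (negPf iS) (negPf jS) !scalerA ext_sign_swap// scaleNr.
by rewrite finset.setUCA.
Qed.

(** The canonical anticommutation relations. For i = j exactly one of the two orders survives on
    each basis element; for i != j, removing i and inserting j in the two orders gives opposite
    signs, because exactly one of i < j and j < i holds. *)
Lemma contract_wedge_delta i j :
  (wedge (delta_mx 0 i))^T *m wedge (delta_mx 0 j)
    + wedge (delta_mx 0 j) *m (wedge (delta_mx 0 i))^T = (i == j)%:R%:M :> 'M[R]_N.
Proof.
apply: ext_basisP => S; rewrite mulmxDl -!mulmxA wedge_basis contract_basis mul_scalar_mx.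
have [->|ij] := eqVneq i j.
  rewrite scale1r; case: ifPn => jS.
    rewrite mulmx0 add0r -scalemxAr wedge_basis !inE eqxx/= scalerA.
    by rewrite ext_signK scale1r finset.setD1K.
  rewrite mulmx0 addr0 -scalemxAr contract_basis finset.setU11 finset.setU1K// scalerA.
  by rewrite ext_signK scale1r.
rewrite scale0r; case: ifPn => jS; case: ifPn => iS;
  rewrite ?mulmx0 ?addr0 ?add0r // -?scalemxAr ?wedge_basis ?contract_basis ?inE.
- by rewrite eq_sym ij jS scaler0.
- rewrite iS orbT eq_sym (negPf ij) (negPf jS) /= !scalerA.
  have iE : (j |: S) :\ i = j |: (S :\ i).
    by apply/setP => k; rewrite !inE; have [->|] := eqVneq k j; rewrite // eq_sym ij.
  rewrite iE -scalerDl -[in ext_sign j S](finset.setD1K iS).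
  rewrite !ext_sign_setU1 ?inE ?eqxx ?(negPf jS) ?andbF//.
  have ss : (-1) ^+ (i < j)%N * (-1) ^+ (j < i)%N = -1 :> R.
    by case: ltngtP ij => [||/val_inj->]; rewrite ?eqxx// expr0 expr1 ?mulr1 ?mul1r.
  by rewrite [X in X + _]mulrACA ss mulN1r [X in _ + X]mulrC addNr scale0r.
- by rewrite (negPf iS) (negPf ij) scaler0.
Qed.

Lemma wedgeC u v : wedge u *m wedge v = - (wedge v *m wedge u).
Proof.
rewrite [wedge u]wedge_sum [wedge v]wedge_sum !mulmx_suml -sumrN.
under eq_bigr do rewrite mulmx_sumr.
rewrite exchange_big/=; apply: eq_bigr => i _.
rewrite mulmx_sumr -sumrN; apply: eq_bigr => j _.
by rewrite -!scalemxAl -!scalemxAr wedge_deltaC !scalerN scalerA mulrC -scalerA.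
Qed.

Lemma wedge_sqr u : wedge u *m wedge u = 0.
Proof.
have /eqP := wedgeC u u.
by rewrite -addr_eq0 -mulr2n -scaler_nat scaler_eq0 pnatr_eq0 => /eqP.
Qed.

Lemma contract_wedge u v : (wedge u)^T *m wedge v + wedge v *m (wedge u)^T
  = ((u *m v^T) 0 0)%:M.
Proof.
have ct : (wedge u)^T = \sum_i u 0 i *: (wedge (delta_mx 0 i))^T :> 'M[R]_N.
  by rewrite wedge_sum linear_sum; apply: eq_bigr => i _; rewrite linearZ.
rewrite ct mulmx_suml mulmx_sumr -big_split mxE raddf_sum/=.
apply: eq_bigr => i _; rewrite -scalemxAl -scalemxAr -scalerDr.
rewrite [wedge v]wedge_sum mulmx_sumr mulmx_suml -big_split/=.
rewrite (bigD1 i)//= big1 ?addr0 => [|j ji];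
  rewrite -scalemxAl -scalemxAr -scalerDr contract_wedge_delta.
  by rewrite eqxx !scale_scalar_mx mulr1 mxE.
by rewrite eq_sym (negPf ji) scale_scalar_mx mulr0 raddf0.
Qed.

(** * The exterior extension of a linear map *)

Lemma index_enum_ord_split i : exists l1 l2,
  [/\ index_enum 'I_n = l1 ++ i :: l2, {in l1, forall j : 'I_n, (j < i)%N} &
      {in l2, forall j : 'I_n, (i < j)%N}].
Proof.
have /splitPr sp := mem_index_enum i.
have : pairwise ltn (map val (index_enum 'I_n)).
  rewrite -(sorted_pairwise ltn_trans).
  have -> : index_enum 'I_n = enum 'I_n by rewrite enumT [index_enum _]unlock.
  by rewrite val_enum_ord iota_ltn_sorted.
case: sp => l1 l2; rewrite map_cat pairwise_cat/= => /and4P[/allrelP l1i _ il2 _].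
exists l1, l2; split => // j jl.
  by apply: l1i; rewrite ?mem_head// map_f.
by move/allP : il2; apply; rewrite map_f.
Qed.

(** The factor [W i] travels right through the factors of smaller index, each costing a sign, so the
    total sign is that of [wedge_basis]. If i is in S, it then meets its own copy and squares to
    zero. *)
Lemma mulmx_big_anticomm (W : 'I_n -> 'M[R]_N) i S :
  (forall i j, W i *m W j = - (W j *m W i)) -> W i *m W i = 0 ->
  W i *m \big[mulmx/1%:M]_(j in S) W j =
    if i \in S then 0 else ext_sign i S *: \big[mulmx/1%:M]_(j in i |: S) W j.
Proof.
move=> WC W0.
have Wl l : W i *m \big[mulmx/1%:M]_(j <- l | j \in S) W j =
    (-1) ^+ count [in S] l *: (\big[mulmx/1%:M]_(j <- l | j \in S) W j *m W i).
  elim: l => [|j l IH]; first by rewrite !big_nil scale1r mulmx1 mul1mx.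
  rewrite !big_cons/=; case: ifPn => // jS.
  rewrite [LHS]mulmxA WC mulNmx -[X in - X]mulmxA IH -scalemxAr mulmxA.
  by rewrite exprS mulN1r scaleNr.
have [l1 [l2 [il l1P l2P]]] := index_enum_ord_split i.
have sE : ext_sign i S = (-1) ^+ count [in S] l1.
  rewrite /ext_sign -sum1_card il big_cat big_cons/= inE ltnn andbF.
  rewrite [X in (_ + X)%N]big_seq_cond [X in (_ + X)%N]big_pred0 ?addn0; last first.
    move=> j; apply/negbTE/negP => /andP[/l2P ij].
    by rewrite inE ltnNge (ltnW ij) andbF.
  rewrite big_seq_cond -sum1_count [in RHS]big_seq_cond; congr (_ ^+ _).
  apply: eq_bigl => j; rewrite inE; have [/l1P ->|//] := boolP (j \in l1).
  by rewrite andbT.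
rewrite il !big_cat !big_cons/= mulmxA Wl -scalemxAl -mulmxA.
case: ifPn => iS; first by rewrite [W i *m (W i *m _)]mulmxA W0 mul0mx mulmx0 scaler0.
have big_setU1_notin l : i \notin l ->
    \big[mulmx/1%:M]_(j <- l | j \in i |: S) W j = \big[mulmx/1%:M]_(j <- l | j \in S) W j.
  move=> il'; rewrite big_seq_cond [RHS]big_seq_cond; apply: eq_bigl => j.
  by rewrite !inE; have [->|] := eqVneq j i; rewrite // (negPf il').
rewrite !inE eqxx/= sE !big_setU1_notin//.
  by apply/negP => /l2P; rewrite ltnn.
by apply/negP => /l1P; rewrite ltnn.
Qed.

Lemma ext_mx_basis A S : ext_mx A *m ext_basis S =
  (\big[mulmx/1%:M]_(i in S) wedge (row i A)) *m ext_basis finset.set0.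
Proof.
by rewrite -!colE; apply/colP => p; rewrite !mxE /index_set enum_rankK.
Qed.

Lemma ext_mx_basis0 A : ext_mx A *m ext_basis finset.set0 = ext_basis finset.set0.
Proof. by rewrite ext_mx_basis big1 ?mul1mx// => i; rewrite inE. Qed.

(** By linearity u may be a basis covector; the rows of A anticommute as the covectors do, so
    sorting costs the same sign on both sides. Together with [ext_mx_basis0] this characterises
    [ext_mx A] as an algebra morphism. *)
Lemma ext_mx_wedge A u : ext_mx A *m wedge u = wedge (u *m A) *m ext_mx A.
Proof.
rewrite [wedge u]wedge_sum mulmx_sumr [u *m A]mulmx_sum_row linear_sum/= mulmx_suml.
apply: eq_bigr => i _; rewrite -scalemxAr linearZ -scalemxAl/=.
congr (_ *: _).
apply: ext_basisP => S; rewrite -!mulmxA wedge_basis ext_mx_basis mulmxA.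
rewrite mulmx_big_anticomm; [|by move=> j k; exact: wedgeC|exact: wedge_sqr].
by case: ifP => _; rewrite ?mulmx0 ?mul0mx// -scalemxAr ext_mx_basis -scalemxAl.
Qed.

(** Wedging with covectors generates the exterior algebra from 1, so a matrix that intertwines
    wedging and kills 1 is zero. Identities for [ext_mx] follow by applying this to the difference
    of their sides. *)
Lemma ext_basis_ind m (Z : 'M[R]_(m, N)) : Z *m ext_basis finset.set0 = 0 ->
  (forall i, exists Y, Z *m wedge (delta_mx 0 i) = Y *m Z) -> Z = 0.
Proof.
move=> Z0 ZW; apply: ext_basisP => S; rewrite mul0mx.
have [k] := ubnP #|S|; elim: k S => // k IH S.
have [->//|[i iS]] := set_0Vmem S; rewrite (cardsD1 i) iS ltnS => Sk.
have [Y ZY] := ZW i.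
have := wedge_basis i (S :\ i); rewrite !inE eqxx/= finset.setD1K// => wS.
have -> : ext_basis S = ext_sign i (S :\ i) *: (wedge (delta_mx 0 i) *m ext_basis (S :\ i)).
  by rewrite wS scalerA ext_signK scale1r.
by rewrite -scalemxAr mulmxA ZY -mulmxA IH// mulmx0 scaler0.
Qed.

Lemma ext_mx_unique A (X : 'M[R]_N) : X *m ext_basis finset.set0 = ext_basis finset.set0 ->
  (forall i, X *m wedge (delta_mx 0 i) = wedge (delta_mx 0 i *m A) *m X) ->
  X = ext_mx A.
Proof.
move=> X0 XW; apply/eqP; rewrite -subr_eq0; apply/eqP/ext_basis_ind.
  by rewrite mulmxBl X0 ext_mx_basis0 subrr.
move=> i; exists (wedge (delta_mx 0 i *m A)).
by rewrite mulmxBl XW ext_mx_wedge mulmxBr.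
Qed.

Lemma ext_mx1 : ext_mx 1%:M = 1%:M :> 'M[R]_N.
Proof.
by apply/esym/ext_mx_unique => [|i]; rewrite mul1mx// !mulmx1.
Qed.

Lemma ext_mxM A B : ext_mx (A *m B) = ext_mx B *m ext_mx A.
Proof.
apply/esym/ext_mx_unique => [|i]; rewrite -mulmxA ?ext_mx_basis0//.
by rewrite ext_mx_wedge mulmxA ext_mx_wedge !mulmxA.
Qed.

Lemma ext_mx_unit A : A \in unitmx -> ext_mx A \in unitmx.
Proof.
by move=> Au; case: (@mulmx1_unit _ _ (ext_mx A) (ext_mx (invmx A))); rewrite // -ext_mxM mulVmx ?ext_mx1.
Qed.

Lemma ext_basis0_wedge u : (ext_basis finset.set0)^T *m wedge u = 0.
Proof.
rewrite wedge_sum mulmx_sumr big1// => i _; rewrite -scalemxAr.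
rewrite -[X in _ *: X]trmxK trmx_mul trmxK contract_basis inE.
by rewrite trmx0 scaler0.
Qed.

Lemma ext_basis0_ext_mx A :
  (ext_basis finset.set0)^T *m ext_mx A = (ext_basis finset.set0)^T.
Proof.
apply/eqP; rewrite -subr_eq0; apply/eqP/ext_basis_ind.
  by rewrite mulmxBl -mulmxA ext_mx_basis0 subrr.
move=> i; exists 0; rewrite mul0mx mulmxBl -mulmxA ext_mx_wedge mulmxA.
by rewrite !ext_basis0_wedge mul0mx subrr.
Qed.

(** Contraction is moved through wedging by [contract_wedge]; the two scalars that appear agree,
    since u *m (e_i *m A)^T = (u *m A^T) *m e_i^T. Transposed, this is the relation that identifies
    the transpose of [ext_mx A]. *)
Lemma contract_ext_mx A u :
  (wedge u)^T *m ext_mx A = ext_mx A *m (wedge (u *m A^T))^T.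
Proof.
apply/eqP; rewrite -subr_eq0; apply/eqP/ext_basis_ind.
  rewrite mulmxBl -!mulmxA ext_mx_basis0 -[ext_basis _]trmxK -!trmx_mul.
  by rewrite !ext_basis0_wedge trmx0 mulmx0 subrr.
move=> i; exists (- wedge (delta_mx 0 i *m A)).
have cw v w : (wedge v)^T *m wedge w = ((v *m w^T) 0 0)%:M - wedge w *m (wedge v)^T :> 'M[R]_N.
  by rewrite -contract_wedge addrK.
rewrite mulmxBl -!mulmxA ext_mx_wedge cw mulmxBr !mulmxA cw ext_mx_wedge.
rewrite mulmxBl [('e_i *m A)^T]trmx_mul mulmxA mul_mx_scalar mul_scalar_mx.
rewrite opprB addrCA [X in _ + (X - _)]addrC addrK.
by rewrite mulmxBr !mulNmx opprK !mulmxA addrC.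
Qed.

Lemma ext_mx_tr A : ext_mx A^T = (ext_mx A)^T.
Proof.
apply/esym/ext_mx_unique => [|i].
  by rewrite -[ext_basis _]trmxK -trmx_mul ext_basis0_ext_mx.
have := contract_ext_mx A (delta_mx 0 i) => /(congr1 trmx).
by rewrite !trmx_mul !trmxK.
Qed.

Lemma ext_der_basis0 A : ext_der A *m ext_basis finset.set0 = 0.
Proof.
rewrite mulmx_suml big1// => i _.
by rewrite -mulmxA contract_basis inE mulmx0.
Qed.

(** The Leibniz rule: the sign from moving the contraction past u cancels the sign from exchanging
    the two wedge factors. *)
Lemma ext_der_wedge A u :
  ext_der A *m wedge u = wedge (u *m A) + wedge u *m ext_der A.
Proof.
rewrite mulmx_suml mulmx_sumr mulmx_sum_row linear_sum -big_split/=.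
apply: eq_bigr => i _; rewrite -mulmxA linearZ/=.
have := contract_wedge (delta_mx 0 i) u => /(canRL (addrK _)) ->.
rewrite mulmxBr !mulmxA [wedge (row i A) *m wedge u]wedgeC mulNmx opprK.
by rewrite mul_mx_scalar -rowE !mxE.
Qed.

(* The relations satisfied by the derivative of [ext_mx V] along V', obtained
   by differentiating [ext_mx_basis0] and [ext_mx_wedge], determine it. *)
Lemma ext_mx_derivative_unique (V V' : 'M[R]_n) (E' : 'M[R]_N) : V \in unitmx ->
  E' *m ext_basis finset.set0 = 0 ->
  (forall i, E' *m wedge (delta_mx 0 i) = wedge (delta_mx 0 i *m V') *m ext_mx V
      + wedge (delta_mx 0 i *m V) *m E') ->
  E' = ext_der (invmx V *m V') *m ext_mx V.
Proof.
move=> Vu E0 EW; apply/eqP; rewrite -subr_eq0; apply/eqP/ext_basis_ind.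
  by rewrite mulmxBl -mulmxA ext_mx_basis0 E0 ext_der_basis0 subrr.
move=> i; exists (wedge (delta_mx 0 i *m V)).
rewrite mulmxBl EW -mulmxA ext_mx_wedge mulmxA ext_der_wedge mulmxDl.
rewrite [_ *m V *m _]mulmxA mulmxK// mulmxBr !mulmxA.
by rewrite [X in X - _]addrC addrKA.
Qed.

Lemma wedge_form2_is_linear : linear (@wedge_form2 R n).
Proof.
move=> a u v; rewrite /wedge_form2 scaler_sumr -big_split/=; apply: eq_bigr => i _.
rewrite scaler_sumr -big_split/=; apply: eq_bigr => j _.
by rewrite !mxE scalerDl scalerA.
Qed.
HB.instance Definition _ := GRing.isLinear.Build R 'M[R]_n 'M[R]_N _
  (@wedge_form2 R n) wedge_form2_is_linear.

Lemma wedge_form2_wedge2 u v : wedge_form2 (wedge2 u v) = wedge u *m wedge v.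
Proof.
pose T i j := (u 0 i * v 0 j) *: (wedge (delta_mx 0 i) *m wedge (delta_mx 0 j) : 'M[R]_N).
have -> : wedge u *m wedge v = \sum_i \sum_j T i j.
  rewrite [wedge u]wedge_sum [wedge v]wedge_sum mulmx_suml; apply: eq_bigr => i _.
  rewrite mulmx_sumr; apply: eq_bigr => j _.
  by rewrite -scalemxAl -scalemxAr scalerA.
(* The terms (i, j) and (j, i) are paired; the diagonal ones vanish because wedging twice with e_i
   is zero. *)
have -> : \sum_i \sum_j T i j = \sum_(i < n) \sum_(j < n | (i < j)%N) (T i j + T j i).
  under [RHS]eq_bigr do rewrite big_split/=.
  rewrite big_split/= [X in _ + X](exchange_big_dep predT)//= -big_split/=.
  apply: eq_bigr => i _; rewrite (bigID (fun j : 'I_n => (i < j)%N))/=; congr (_ + _).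
  rewrite (bigID (fun j : 'I_n => (j < i)%N))/= [X in _ + X]big1 ?addr0.
    by apply: eq_bigl => j; case: ltngtP.
  move=> j; rewrite -leqNgt -leqNgt -eqn_leq => /eqP/val_inj ->.
  by rewrite /T wedge_sqr scaler0.
apply: eq_bigr => i _; apply: eq_bigr => j _.
rewrite !mxE !big_ord_recl !big_ord0 !mxE !addr0.
by rewrite /T [X in _ = _ + _ *: X]wedge_deltaC scalerN -scalerBl [v 0 i * _]mulrC.
Qed.

End ExteriorAlgebra.

(** * Smooth germs *)

Section DifferentialCalculus.
Variables (R : realType) (n : nat).
Local Notation E := 'rV[R]_n.
Implicit Types (x v : E) (k : nat).

(** The difference h = g - f is zero near x, so it is differentiable there with differential zero,
    and g = h + f. *)
Lemma differentiable_near_eq (V W : normedModType R) (f g : V -> W) (x : V) :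
  (\near x, f x = g x) -> differentiable f x -> differentiable g x.
Proof.
move=> fg df; pose h := g - f.
have h0 : \near x, h x = 0.
  by apply: filterS fg => y fgy; rewrite /h -[LHS]/(g y - f y) fgy subrr.
have hE : h \o shift x = cst (h x) + 0 +o_ 0 id.
  apply/eqaddoP => e e0; rewrite (nbhs_singleton h0).
  have : \forall y \near 0, h (y + x) = 0.
    by have := h0; rewrite (near_shift 0) subr0.
  apply: filterS => y hy.
  by rewrite fctE/= !fctE hy /cst addr0 subr0 normr0 mulr_ge0 ?(ltW e0).
have c0 : continuous (\0 : V -> W) by move=> ?; exact: cvg_cst.
have dh : differentiable h x.
  apply/diff_locallyP; rewrite (_ : 'd h x = \0 :> (V -> W)); first by split.
  exact: (@diff_unique _ _ _ h \0).
by rewrite -(subrK f g); exact: differentiableD.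
Unshelve. all: by end_near. Qed.

Lemma continuous_near_eq (T S : topologicalType) (f g : T -> S) (x : T) :
  (\near x, f x = g x) -> {for x, continuous f} -> {for x, continuous g}.
Proof.
move=> fg cf; rewrite /prop_for /continuous_at -(nbhs_singleton fg).
exact/(cvg_trans _ cf)/near_eq_cvg.
Qed.

Lemma continuous_mxP (T : topologicalType) m p (F : T -> 'M[R]_(m, p)) (x : T) :
  {for x, continuous F} <-> forall i j, {for x, continuous (fun y => F y i j : R)}.
Proof.
split=> [cF i j|cF]; first exact:
  (continuous_comp (g := fun M : 'M[R]_(m, p) => M i j) cF (@coord_continuous _ _ _ _ _ _)).
apply/cvg_ballP => e e0.
have : \forall y \near x, forall i j, ball (F x i j) e (F y i j).
  by apply: filter_forall => i; apply: filter_forall => j; have /cvg_ballP/(_ _ e0) := cF i j.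
by apply: filterS => y Fy; split.
Qed.

Lemma differentiable_mxP (V : normedModType R) m p (F : V -> 'M[R]_(m, p)) (x : V) :
  differentiable F x <-> forall i j, differentiable (fun y => F y i j : R) x.
Proof.
split=> [dF i j|dF].
  exact: (differentiable_comp (g := fun M : 'M[R]_(m, p) => M i j) dF (differentiable_coord _ _ _)).
have -> : F = \sum_i \sum_j (fun y => F y i j *: delta_mx i j).
  apply/funext => y; rewrite fct_sumE {1}[F y]matrix_sum_delta.
  by apply: eq_bigr => i _; rewrite fct_sumE.
apply: differentiable_sum => i; apply: differentiable_sum => j.
exact: differentiableZl.
Qed.

Lemma derive_mx_entry (V : normedModType R) m p (F : V -> 'M[R]_(m, p)) (x v : V) i j :
  differentiable F x -> ('D_v F x) i j = 'D_v (fun y => F y i j) x.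
Proof. by move=> dF; rewrite derive_mx ?mxE//; exact: diff_derivable. Qed.

Lemma derive_comp (U V W : normedModType R) (f : U -> V) (g : V -> W) (x v : U) :
  differentiable f x -> differentiable g (f x) ->
  'D_v (g \o f) x = 'D_('D_v f x) g (f x).
Proof.
move=> df dg; rewrite (deriveE _ (differentiable_comp df dg)).
by rewrite (deriveE _ dg) (deriveE _ df) (diff_comp df dg).
Qed.

Lemma derive_linear_dir (V W : normedModType R) (f : V -> W) (x : V) (a : R) (v w : V) :
  differentiable f x -> 'D_(a *: v + w) f x = a *: 'D_v f x + 'D_w f x.
Proof. by move=> df; rewrite !(deriveE _ df) linearP. Qed.

Lemma derive_sum_dir (W : normedModType R) (f : E -> W) x v :
  differentiable f x -> 'D_v f x = \sum_i v 0 i *: 'D_(delta_mx 0 i) f x.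
Proof.
move=> df; rewrite (deriveE _ df) {1}[v]row_sum_delta linear_sum/=.
by apply: eq_bigr => i _; rewrite linearZ/= (deriveE _ df).
Qed.

(* [Ck] relative to unspecified neighbourhoods of a point, one for each order. *)
Fixpoint Ck_near (V : normedModType R) k (f : E -> V) x : Prop :=
  match k with
  | 0%N => \near x, {for x, continuous f}
  | k'.+1 => (\near x, differentiable f x) /\
      (forall a, Ck_near k' (fun x => 'D_(delta_mx 0 a) f x) x)
  end.

Lemma Ck_near0 (V : normedModType R) (f : E -> V) x :
  Ck_near 0 f x = \near x, {for x, continuous f}.
Proof. by []. Qed.

Lemma Ck_nearSE (V : normedModType R) k (f : E -> V) x :
  Ck_near k.+1 f x = ((\near x, differentiable f x) /\
      (forall a, Ck_near k (fun x => 'D_(delta_mx 0 a) f x) x)).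
Proof. by []. Qed.

Lemma CkP (V : normedModType R) k (U : set E) (f : E -> V) : open U ->
  Ck k U f <-> forall x, U x -> Ck_near k f x.
Proof.
move=> oU; have nU x : U x -> \near x, U x by move=> Ux; exact: open_nbhs_nbhs.
elim: k f => [|k IH] f.
  split=> [cf x Ux|cf x /cf]; last exact: nbhs_singleton.
  by rewrite Ck_near0; near=> y; apply: cf; near: y; exact: (nU _ Ux).
split=> [[df cf] x Ux|cf].
  split=> [|a]; last by apply: (iffLR (IH _) (cf a)).
  by near=> y; apply: df; near: y; exact: (nU _ Ux).
split=> [x /cf[df _]|a]; first exact: (nbhs_singleton df).
by apply/IH => x /cf[_]; apply.
Unshelve. all: by end_near. Qed.

Lemma Ck_near_eq (V : normedModType R) k (f g : E -> V) x :
  (\near x, f x = g x) -> Ck_near k f x -> Ck_near k g x.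
Proof.
elim: k f g => [|k IH] f g fg; rewrite ?Ck_near0 ?Ck_nearSE.
  move=> cf; near=> y; apply: (@continuous_near_eq _ _ f).
    by near: y; exact: (near_join fg).
  by near: y.
move=> [df cf]; split.
  near=> y; apply: (@differentiable_near_eq _ _ f).
    by near: y; exact: (near_join fg).
  by near: y.
move=> a; apply: IH (cf a); near=> y; apply: near_eq_derive.
by near: y; exact: (near_join fg).
Unshelve. all: by end_near. Qed.

Lemma Ck_nearS (V : normedModType R) k (f : E -> V) x : Ck_near k.+1 f x -> Ck_near k f x.
Proof.
elim: k f => [|k IH] f [df cf].
  by rewrite Ck_near0; near=> y; apply: differentiable_continuous; near: y.
by split=> // a; apply: IH; exact: cf.
Unshelve. all: by end_near. Qed.

Lemma Ck_near_mxP k m p (F : E -> 'M[R]_(m, p)) x :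
  Ck_near k F x <-> forall i j, Ck_near k (fun y => F y i j : R) x.
Proof.
elim: k F => [F|k IH F].
  rewrite Ck_near0; split=> [cF i j|cF]; rewrite ?Ck_near0.
    by near=> y; have /continuous_mxP : {for y, continuous F}; [near: y|apply].
  have : \forall y \near x, forall i j, {for y, continuous (fun y => F y i j : R)}.
    exact: (filter_forall _ (fun i => filter_forall _ (fun j => cF i j))).
  by apply: filterS => y; rewrite -continuous_mxP.
split=> [[dF cF] i j|dF].
  rewrite Ck_nearSE; split=> [|a].
    by near=> y; have /differentiable_mxP : differentiable F y; [near: y|apply].
  apply: Ck_near_eq (iffLR (IH _) (cF a) i j).
  by near=> y; rewrite derive_mx_entry//; near: y.
have dF' : \forall y \near x, differentiable F y.
  have : \forall y \near x, forall i j, differentiable (fun y => F y i j : R) y.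
    exact: (filter_forall _ (fun i => filter_forall _ (fun j => (dF i j).1))).
  by apply: filterS => y; rewrite -differentiable_mxP.
rewrite Ck_nearSE; split=> // a; apply/IH => i j; have [_ /(_ a)] := dF i j; apply: Ck_near_eq.
by near=> y; rewrite derive_mx_entry//; near: y.
Unshelve. all: by end_near. Qed.

Lemma Ck_near_cst (V : normedModType R) k (c : V) x : Ck_near k (cst c) x.
Proof.
elim: k c => [|k IH] c; first by rewrite Ck_near0; near=> y; exact: cst_continuous.
rewrite Ck_nearSE; split=> [|a]; first by near=> y; exact: differentiable_cst.
by apply: Ck_near_eq (IH 0); near=> y; rewrite derive_cst.
Unshelve. all: by end_near. Qed.

Lemma Ck_nearD (V : normedModType R) k (f g : E -> V) x :
  Ck_near k f x -> Ck_near k g x -> Ck_near k (fun y => f y + g y) x.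
Proof.
elim: k f g => [|k IH] f g.
  by rewrite !Ck_near0 => cf cg; near=> y; apply: continuousD; near: y.
move=> [df cf] [dg cg]; rewrite Ck_nearSE; split.
  by near=> y; apply: differentiableD; near: y.
move=> a; apply: Ck_near_eq (IH _ _ (cf a) (cg a)).
by near=> y; rewrite -deriveD//; apply: diff_derivable; near: y.
Unshelve. all: by end_near. Qed.

Lemma Ck_nearM k (f g : E -> R) x :
  Ck_near k f x -> Ck_near k g x -> Ck_near k (fun y => f y * g y) x.
Proof.
elim: k f g => [|k IH] f g.
  by rewrite !Ck_near0 => cf cg; near=> y; apply: continuousM; near: y.
move=> Cf Cg; have [df cf] := Cf; have [dg cg] := Cg; rewrite Ck_nearSE; split.
  by near=> y; apply: differentiableM; near: y.
move=> a; have := Ck_nearD (IH _ _ (Ck_nearS Cf) (cg a)) (IH _ _ (Ck_nearS Cg) (cf a)).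
apply: Ck_near_eq; near=> y.
by rewrite -[RHS]/('D_(delta_mx 0 a) (f * g) y) deriveM//; apply: diff_derivable; near: y.
Unshelve. all: by end_near. Qed.

(** At order k + 1 the derivative of 1/f involves 1/f itself only to order k, which the induction
    covers. The square root follows the same pattern. *)
Lemma Ck_nearV k (f : E -> R) x : (\near x, f x != 0) ->
  Ck_near k f x -> Ck_near k (fun y => (f y)^-1) x.
Proof.
move=> f0; elim: k => [|k IH].
  by rewrite !Ck_near0 => cf; near=> y; apply: continuousV; near: y.
move=> Cf; have [df cf] := Cf; rewrite Ck_nearSE; split.
  by near=> y; apply: differentiableV; near: y.
move=> a; have fV := IH (Ck_nearS Cf).
have := Ck_nearM (Ck_near_cst k (-1 : R) x) (Ck_nearM (Ck_nearM fV fV) (cf a)).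
apply: Ck_near_eq; near=> y; rewrite deriveV.
- by rewrite mulN1r scaleNr -invfM -expr2.
- by near: y.
- by apply: diff_derivable; near: y.
Unshelve. all: by end_near. Qed.

Lemma Ck_near_sqrt k (f : E -> R) x : (\near x, 0 < f x) ->
  Ck_near k f x -> Ck_near k (fun y => Num.sqrt (f y)) x.
Proof.
move=> f0; elim: k => [|k IH].
  by rewrite !Ck_near0 => cf; near=> y; apply: continuous_comp; [near: y|exact: sqrt_continuous].
have ds y : 0 < f y -> differentiable (@Num.sqrt R) (f y).
  by move=> fy; apply/derivable1_diffP; have [] := is_derive1_sqrt fy.
move=> Cf; have [df cf] := Cf; rewrite Ck_nearSE; split.
  near=> y; apply: (differentiable_comp (g := @Num.sqrt R)); first by near: y.
  by apply: ds; near: y.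
move=> a; have Csf := IH (Ck_nearS Cf).
have sf0 : \near x, 2 * Num.sqrt (f x) != 0.
  by near=> y; rewrite mulf_neq0// gt_eqF// sqrtr_gt0; near: y.
have := Ck_nearM (cf a) (Ck_nearV sf0 (Ck_nearM (Ck_near_cst k (2 : R) x) Csf)).
apply: Ck_near_eq; near=> y.
have fy0 : 0 < f y by near: y.
have dfy : differentiable f y by near: y.
have dsf := ds _ fy0; rewrite -[RHS]/('D_(delta_mx 0 a) (Num.sqrt \o f) y).
rewrite (derive_comp _ dfy dsf) (deriveE _ dsf).
rewrite -[X in 'd _ _ X]mulr1 -[_ * 1]/(_ *: 1) linearZ -(deriveE _ dsf).
by rewrite derive_sqrt.
Unshelve. all: by end_near. Qed.

Definition smooth_near (V : normedModType R) (f : E -> V) x := forall k, Ck_near k f x.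

Lemma smoothP (V : normedModType R) (U : set E) (f : E -> V) : open U ->
  smooth U f <-> forall x, U x -> smooth_near f x.
Proof.
move=> oU; split=> [sf x Ux k|sf k]; first exact: (iffLR (CkP k f oU) (sf k)).
by apply/CkP => // x Ux; exact: sf.
Qed.

Lemma smooth_near_eq (V : normedModType R) (f g : E -> V) x :
  (\near x, f x = g x) -> smooth_near f x -> smooth_near g x.
Proof. by move=> fg sf k; exact: Ck_near_eq (sf k). Qed.

Lemma smooth_near_differentiable (V : normedModType R) (f : E -> V) x :
  smooth_near f x -> \near x, differentiable f x.
Proof. by move=> /(_ 1%N)[]. Qed.

Lemma smooth_near_mxP m p (F : E -> 'M[R]_(m, p)) x :
  smooth_near F x <-> forall i j, smooth_near (fun y => F y i j : R) x.
Proof.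
split=> [sF i j k|sF k]; first exact: (iffLR (Ck_near_mxP _ _ _) (sF k)).
by apply/Ck_near_mxP => i j; exact: sF.
Qed.

Lemma smooth_near_cst (V : normedModType R) (c : V) x : smooth_near (fun=> c) x.
Proof. by move=> k; exact: Ck_near_cst. Qed.

Lemma smooth_nearD (V : normedModType R) (f g : E -> V) x :
  smooth_near f x -> smooth_near g x -> smooth_near (fun y => f y + g y) x.
Proof. by move=> sf sg k; exact: Ck_nearD. Qed.

Lemma smooth_nearM (f g : E -> R) x :
  smooth_near f x -> smooth_near g x -> smooth_near (fun y => f y * g y) x.
Proof. by move=> sf sg k; exact: Ck_nearM. Qed.

Lemma smooth_nearN (f : E -> R) x : smooth_near f x -> smooth_near (fun y => - f y) x.
Proof.
move=> sf; apply: smooth_near_eq (smooth_nearM (smooth_near_cst (-1 : R) x) sf).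
by near=> y; rewrite mulN1r.
Unshelve. all: by end_near. Qed.

Lemma smooth_near_sum (V : normedModType R) I (r : seq I) (P : pred I) (F : I -> E -> V) x :
  (forall i, P i -> smooth_near (F i) x) ->
  smooth_near (fun y => \sum_(i <- r | P i) F i y) x.
Proof.
move=> sF; elim: r => [|i r IH].
  by under eq_fun do rewrite big_nil; exact: smooth_near_cst.
have Fr : (fun y => \sum_(j <- i :: r | P j) F j y) = (fun y => if P i then
    F i y + \sum_(j <- r | P j) F j y else \sum_(j <- r | P j) F j y).
  by apply/funext => y; rewrite big_cons.
rewrite Fr; case Pi : (P i) => //.
by apply: smooth_nearD => //; exact: sF.
Qed.

Lemma smooth_near_prod I (r : seq I) (P : pred I) (F : I -> E -> R) x :
  (forall i, P i -> smooth_near (F i) x) ->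
  smooth_near (fun y => \prod_(i <- r | P i) F i y) x.
Proof.
move=> sF; elim: r => [|i r IH].
  by under eq_fun do rewrite big_nil; exact: smooth_near_cst.
have Fr : (fun y => \prod_(j <- i :: r | P j) F j y) = (fun y => if P i then
    F i y * \prod_(j <- r | P j) F j y else \prod_(j <- r | P j) F j y).
  by apply/funext => y; rewrite big_cons.
rewrite Fr; case Pi : (P i) => //.
by apply: smooth_nearM => //; exact: sF.
Qed.

Lemma smooth_near_mulmx m p q (F : E -> 'M[R]_(m, p)) (G : E -> 'M[R]_(p, q)) x :
  smooth_near F x -> smooth_near G x -> smooth_near (fun y => F y *m G y) x.
Proof.
move=> /smooth_near_mxP sF /smooth_near_mxP sG; apply/smooth_near_mxP => i j.
under eq_fun do rewrite mxE.
by apply: smooth_near_sum => l _; exact: smooth_nearM.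
Qed.

Lemma smooth_near_trmx m p (F : E -> 'M[R]_(m, p)) x :
  smooth_near F x -> smooth_near (fun y => (F y)^T) x.
Proof.
move=> /smooth_near_mxP sF; apply/smooth_near_mxP => i j.
by under eq_fun do rewrite mxE; exact: sF.
Qed.

Lemma smooth_near_det m (F : E -> 'M[R]_m) x :
  smooth_near F x -> smooth_near (fun y => \det (F y)) x.
Proof.
move=> /smooth_near_mxP sF; apply: smooth_near_sum => s _.
apply: smooth_nearM; first exact: smooth_near_cst.
by apply: smooth_near_prod.
Qed.

Lemma smooth_near_invmx m (F : E -> 'M[R]_m) x : (\near x, F x \in unitmx) ->
  smooth_near F x -> smooth_near (fun y => invmx (F y)) x.
Proof.
move=> uF sF.
have dF : \near x, \det (F x) != 0.
  by apply: filterS uF => y; rewrite unitmxE unitfE.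
have sV : smooth_near (fun y => (\det (F y))^-1) x.
  by move=> k; apply: Ck_nearV dF _; exact: smooth_near_det.
apply: (@smooth_near_eq _ (fun y => \matrix_(i, j) ((\det (F y))^-1 * cofactor (F y) j i))).
  near=> y; apply/matrixP => i j; rewrite /invmx mxE.
  have -> : F y \in unitmx by near: y.
  by rewrite !mxE.
apply/smooth_near_mxP => i j; under eq_fun do rewrite mxE.
apply: smooth_nearM => //; apply: smooth_nearM; first exact: smooth_near_cst.
apply: smooth_near_det; apply/smooth_near_mxP => a b.
under eq_fun do rewrite !mxE.
exact: (iffLR (smooth_near_mxP _ _) sF).
Unshelve. all: by end_near. Qed.

Lemma smooth_near_sqrt (f : E -> R) x : (\near x, 0 < f x) -> smooth_near f x ->
  smooth_near (fun y => Num.sqrt (f y)) x.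
Proof. by move=> f0 sf k; exact: Ck_near_sqrt. Qed.

Lemma smooth_nearV (f : E -> R) x : (\near x, f x != 0) -> smooth_near f x ->
  smooth_near (fun y => (f y)^-1) x.
Proof. by move=> f0 sf k; exact: Ck_nearV. Qed.

Lemma smooth_near_partial (V : normedModType R) (f : E -> V) x a :
  smooth_near f x -> smooth_near (fun y => 'D_(delta_mx 0 a) f y) x.
Proof. by move=> sf k; have [_] := sf k.+1; apply. Qed.

Lemma smooth_near_derive (f : E -> R) (Y : E -> E) x :
  smooth_near f x -> smooth_near Y x -> smooth_near (fun y => 'D_(Y y) f y) x.
Proof.
move=> sf /smooth_near_mxP sY.
apply: (@smooth_near_eq _ (fun y => \sum_i Y y 0 i * 'D_(delta_mx 0 i) f y)).
  have df := smooth_near_differentiable sf.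
  by near=> y; rewrite [RHS]derive_sum_dir//; near: y.
apply: smooth_near_sum => i _; apply: smooth_nearM => //.
exact: smooth_near_partial.
Unshelve. all: by end_near. Qed.

(** * Mean value arguments: local constancy and symmetry of second derivatives *)

Lemma MVT_dir (f : E -> R) x v (h : R) : 0 <= h ->
  (forall t, 0 <= t <= h -> differentiable f (x + t *: v)) ->
  exists2 c, 0 <= c <= h & f (x + h *: v) - f x = h * 'D_v f (x + c *: v).
Proof.
move=> h0 df; pose phi (t : R) := f (x + t *: v).
have dl (t : R) : is_derive t 1 (fun t : R => x + t *: v) v.
  have dZ : differentiable (fun t : R => t *: v) t by exact: differentiableZl.
  apply: DeriveDef.
    by apply/diff_derivable; apply: differentiableD => //; exact: differentiable_cst.
  rewrite deriveD; last 2 first.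
  - exact: derivable_cst.
  - exact: diff_derivable.
  rewrite derive_cst add0r deriveE// diffZl// diff_val/=.
  by rewrite scale1r.
have dphi t : 0 <= t <= h -> is_derive t 1 phi ('D_v f (x + t *: v)).
  move=> /df dft; have [dlt dlv] := dl t.
  have dlt' : differentiable (fun t : R => x + t *: v) t by apply/derivable1_diffP.
  apply: DeriveDef; last by rewrite (derive_comp _ dlt' dft) dlv.
  by apply: diff_derivable; exact: differentiable_comp.
have [||c] := @MVT_segment R phi (fun t => 'D_v f (x + t *: v)) 0 h h0.
- by move=> t; rewrite in_itv/= => /andP[t0 th]; apply: dphi; rewrite !ltW.
- apply: derivable_within_continuous => t; rewrite in_itv/= => /dphi.
  by case.
- rewrite in_itv/= subr0 => ch; rewrite /phi scale0r addr0 => ->.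
  by exists c => //; rewrite mulrC.
Qed.

Lemma derive0_ball_cst (f : E -> R) x (e : R) :
  (forall y, ball x e y -> differentiable f y) ->
  (forall y v, ball x e y -> 'D_v f y = 0) ->
  forall y, ball x e y -> f y = f x.
Proof.
move=> df f0 y xy.
have xb t : 0 <= t <= 1 -> ball x e (x + t *: (y - x)).
  move=> /andP[t0 t1]; move: xy; rewrite -ball_normE/= => xy.
  rewrite opprD addNKr normrN normrZ ger0_norm//.
  by apply: le_lt_trans xy; rewrite distrC ler_piMl.
have [t /xb/df //|c /xb c1] := @MVT_dir f x (y - x) 1 ler01.
by rewrite f0// mulr0 scale1r [x + _]addrC subrK => /eqP; rewrite subr_eq0 => /eqP.
Qed.

(** The level set of F through p and the set where F takes other values are both open in U. *)
Lemma locally_constant_connected (T : topologicalType) (S : Type) (U : set T) (F : T -> S) :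
  open U -> connected U -> (forall p, U p -> \forall q \near p, F q = F p) ->
  forall p q, U p -> U q -> F p = F q.
Proof.
move=> oU cU lF p q Up Uq.
have oE (P : set S) : open [set r | U r /\ P (F r)].
  rewrite openE => r [Ur Pr]; rewrite /interior.
  near=> t; split; first by near: t; exact: open_nbhs_nbhs.
  by have -> : F t = F r by near: t; exact: lF.
suff UE : [set r | U r /\ F r = F p] = U by move: Uq; rewrite -UE => -[].
apply: cU.
- by exists p.
- exists [set r | U r /\ F r = F p]; first exact: (oE [set F p]).
  by rewrite eqEsubset; split => r; [move=> [Ur]|move=> [_]].
- exists (~` [set r | U r /\ F r <> F p]).
    by apply: open_closedC; exact: (oE (~` [set F p])).
  rewrite eqEsubset; split => r /=.
    by move=> [Ur Fr]; split => // -[].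
  by move=> [Ur Fr]; split => //; apply: contrapT => Frp; apply: Fr.
Unshelve. all: by end_near. Qed.

Lemma Ck_near_id k x : Ck_near k (id : E -> E) x.
Proof.
case: k => [|k]; first by rewrite Ck_near0; near=> y; exact: cvg_id.
rewrite Ck_nearSE; split=> [|a]; first by near=> y; exact: ex_diff.
apply: Ck_near_eq (Ck_near_cst k (delta_mx 0 a : E) x).
by near=> y; rewrite derive_id.
Unshelve. all: by end_near. Qed.

Lemma smooth_near_dir (f : E -> R) x v :
  smooth_near f x -> smooth_near (fun y => 'D_v f y) x.
Proof. by move=> sf; apply: (smooth_near_derive sf); exact: smooth_near_cst. Qed.

Lemma smooth_near_continuous (V : normedModType R) (f : E -> V) x :
  smooth_near f x -> {for x, continuous f}.
Proof. by move=> /(_ 0%N)/nbhs_singleton. Qed.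

Lemma smooth_near_diff (V : normedModType R) (f : E -> V) x :
  smooth_near f x -> differentiable f x.
Proof. by move=> /smooth_near_differentiable/nbhs_singleton. Qed.

Lemma derive_shift_arg (f : E -> R) x v w :
  'D_v (fun y => f (y + w)) x = 'D_v f (x + w).
Proof. by rewrite /derive; under eq_fun do rewrite /= -addrA. Qed.

Lemma differentiable_shift_arg (f : E -> R) x w : differentiable f (x + w) ->
  differentiable (fun y => f (y + w)) x.
Proof.
move=> df; have ds : differentiable (fun y : E => y + w) x.
  by apply: differentiableD => //; exact: differentiable_cst.
exact: (differentiable_comp ds df).
Qed.

(* The left-hand side is symmetric in u and v. *)
Lemma second_difference (f : E -> R) x u v (r h : R) : 0 < h ->
  h * (`|u| + `|v|) < r ->
  (forall y, ball x r y -> differentiable f y /\ differentiable (fun z => 'D_u f z) y) ->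
  exists2 y, ball x r y & f (x + h *: u + h *: v) - f (x + h *: u) - (f (x + h *: v) - f x)
    = h * (h * 'D_v (fun z => 'D_u f z) y).
Proof.
move=> h0 hr df; have inb t t' : 0 <= t <= h -> 0 <= t' <= h ->
    ball x r (x + t *: u + t' *: v).
  move=> /andP[t0 th] /andP[t'0 t'h]; rewrite -ball_normE/= -addrA opprD addNKr normrN.
  apply: le_lt_trans hr; rewrite mulrDr; apply: (le_trans (ler_normD _ _)).
  by rewrite !normrZ !ger0_norm// lerD// ler_wpM2r.
have hh : 0 <= h <= h by rewrite lexx ltW.
have h00 : 0 <= (0 : R) <= h by rewrite lexx ltW.
have inb0 t : 0 <= t <= h -> ball x r (x + t *: u).
  by move=> th; have := inb t 0 th h00; rewrite scale0r addr0.
pose g y := f (y + h *: v) - f y.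
have dg t : 0 <= t <= h -> differentiable g (x + t *: u).
  move=> th; apply: differentiableB; last exact: (df _ (inb0 _ th)).1.
  exact/differentiable_shift_arg/(df _ (inb _ _ th hh)).1.
have [c ch gE] := MVT_dir (ltW h0) dg.
have [|d dh fE] := @MVT_dir (fun z => 'D_u f z) (x + c *: u) v h (ltW h0).
  by move=> t th; exact: (df _ (inb _ _ ch th)).2.
exists (x + c *: u + d *: v); first exact: inb.
rewrite -fE; move: gE; rewrite {1 2}/g => ->; congr (_ * _).
have d1 : differentiable f (x + c *: u + h *: v) := (df _ (inb _ _ ch hh)).1.
have d2 : differentiable f (x + c *: u) := (df _ (inb0 _ ch)).1.
have := deriveB (diff_derivable (v := u) (differentiable_shift_arg d1)) (diff_derivable (v := u) d2).
by rewrite derive_shift_arg.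
Qed.

(** If the mixed derivatives A and B at x differed, continuity would keep each within |A - B| / 2 of
    its value at x on a small ball. The second difference, being symmetric in u and v, equals h^2
    times a value of either of them in this ball, so the two disjoint ranges would meet. *)
Lemma derive_swap (f : E -> R) x u v : smooth_near f x ->
  'D_v (fun z => 'D_u f z) x = 'D_u (fun z => 'D_v f z) x.
Proof.
move=> sf; set A := LHS; set B := RHS; apply/eqP/contraT => AB.
have e0 : 0 < `|A - B| / 2 by rewrite divr_gt0// normr_gt0 subr_eq0.
have cA := smooth_near_continuous (smooth_near_dir v (smooth_near_dir u sf)).
have cB := smooth_near_continuous (smooth_near_dir u (smooth_near_dir v sf)).
have /nbhs_ballP[r /= r0 xr] : \forall y \near x,
    [/\ differentiable f y, differentiable (fun z => 'D_u f z) y,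
        differentiable (fun z => 'D_v f z) y,
        `|A - 'D_v (fun z => 'D_u f z) y| < `|A - B| / 2 &
        `|B - 'D_u (fun z => 'D_v f z) y| < `|A - B| / 2].
  have d1 := smooth_near_differentiable sf.
  have d2 := smooth_near_differentiable (smooth_near_dir u sf).
  have d3 := smooth_near_differentiable (smooth_near_dir v sf).
  have /cvgrPdist_lt/(_ _ e0) nA := cA.
  have /cvgrPdist_lt/(_ _ e0) nB := cB.
  apply: filterS (filterI d1 (filterI d2 (filterI d3 (filterI nA nB)))).
  move=> y [p1 [p2 [p3 [p4 p5]]]]; exact: (And5 p1 p2 p3 p4 p5).
(* Small enough for the parallelogram at x to stay in the ball of radius r; the summand 1 keeps the
   denominator positive when u and v vanish. *)
pose h := r / 2 / (`|u| + `|v| + 1).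
have uv0 : 0 < `|u| + `|v| + 1 by rewrite ltr_wpDl// addr_ge0.
have h0 : 0 < h by rewrite !divr_gt0.
have hr : h * (`|u| + `|v|) < r.
  rewrite /h mulrAC ltr_pdivrMr// -mulrA ltr_pM2l// mulrC.
  rewrite ltr_pdivrMr//.
  by have := normr_ge0 u; have := normr_ge0 v; lra.
have hr' : h * (`|v| + `|u|) < r by rewrite addrC.
have cancel_h (a b c d p q : R) : a - b - (c - d) = h * (h * p) ->
    a - c - (b - d) = h * (h * q) -> p = q.
  move=> ep eq; apply: (mulfI (lt0r_neq0 h0)); apply: (mulfI (lt0r_neq0 h0)).
  by rewrite -ep -eq; ring.
have close_false (a b p : R) : `|a - p| < `|a - b| / 2 -> `|b - p| < `|a - b| / 2 -> False.
  by have := ler_distD p a b; rewrite [`|b - p|]distrC; lra.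
have [|y /xr[_ _ _ Ay _] yE] := second_difference h0 hr (f := f) (x := x).
  by move=> y /xr[].
have [|z /xr[_ _ _ _ Bz] zE] := second_difference h0 hr' (f := f) (x := x).
  by move=> z /xr[].
rewrite [x + h *: v + _]addrAC in zE.
have yz := cancel_h _ _ _ _ _ _ yE zE.
rewrite yz in Ay.
by case: (close_false _ _ _ Ay Bz).
Qed.

End DifferentialCalculus.

(** * Derivatives of matrix-valued maps *)

Section MatrixCalculus.
Variables (R : realType) (n : nat).
Local Notation E := 'rV[R]_n.
Implicit Types (x w : E).

Lemma is_derive_scalar_mul (f g : E -> R) x w : differentiable f x -> differentiable g x ->
  'D_w (fun y => f y * g y) x = 'D_w f x * g x + f x * 'D_w g x.
Proof.
move=> df dg.
have := deriveM (diff_derivable (v := w) df) (diff_derivable (v := w) dg).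
by move=> fg; rewrite [LHS]fg addrC mulrC.
Qed.

Lemma derive_sum_fun (V : normedModType R) m (F : 'I_m -> E -> V) x w :
  (forall i, differentiable (F i) x) ->
  'D_w (fun y => \sum_i F i y) x = \sum_i 'D_w (F i) x.
Proof.
move=> dF; rewrite -derive_sum; last by move=> i; exact: diff_derivable.
by congr ('D_w _ x); apply/funext => y; rewrite fct_sumE.
Qed.

Lemma differentiable_sum_fun (V : normedModType R) m (F : 'I_m -> E -> V) x :
  (forall i, differentiable (F i) x) -> differentiable (fun y => \sum_i F i y) x.
Proof.
move=> dF; have -> : (fun y => \sum_i F i y) = \sum_i F i.
  by apply/funext => y; rewrite fct_sumE.
exact: differentiable_sum.
Qed.

Lemma differentiable_mulmx m p q (F : E -> 'M[R]_(m, p)) (G : E -> 'M[R]_(p, q)) x :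
  differentiable F x -> differentiable G x -> differentiable (fun y => F y *m G y) x.
Proof.
move=> /differentiable_mxP dF /differentiable_mxP dG; apply/differentiable_mxP => i j.
under eq_fun do rewrite mxE.
by apply: differentiable_sum_fun => l; exact: (differentiableM (dF i l) (dG l j)).
Qed.

Lemma derive_mulmx m p q (F : E -> 'M[R]_(m, p)) (G : E -> 'M[R]_(p, q)) x w :
  differentiable F x -> differentiable G x ->
  'D_w (fun y => F y *m G y) x = 'D_w F x *m G x + F x *m 'D_w G x.
Proof.
move=> dF dG; apply/matrixP => i j.
rewrite (derive_mx_entry _ _ _ (differentiable_mulmx dF dG)) !mxE -big_split/=.
have dFe := iffLR (differentiable_mxP _ _) dF; have dGe := iffLR (differentiable_mxP _ _) dG.
under eq_fun do rewrite mxE.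
rewrite derive_sum_fun => [|l]; last exact: (differentiableM (dFe i l) (dGe l j)).
apply: eq_bigr => l _; rewrite (is_derive_scalar_mul _ (dFe i l) (dGe l j)).
by rewrite (derive_mx_entry _ _ _ dF) (derive_mx_entry _ _ _ dG).
Qed.

Section Linear.
Variables (m p m' p' : nat) (L : {linear 'M[R]_(m, p) -> 'M[R]_(m', p')}).
Variables (F : E -> 'M[R]_(m, p)) (x : E).

(** Expanding in matrix units makes each entry of L a fixed combination of entries, to which the sum
    and product rules apply. *)
Let linE A i j : L A i j = \sum_k \sum_l A k l * L (delta_mx k l) i j.
Proof.
rewrite {1}[A]matrix_sum_delta linear_sum summxE; apply: eq_bigr => k _.
by rewrite linear_sum summxE; apply: eq_bigr => l _; rewrite linearZ mxE.
Qed.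

Lemma differentiable_linear_mx : differentiable F x -> differentiable (fun y => L (F y)) x.
Proof.
move=> /differentiable_mxP dF; apply/differentiable_mxP => i j.
under eq_fun do rewrite linE.
apply: differentiable_sum_fun => k; apply: differentiable_sum_fun => l.
by apply: (differentiableM (dF k l)); exact: differentiable_cst.
Qed.

Lemma derive_linear_mx w : differentiable F x -> 'D_w (fun y => L (F y)) x = L ('D_w F x).
Proof.
move=> dF; have dFe := iffLR (differentiable_mxP _ _) dF; apply/matrixP => i j.
rewrite (derive_mx_entry _ _ _ (differentiable_linear_mx dF)) linE.
under eq_fun do rewrite linE.
have dc k l : differentiable (fun=> L (delta_mx k l) i j) x.
  exact: (differentiable_cst (L (delta_mx k l) i j)).
have dkl k l : differentiable (fun y => F y k l * L (delta_mx k l) i j) x.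
  exact: (differentiableM (dFe k l) (dc k l)).
rewrite derive_sum_fun => [|k]; last exact: differentiable_sum_fun.
apply: eq_bigr => k _; rewrite derive_sum_fun//; apply: eq_bigr => l _.
rewrite (is_derive_scalar_mul _ (dFe k l) (dc k l)) (derive_mx_entry _ _ _ dF).
by rewrite [X in _ + _ * X](derive_cst (L (delta_mx k l) i j)) mulr0 addr0.
Qed.

Lemma smooth_near_linear_mx : smooth_near F x -> smooth_near (fun y => L (F y)) x.
Proof.
move=> /smooth_near_mxP sF; apply/smooth_near_mxP => i j.
under eq_fun do rewrite linE.
apply: smooth_near_sum => k _; apply: smooth_near_sum => l _.
by apply: smooth_nearM => //; exact: smooth_near_cst.
Qed.

End Linear.

Lemma derive_mulmx_cst m p q r (A : 'M[R]_(m, p)) (B : 'M[R]_(q, r))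
    (F : E -> 'M[R]_(p, q)) x w : differentiable F x ->
  'D_w (fun y => A *m F y *m B) x = A *m 'D_w F x *m B.
Proof.
move=> dF; rewrite (derive_linear_mx (mulmxr B) w (differentiable_linear_mx (mulmx A) dF)).
by rewrite /= (derive_linear_mx (mulmx A) w dF).
Qed.

Lemma smooth_near_ext_mx m (V : E -> 'M[R]_m) x :
  smooth_near V x -> smooth_near (fun y => ext_mx (V y)) x.
Proof.
move=> sV; apply/smooth_near_mxP => p q; under eq_fun do rewrite mxE.
have sr (r : seq 'I_m) : smooth_near (fun y =>
    \big[mulmx/1%:M]_(i <- r | i \in index_set q) wedge (row i (V y))) x.
  elim: r => [|i r IH].
    by under eq_fun do rewrite big_nil; exact: smooth_near_cst.
  have -> : (fun y => \big[mulmx/1%:M]_(j <- i :: r | j \in index_set q) wedge (row j (V y)))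
    = (fun y => if i \in index_set q then wedge (row i (V y)) *m
        \big[mulmx/1%:M]_(j <- r | j \in index_set q) wedge (row j (V y))
        else \big[mulmx/1%:M]_(j <- r | j \in index_set q) wedge (row j (V y))).
    by apply/funext => y; rewrite big_cons.
  case Pi : (i \in index_set q) => //; apply: smooth_near_mulmx => //.
  exact: (smooth_near_linear_mx (@wedge R m) (smooth_near_linear_mx (row i) sV)).
exact: (iffLR (smooth_near_mxP _ _) (sr _)).
Qed.

Lemma derive_ext_mx m (V : E -> 'M[R]_m) x w : V x \in unitmx -> smooth_near V x ->
  'D_w (fun y => ext_mx (V y)) x = ext_der (invmx (V x) *m 'D_w V x) *m ext_mx (V x).
Proof.
move=> Vu sV; have dE := smooth_near_diff (smooth_near_ext_mx sV).
have dV := smooth_near_diff sV; apply: ext_mx_derivative_unique => //.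
  rewrite -[LHS](derive_linear_mx (mulmxr (ext_basis R finset.set0)) w dE)/=.
  under eq_fun do rewrite ext_mx_basis0.
  by rewrite (derive_cst (ext_basis R finset.set0)).
move=> i; rewrite -[LHS](derive_linear_mx (mulmxr (wedge (delta_mx 0 i))) w dE)/=.
under eq_fun do rewrite ext_mx_wedge.
have dW : differentiable (fun y => wedge (delta_mx 0 i *m V y)) x.
  exact: (differentiable_linear_mx (@wedge R m) (differentiable_linear_mx (mulmx (delta_mx 0 i)) dV)).
rewrite (derive_mulmx w dW dE); congr (_ *m _ + _).
rewrite (derive_linear_mx (@wedge R m) w (differentiable_linear_mx (mulmx (delta_mx 0 i)) dV)).
by rewrite /= (derive_linear_mx (mulmx (delta_mx 0 i)) w dV).
Qed.

Lemma derive_invmx m (F G : E -> 'M[R]_m) x w : (\near x, F x *m G x = 1%:M) ->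
  differentiable F x -> differentiable G x ->
  'D_w G x = - (G x *m 'D_w F x *m G x).
Proof.
move=> FG dF dG; have FG1 := nbhs_singleton FG.
have : 'D_w (fun y => F y *m G y) x = 0.
  by rewrite (near_eq_derive w FG) (derive_cst (1%:M : 'M[R]_m)).
rewrite (derive_mulmx w dF dG) => /eqP; rewrite addrC addr_eq0 => /eqP FDG.
by rewrite -[LHS]mul1mx -(mulmx1C FG1) -[LHS]mulmxA FDG mulmxN mulmxA.
Qed.

(** As [ext_mx (V y)] has logarithmic derivative B, its conjugates vary by the commutator with B.
    The Christoffel term of [levi_civita] is a commutator of the same shape, and will cancel it. *)
Lemma derive_ext_conj m (V : E -> 'M[R]_m) (T : 'M[R]_(extdim m)) x w :
  (\near x, V x \in unitmx) -> smooth_near V x ->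
  let B := ext_der (invmx (V x) *m 'D_w V x) in
  let S := ext_mx (V x) *m T *m invmx (ext_mx (V x)) in
  'D_w (fun y => ext_mx (V y) *m T *m invmx (ext_mx (V y))) x = B *m S - S *m B.
Proof.
move=> Vu sV B S; have Vxu := nbhs_singleton Vu.
have sE := smooth_near_ext_mx sV; have dE := smooth_near_diff sE.
have Eu : \near x, ext_mx (V x) \in unitmx by apply: filterS Vu => y; exact: ext_mx_unit.
have dI := smooth_near_diff (smooth_near_invmx Eu sE).
have dET := differentiable_linear_mx (mulmxr T) dE.
rewrite (derive_mulmx w dET dI) (derive_linear_mx (mulmxr T) w dE)/= (derive_ext_mx w Vxu sV).
rewrite (derive_invmx w _ dE dI); last by apply: filterS Eu => y; exact: mulmxV.
rewrite (derive_ext_mx w Vxu sV) mulmxN /S !mulmxA.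
by rewrite mulmxK// ext_mx_unit.
Qed.

End MatrixCalculus.

(** * Changes of coordinates *)

Lemma mulmx_invM (R : comUnitRingType) n (A B : 'M[R]_n) :
  A \in unitmx -> B \in unitmx -> B *m invmx (A *m B) = invmx A.
Proof.
move=> Au Bu; apply: (can_inj (mulKmx Au)).
by rewrite mulmxA !mulmxV// unitmx_mul Au.
Qed.

Section Charts.
Variables (R : realType) (n : nat) (X : manifold R n).
Local Notation E := 'rV[R]_n.
Implicit Types (c d e : chart R n X) (p q : X) (U : set X) (w : E).

(** Passes from points near p to coordinates near c p. As [icoord] is arbitrary off the image of the
    chart, the inverse relations come along with the property. *)
Lemma near_icoord c p (P : set X) : dom c p -> (\near p, P p) ->
  \forall x \near c p, [/\ P (icoord c x), dom c (icoord c x) & c (icoord c x) = x].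
Proof.
move=> cp Pp; have /(icoord_cts cp) : nbhs (icoord c (c p)) P by rewrite coordK.
rewrite nbhs_simpl/= => Px; have oc : nbhs (c p) (c @` dom c).
  by apply: open_nbhs_nbhs; split; [exact: cod_open|exists p].
apply: filterS (filterI Px oc) => x [Px' [q cq qx]].
by rewrite -qx coordK//; split=> //; move: Px'; rewrite -qx /= coordK.
Qed.

Lemma near_coord c p (P : set E) : dom c p -> (\forall x \near c p, P x) -> \forall q \near p, P (c q).
Proof. by move=> cp Px; exact: (coord_cts cp Px). Qed.

Lemma near_dom c p : dom c p -> \forall q \near p, dom c q.
Proof. by move=> cp; apply: open_nbhs_nbhs; split => //; exact: dom_open. Qed.

Lemma open_coord_image c U : open U -> open (c @` (U `&` dom c)).
Proof.
move=> oU; rewrite openE => _ [p [Up cp] <-]; rewrite /interior.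
have Up' : \near p, U p by exact: open_nbhs_nbhs.
by apply: filterS (near_icoord cp Up') => x [Ux cx xE]; exists (icoord c x).
Qed.

Lemma smooth_transitionP c d : smooth_transition c d <->
  forall p, dom c p -> dom d p -> smooth_near (fun x => d (icoord c x)) (c p).
Proof.
have oI : open (c @` (dom c `&` dom d)).
  by rewrite setIC; apply: open_coord_image; exact: dom_open.
rewrite /smooth_transition smoothP//; split=> [st p cp dp|st _ [p [cp dp] <-]].
  by apply: st; exists p.
exact: st.
Qed.

Lemma Ck_fieldP (V : normedModType R) k U (comp : chart R n X -> X -> V) : open U ->
  Ck_field k U comp <-> forall e p, atlas e -> U p -> dom e p ->
     Ck_near k (fun x => comp e (icoord e x)) (e p).
Proof.
move=> oU; split=> [sf e p ae Up ep|sf e ae].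
  have := iffLR (CkP k _ (open_coord_image (c := e) oU)) (sf e ae) (e p).
  by apply; exists p.
apply: (iffRL (CkP k _ (open_coord_image (c := e) oU))) => _ [p [Up ep] <-]; exact: sf.
Qed.

Lemma smooth_fieldP (V : normedModType R) U (comp : chart R n X -> X -> V) : open U ->
  smooth_field U comp <-> forall e p, atlas e -> U p -> dom e p ->
     smooth_near (fun x => comp e (icoord e x)) (e p).
Proof.
move=> oU; split=> [sf e p ae Up ep k|sf k].
  exact: (iffLR (Ck_fieldP k comp oU) (sf k)).
by apply: (iffRL (Ck_fieldP k comp oU)) => e p ae Up ep; exact: sf.
Qed.

Definition compatible_charts c d := smooth_transition c d /\ smooth_transition d c.

Lemma compatible_charts_sym c d : compatible_charts c d -> compatible_charts d c.
Proof. by case. Qed.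

Lemma atlas_compatible c d : atlas c -> atlas d -> compatible_charts c d.
Proof. by move=> ac ad; split; exact: atlas_smooth. Qed.

Lemma smooth_chart_compatible c d : smooth_chart c -> atlas d -> compatible_charts c d.
Proof. by move=> sc /sc. Qed.

Lemma smooth_trans c d p : compatible_charts c d -> dom c p -> dom d p ->
  smooth_near (fun x => d (icoord c x)) (c p).
Proof. by case=> /smooth_transitionP st _; exact: st. Qed.

Definition trans_jac c d q : 'M[R]_n := jacobian (fun x => d (icoord c x)) (c q).

Lemma trans_derive c d p w : compatible_charts c d -> dom c p -> dom d p ->
  'D_w (fun x => d (icoord c x)) (c p) = w *m trans_jac c d p.
Proof.
by move=> cd cp dp; rewrite deriveEjacobian//; exact: smooth_near_diff (smooth_trans cd cp dp).
Qed.

Lemma chart_derive_change (V : normedModType R) (F : X -> V) c d p w :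
  compatible_charts c d -> dom c p -> dom d p ->
  differentiable (fun y => F (icoord d y)) (d p) ->
  'D_w (fun x => F (icoord c x)) (c p)
    = 'D_(w *m trans_jac c d p) (fun y => F (icoord d y)) (d p).
Proof.
move=> cd cp dp dF; have dt := smooth_near_diff (smooth_trans cd cp dp).
have tE : d (icoord c (c p)) = d p by rewrite coordK.
have -> : 'D_w (fun x => F (icoord c x)) (c p)
    = 'D_w ((fun y => F (icoord d y)) \o (fun x => d (icoord c x))) (c p).
  apply: near_eq_derive.
  by apply: filterS (near_icoord cp (near_dom dp)) => x [dx _ _] /=; rewrite coordK.
by rewrite derive_comp ?tE// (trans_derive _ cd cp dp).
Qed.

Lemma differentiable_chart_change (V : normedModType R) (F : X -> V) c d p :
  compatible_charts c d -> dom c p -> dom d p ->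
  differentiable (fun y => F (icoord d y)) (d p) ->
  differentiable (fun x => F (icoord c x)) (c p).
Proof.
move=> cd cp dp dF; have dt := smooth_near_diff (smooth_trans cd cp dp).
have tE : d (icoord c (c p)) = d p by rewrite coordK.
apply: (@differentiable_near_eq _ _ _ ((fun y => F (icoord d y)) \o (fun x => d (icoord c x)))).
  by apply: filterS (near_icoord cp (near_dom dp)) => x [dx _ _] /=; rewrite coordK.
apply: differentiable_comp; first exact: dt.
rewrite tE; exact: dF.
Qed.

Lemma trans_jac_id c p : dom c p -> trans_jac c c p = 1%:M.
Proof.
move=> cp; apply/row_matrixP => i; rewrite !rowE mulmx1.
have idE : \forall x \near c p, c (icoord c x) = id x.
  by apply: filterS (near_icoord cp (near_dom cp)) => x [].
rewrite -deriveEjacobian; first by rewrite (near_eq_derive _ idE) derive_id.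
apply: (@differentiable_near_eq _ _ _ id); last by [].
by apply: filterS idE => x ->.
Qed.

Lemma trans_jacM c d e p : compatible_charts c d -> compatible_charts d e ->
  compatible_charts c e -> dom c p -> dom d p -> dom e p ->
  trans_jac c e p = trans_jac c d p *m trans_jac d e p.
Proof.
move=> cd de ce cp dp ep; apply/row_matrixP => i; rewrite !rowE mulmxA.
have e1 := trans_derive (delta_mx 0 i) ce cp ep.
have e2 := trans_derive (delta_mx 0 i *m trans_jac c d p) de dp ep.
apply: etrans (esym e1) (etrans _ e2).
exact: (chart_derive_change (F := e) _ cd cp dp (smooth_near_diff (smooth_trans de dp ep))).
Qed.

Lemma trans_jacK c d p : atlas c -> compatible_charts c d -> dom c p -> dom d p ->
  trans_jac c d p *m trans_jac d c p = 1%:M.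
Proof.
move=> ac cd cp dp; rewrite -(trans_jacM (e := c) cd (compatible_charts_sym cd))//.
  by rewrite trans_jac_id.
exact: atlas_compatible.
Qed.

Lemma smooth_trans_jac c d p : compatible_charts c d -> dom c p -> dom d p ->
  smooth_near (fun x => trans_jac c d (icoord c x)) (c p).
Proof.
move=> cd cp dp; have st := smooth_trans cd cp dp; apply/smooth_near_mxP => i j.
have := iffLR (smooth_near_mxP _ _) (smooth_near_partial i st) 0 j; apply: smooth_near_eq.
apply: filterS (near_icoord cp (near_dom dp)) => x [dx cx xE].
have := trans_derive (delta_mx 0 i) cd cx dx; rewrite xE => ->.
by rewrite -rowE mxE.
Qed.

Lemma jacE c q : jac c q = trans_jac (chart_at q) c q.
Proof. by []. Qed.

Lemma jac_chart_at q : jac (chart_at q) q = 1%:M.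
Proof. by rewrite jacE trans_jac_id//; exact: chart_at_dom. Qed.

Lemma jac_unit c q : smooth_chart c -> dom c q -> jac c q \in unitmx.
Proof.
move=> sc cq; have ac := chart_at_atlas q; have dq := chart_at_dom q.
have cc := compatible_charts_sym (smooth_chart_compatible sc ac).
by rewrite jacE; have /mulmx1_unit[u _] := trans_jacK ac cc dq cq; exact: u.
Qed.

Lemma atlas_smooth_chart c : atlas c -> smooth_chart c.
Proof. by move=> ac d ad; exact: atlas_compatible. Qed.

Lemma jac_trans c d q : atlas c -> smooth_chart d -> dom c q -> dom d q ->
  jac d q = jac c q *m trans_jac c d q.
Proof.
move=> ac sd cq dq; rewrite !jacE; have aq := chart_at_atlas q.
apply: trans_jacM => //; last exact: chart_at_dom.
- exact: atlas_compatible.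
- exact/compatible_charts_sym/smooth_chart_compatible.
- exact/compatible_charts_sym/smooth_chart_compatible.
Qed.

Lemma trans_jac_unit c d q : atlas c -> smooth_chart d -> dom c q -> dom d q ->
  trans_jac c d q \in unitmx.
Proof.
move=> ac sd cq dq; have cd := compatible_charts_sym (smooth_chart_compatible sd ac).
by have /mulmx1_unit[u _] := trans_jacK ac cd cq dq; exact: u.
Qed.

Lemma cojac_unit c q : smooth_chart c -> dom c q -> cojac c q \in unitmx.
Proof. by move=> sc cq; rewrite /cojac unitmx_tr unitmx_inv jac_unit. Qed.

Lemma cojac_chart_at q : cojac (chart_at q) q = 1%:M.
Proof. by rewrite /cojac jac_chart_at invmx1 trmx1. Qed.

Lemma cojac_trans c d q : atlas c -> smooth_chart d -> dom c q -> dom d q ->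
  cojac c q = cojac d q *m (trans_jac c d q)^T.
Proof.
move=> ac sd cq dq; rewrite /cojac (jac_trans ac sd cq dq) -trmx_mul.
have Ju := trans_jac_unit ac sd cq dq; have ju := jac_unit (atlas_smooth_chart ac) cq.
by rewrite (mulmx_invM ju Ju).
Qed.

Lemma bil_in_trans (b : X -> 'M[R]_n) c d q : atlas c -> smooth_chart d -> dom c q -> dom d q ->
  bil_in b c q = trans_jac c d q *m bil_in b d q *m (trans_jac c d q)^T.
Proof.
move=> ac sd cq dq; rewrite /bil_in (cojac_trans ac sd cq dq) trmx_mul trmxK.
by rewrite !mulmxA.
Qed.

Lemma vec_in_chart_at (Y : X -> 'rV[R]_n) q : vec_in Y (chart_at q) q = Y q.
Proof. by rewrite /vec_in jac_chart_at mulmx1. Qed.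

Lemma bil_in_chart_at (b : X -> 'M[R]_n) q : bil_in b (chart_at q) q = b q.
Proof. by rewrite /bil_in cojac_chart_at trmx1 mulmx1 mul1mx. Qed.

End Charts.

(** * Adapted coframes *)

Lemma sum_ord2 (V : nmodType) (F : 'I_2 -> V) : \sum_i F i = F ord0 + F ord_max.
Proof. by rewrite big_ord_recl big_ord1; congr (_ + F _); exact: val_inj. Qed.

Lemma ord2P (P : 'I_2 -> Prop) : P ord0 -> P ord_max -> forall i, P i.
Proof.
by move=> P0 P1 i; case: (unliftP ord0 i) => [j ->|->//]; rewrite ord1; congr P: P1; exact: val_inj.
Qed.

Section Coframes.
Variables (R : realType) (s : nat).
Local Notation n := (2 * s.+1)%N.
Implicit Types (u v : coframe R s) (G : 'M[R]_n) (A : 'M[R]_n) (x y : 'rV[R]_n).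
Implicit Types (i l : 'I_2) (j k m : 'I_s.+1) (b : 'M[R]_2).

Lemma dyE j i k l : dy R j i 0 (mxvec_index l k) = ((i == l) && (j == k))%:R.
Proof.
rewrite /dy !mxE /= (inj_eq (@cast_ord_inj _ _ _)) (inj_eq enum_rank_inj).
by rewrite eq_sym xpair_eqE.
Qed.

Lemma dy_mulmx (m' : nat) j i (B : 'M[R]_(n, m')) : dy R j i *m B = row (mxvec_index i j) B.
Proof. by rewrite rowE. Qed.

(** The matrix with rows v i j, ordered as the standard covectors [dy]; through [ext_mx] it carries
    the standard exterior algebra to that of a cotangent space. *)
Definition frame_mx v : 'M[R]_n := \sum_i \sum_j (dy R j i)^T *m v i j.

Lemma dy_frame j i v : dy R j i *m frame_mx v = v i j.
Proof.
apply/rowP => a; rewrite dy_mulmx mxE summxE (bigD1 i)//= summxE (bigD1 j)//=.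
rewrite !big1 ?addr0 => [|l li|k kj].
- by rewrite mxE big_ord1 mxE dyE !eqxx mul1r.
- by rewrite summxE big1// => k _; rewrite mxE big_ord1 mxE dyE (negPf li) mul0r.
- by rewrite mxE big_ord1 mxE dyE (negPf kj) andbF mul0r.
Qed.

Lemma dy_row_inj (m' : nat) (B C : 'M[R]_(n, m')) :
  (forall i j, dy R j i *m B = dy R j i *m C) -> B = C.
Proof.
move=> BC; apply/row_matrixP => k; case/mxvec_indexP: k => i j.
by rewrite -!dy_mulmx.
Qed.

Lemma frame_mx_unique v A : (forall i j, dy R j i *m A = v i j) -> A = frame_mx v.
Proof. by move=> Av; apply: dy_row_inj => i j; rewrite Av dy_frame. Qed.

Lemma frame_mxM v A : frame_mx v *m A = frame_mx (fun i j => v i j *m A).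
Proof. by apply: frame_mx_unique => i j; rewrite mulmxA dy_frame. Qed.

Lemma frame_mx_orthonormal G v : orthonormal G v ->
  frame_mx v *m invmx G *m (frame_mx v)^T = 1%:M.
Proof.
move=> vG; apply: dy_row_inj => i j; rewrite mulmx1 !mulmxA dy_frame.
apply: (can_inj (@trmxK _ _ _)); apply: dy_row_inj => l k.
rewrite !trmx_mul trmxK !mulmxA dy_frame.
have -> : v l k *m (invmx G)^T *m (v i j)^T = (v i j *m invmx G *m (v l k)^T)^T.
  by rewrite !trmx_mul trmxK mulmxA.
by apply/matrixP => a c; rewrite !ord1 mxE vG dy_mulmx 2!mxE dyE.
Qed.

Lemma frame_mx_unit G v : orthonormal G v -> frame_mx v \in unitmx.
Proof. by move=> /frame_mx_orthonormal; rewrite -mulmxA => /mulmx1_unit[]. Qed.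

Lemma mulmx_wedge2 x y (z : 'rV[R]_n) A : z *m A *m wedge2 x y =
  (z *m A *m x^T) 0 0 *: y - (z *m A *m y^T) 0 0 *: x.
Proof.
rewrite /wedge2 mulmxBr !mulmxA.
by rewrite [z *m A *m x^T]mx11_scalar [z *m A *m y^T]mx11_scalar !mul_scalar_mx !mxE !eqxx !mulr1n.
Qed.

Lemma wedge2_mulmx x y A : wedge2 (x *m A) (y *m A) = A^T *m wedge2 x y *m A.
Proof. by rewrite /wedge2 !trmx_mul mulmxBr mulmxBl !mulmxA. Qed.

Lemma wedge2Dl x x' y : wedge2 (x + x') y = wedge2 x y + wedge2 x' y.
Proof. by rewrite /wedge2 linearD/= mulmxDl mulmxDr opprD addrACA. Qed.

Lemma wedge2Zl (a : R) x y : wedge2 (a *: x) y = a *: wedge2 x y.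
Proof. by rewrite /wedge2 linearZ/= -scalemxAl -scalemxAr scalerBr. Qed.

Lemma wedge2C x y : wedge2 x y = - wedge2 y x.
Proof. by rewrite /wedge2 opprB. Qed.

Lemma wedge2Dr x y y' : wedge2 x (y + y') = wedge2 x y + wedge2 x y'.
Proof. by rewrite wedge2C wedge2Dl opprD -!wedge2C. Qed.

Lemma wedge2Zr (a : R) x y : wedge2 x (a *: y) = a *: wedge2 x y.
Proof. by rewrite wedge2C wedge2Zl -scalerN -wedge2C. Qed.

Lemma wedge2xx x : wedge2 x x = 0.
Proof. by rewrite /wedge2 subrr. Qed.

(** Only the term l = i contributes. With an index raised by the metric, omega_0j thus carries W_0
    to W_j, and back with a minus sign in the next lemma. *)
Lemma orthonormal_contract G v i j : orthonormal G v -> j != ord0 ->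
  v i ord0 *m invmx G *m (\sum_l wedge2 (v l ord0) (v l j)) = v i j.
Proof.
move=> vG j0; rewrite mulmx_sumr (bigD1 i)//= big1 ?addr0 => [|l li];
  rewrite mulmx_wedge2 !vG.
  by rewrite !eqxx eq_sym (negPf j0) andbF scale1r scale0r subr0.
by rewrite eq_sym (negPf li) !scale0r subr0.
Qed.

Lemma orthonormal_contract' G v i j : orthonormal G v -> j != ord0 ->
  v i j *m invmx G *m (\sum_l wedge2 (v l ord0) (v l j)) = - v i ord0.
Proof.
move=> vG j0; rewrite mulmx_sumr (bigD1 i)//= big1 ?addr0 => [|l li];
  rewrite mulmx_wedge2 !vG.
  by rewrite !eqxx (negPf j0) scale1r scale0r sub0r.
by rewrite eq_sym (negPf li) !scale0r subr0.
Qed.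

Definition rotate b v : coframe R s := fun i j => \sum_l b i l *: v l j.

(* The forms [omega_0j] determine W_0: contracting [omega_0j] shows that it is
   contained in the span of the [u l 0] and [u l j], for every j != 0; as there
   are at least two such j, it is contained in the span of the [u l 0]. *)
Lemma coframe_span G u v : (2 <= s)%N -> frame_mx u \in unitmx -> orthonormal G v ->
  (forall j, j != ord0 -> \sum_l wedge2 (v l ord0) (v l j) = \sum_l wedge2 (u l ord0) (u l j)) ->
  exists b, forall i, v i ord0 = \sum_l b i l *: u l ord0.
Proof.
move=> hs Fu vG vu; pose c i := v i ord0 *m invmx (frame_mx u).
exists (\matrix_(i, l) c i 0 (mxvec_index l ord0)) => i.
have cE : c i = \sum_l \sum_j c i 0 (mxvec_index l j) *: dy R j l.
  apply/rowP => k; case/mxvec_indexP: k => l j.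
  rewrite summxE (bigD1 l)//= summxE (bigD1 j)//= !big1 ?addr0 => [|l' li|k kj].
  - by rewrite [RHS]mxE dyE !eqxx mulr1.
  - by rewrite summxE big1// => k _; rewrite [LHS]mxE dyE (negPf li) mulr0.
  - by rewrite [LHS]mxE dyE (negPf kj) andbF mulr0.
have c0 l m : m != ord0 -> c i 0 (mxvec_index l m) = 0.
  move=> m0; have [j j0 jm] : exists2 j : 'I_s.+1, j != ord0 & j != m.
    have s1 : (1 < s.+1)%N by rewrite ltnS ltnW.
    have [m1|m1] := eqVneq m (Ordinal s1).
      by exists (Ordinal (hs : (2 < s.+1)%N)); rewrite // m1.
    by exists (Ordinal s1); rewrite // eq_sym.
  have := orthonormal_contract' i vG j0; rewrite vu// mulmx_sumr.
  move/(congr1 (fun z => - (z *m invmx (frame_mx u)))); rewrite mulNmx opprK.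
  move=> /rowP/(_ (mxvec_index l m)); rewrite -/(c i) => <-.
  rewrite mulmx_suml !mxE summxE big1 ?oppr0// => l' _.
  rewrite mulmx_wedge2 mulmxBl -!scalemxAl -[u l' j]dy_frame -[u l' ord0]dy_frame.
  rewrite !mulmxK// mxE [X in X + _]mxE [X in _ + X]mxE [X in _ - X]mxE !dyE.
  by rewrite (negPf jm) [ord0 == m]eq_sym (negPf m0) !andbF !mulr0 subr0.
have -> : v i ord0 = c i *m frame_mx u by rewrite mulmxKV.
rewrite {1}cE mulmx_suml; apply: eq_bigr => l _; rewrite mulmx_suml (bigD1 ord0)//=.
rewrite big1 ?addr0 => [|m m0]; first by rewrite -scalemxAl dy_frame [in RHS]mxE.
by rewrite c0// scale0r mul0mx.
Qed.

(** The condition [adapted] freed from the manifold, so that it also applies to components in a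
    chart. *)
Definition adapted_form G (W : 'I_s.+1 -> 'I_s.+1 -> 'M[R]_n) v :=
  orthonormal G v /\ forall j k, W j k = \sum_i wedge2 (v i j) (v i k).

(** The determinant of b, expanded for computations with [ring]. *)
Definition rotdet b : R := b ord0 ord0 * b ord_max ord_max - b ord0 ord_max * b ord_max ord0.

Lemma rotationE b : b *m b^T = 1%:M ->
  [/\ b ord0 ord0 ^+ 2 + b ord0 ord_max ^+ 2 = 1,
      b ord_max ord0 ^+ 2 + b ord_max ord_max ^+ 2 = 1 &
      b ord0 ord0 * b ord_max ord0 + b ord0 ord_max * b ord_max ord_max = 0].
Proof.
move=> bb; have bE i l : b i ord0 * b l ord0 + b i ord_max * b l ord_max = (i == l)%:R.
  by have /matrixP/(_ i l) := bb; rewrite !mxE sum_ord2 !mxE.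
by split; rewrite ?expr2 ?bE.
Qed.

Lemma rotdet_sqr b : b *m b^T = 1%:M -> rotdet b ^+ 2 = 1.
Proof.
move=> /rotationE[b1 b2 b3]; rewrite /rotdet; set x := b ord0 ord0 in b1 b3 *.
set y := b ord0 ord_max in b1 b3 *; set z := b ord_max ord0 in b2 b3 *.
set t := b ord_max ord_max in b2 b3 *.
(* Lagrange's identity for the two rows of b. *)
have -> : (x * t - y * z) ^+ 2 = (x ^+ 2 + y ^+ 2) * (z ^+ 2 + t ^+ 2) - (x * z + y * t) ^+ 2.
  by ring.
by rewrite b1 b2 b3 expr0n mulr1 subr0.
Qed.

Lemma rotdetP b : b *m b^T = 1%:M -> rotdet b = 1 \/ rotdet b = -1.
Proof.
by move/rotdet_sqr/eqP; rewrite sqrf_eq1 => /orP[]/eqP; [left|right].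
Qed.

Lemma mulmx_scale_gram (a a' : R) x y A :
  (a *: x *m A *m (a' *: y)^T) 0 0 = a * a' * (x *m A *m y^T) 0 0.
Proof.
by rewrite linearZ/= -!scalemxAl -scalemxAr scalerA [LHS]mxE.
Qed.

Lemma rotate_gram G v b i j l k : orthonormal G v ->
  (rotate b v i j *m invmx G *m (rotate b v l k)^T) 0 0 = (b *m b^T) i l * (j == k)%:R.
Proof.
move=> vG; rewrite /rotate [(\sum_l _)^T]linear_sum/= !mulmx_suml summxE mxE mulr_suml.
apply: eq_bigr => l' _; rewrite mulmx_sumr summxE (bigD1 l')//= big1 ?addr0 => [|i' li'].
  by rewrite mulmx_scale_gram vG eqxx mxE.
by rewrite mulmx_scale_gram vG eq_sym (negPf li') mulr0.
Qed.

Lemma orthonormal_rotate G v b : orthonormal G v -> b *m b^T = 1%:M ->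
  orthonormal G (rotate b v).
Proof. by move=> vG bb i j l k; rewrite rotate_gram// bb mxE -natrM mulnb. Qed.

Lemma adapted_rotate G W v b : adapted_form G W v -> b *m b^T = 1%:M ->
  adapted_form G W (rotate b v).
Proof.
move=> [vG vW] bb; split=> [|j k]; first exact: orthonormal_rotate.
(* Expanding the two-forms produces products of columns of b, so the orthogonality relations are
   those of b^T. *)
have /rotationE[c1 c2 c3] : b^T *m b^T^T = 1%:M by rewrite trmxK (mulmx1C bb).
rewrite !mxE in c1 c2 c3.
rewrite vW !sum_ord2 /rotate !sum_ord2.
rewrite !(wedge2Dl, wedge2Dr, wedge2Zl, wedge2Zr).
set w00 := wedge2 (v ord0 j) (v ord0 k); set w11 := wedge2 (v ord_max j) (v ord_max k).
set w01 := wedge2 (v ord0 j) (v ord_max k); set w10 := wedge2 (v ord_max j) (v ord0 k).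
rewrite [RHS](_ : _ = (b ord0 ord0 ^+ 2 + b ord_max ord0 ^+ 2) *: w00
  + (b ord0 ord_max ^+ 2 + b ord_max ord_max ^+ 2) *: w11
  + (b ord0 ord0 * b ord0 ord_max + b ord_max ord0 * b ord_max ord_max) *: w01
  + (b ord0 ord0 * b ord0 ord_max + b ord_max ord0 * b ord_max ord_max) *: w10).
  by rewrite c1 c2 c3 !scale1r !scale0r !addr0.
by apply/matrixP => p q; rewrite !mxE; ring.
Qed.

Lemma adapted_contract G W v i j : adapted_form G W v -> j != ord0 ->
  v i j = v i ord0 *m invmx G *m W ord0 j.
Proof. by move=> [vG vW] j0; rewrite vW orthonormal_contract. Qed.

Lemma adapted_frames_rotate G W v v' : (2 <= s)%N -> adapted_form G W v ->
  adapted_form G W v' -> exists b, b *m b^T = 1%:M /\ v' = rotate b v.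
Proof.
move=> hs av av'; have [vG vW] := av; have [vG' vW'] := av'.
have [b bE] := coframe_span hs (frame_mx_unit vG) vG' (fun j _ => etrans (esym (vW' ord0 j)) (vW ord0 j)).
have v'E : v' = rotate b v.
  apply/funext => i; apply/funext => j; have [->|j0] := eqVneq j ord0; first exact: bE.
  rewrite (adapted_contract i av' j0) bE !mulmx_suml; apply: eq_bigr => l _.
  by rewrite -!scalemxAl -(adapted_contract l av j0).
exists b; split => //; apply/matrixP => i i'; rewrite !mxE.
have := vG' i ord0 i' ord0; rewrite eqxx andbT => <-.
by rewrite v'E rotate_gram// eqxx mulr1 mxE.
Qed.

Lemma wedge2_rotate b v j : wedge2 (rotate b v ord0 j) (rotate b v ord_max j)
  = rotdet b *: wedge2 (v ord0 j) (v ord_max j).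
Proof.
rewrite /rotate !sum_ord2 !(wedge2Dl, wedge2Dr, wedge2Zl, wedge2Zr) !wedge2xx.
rewrite [wedge2 (v ord_max j) _]wedge2C.
by apply/matrixP => p q; rewrite /rotdet !mxE; ring.
Qed.

Lemma wedge_rotate b v j : wedge (rotate b v ord0 j) *m wedge (rotate b v ord_max j)
  = rotdet b *: (wedge (v ord0 j) *m wedge (v ord_max j)).
Proof. by rewrite -!wedge_form2_wedge2 wedge2_rotate linearZ. Qed.

(** Contracting the form with its first factor returns the second, which has length one. *)
Lemma area_form_neq0 G v : orthonormal G v -> wedge2 (v ord0 ord0) (v ord_max ord0) != 0.
Proof.
move=> vG; apply/eqP => v0; have := mulmx_wedge2 (v ord0 ord0) (v ord_max ord0) (v ord0 ord0) (invmx G).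
rewrite v0 mulmx0 !vG/= scale1r scale0r subr0 => v10.
have := vG ord_max ord0 ord_max ord0; rewrite -v10 !mul0mx mxE eqxx/= => /esym/eqP.
by rewrite oner_eq0.
Qed.

Definition std_coframe : coframe R s := fun i j => dy R j i.

Lemma frame_mx_std : frame_mx std_coframe = 1%:M.
Proof. by apply/esym/frame_mx_unique => i j; rewrite mulmx1. Qed.

(** A rotation multiplies the frame matrix on the left by a matrix depending on b alone; for
    constant b this preserves smoothness and changes components by a constant conjugation. *)
Lemma frame_mx_rotate b v : frame_mx (rotate b v) = frame_mx (rotate b std_coframe) *m frame_mx v.
Proof.
rewrite frame_mxM; congr frame_mx; apply/funext => i; apply/funext => j.
by rewrite mulmx_suml; apply: eq_bigr => l _; rewrite -scalemxAl dy_frame.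
Qed.

Definition reflection : 'M[R]_2 := diag_mx (\row_i (-1) ^+ (i == ord_max)).

Lemma reflection_orthogonal : reflection *m reflection^T = 1%:M.
Proof.
rewrite tr_diag_mx mulmx_diag; apply/matrixP => i l; rewrite !mxE.
by rewrite -expr2 sqrr_sign.
Qed.

Lemma rotdet_reflection : rotdet reflection = -1.
Proof. by rewrite /rotdet !mxE/= !mulr1n !mulr0n !expr0 !expr1 mul1r mul0r subr0. Qed.

End Coframes.

(** * The fibres in an adapted coframe *)

Section LieSpans.
Variables (R : realType).

(** Generators are only asked to map into the span, since a generator taken in another coframe may
    be minus a standard one. *)
Lemma lie_span_map (V W : lmodType R[i]) (brV : V -> V -> V) (brW : W -> W -> W)
    (F : set R[i]) (S : set V) (S' : set W) (phi : V -> W) :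
  phi 0 = 0 -> (forall x y, phi (x + y) = phi x + phi y) ->
  (forall a x, F a -> phi (a *: x) = a *: phi x) ->
  (forall x y, phi (brV x y) = brW (phi x) (phi y)) ->
  (forall x, S x -> lie_span brW F S' (phi x)) ->
  forall x, lie_span brV F S x -> lie_span brW F S' (phi x).
Proof.
move=> p0 pD pZ pB pS x; elim=> {x} [x /pS//||x y _ Hx _ Hy|a x Fa _ Hx|x y _ Hx _ Hy].
- by rewrite p0; exact: lie_span_0.
- by rewrite pD; exact: lie_span_add.
- by rewrite pZ//; exact: lie_span_scale.
- by rewrite pB; exact: lie_span_br.
Qed.

Lemma lie_spanW (V : lmodType R[i]) (br : V -> V -> V) (F F' : set R[i]) (S : set V) x :
  F `<=` F' -> lie_span br F S x -> lie_span br F' S x.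
Proof.
move=> FF; elim=> {x} [x Sx||x y _ Hx _ Hy|a x Fa _ Hx|x y _ Hx _ Hy].
- exact: lie_span_gen.
- exact: lie_span_0.
- exact: lie_span_add.
- by apply: lie_span_scale => //; exact: FF.
- exact: lie_span_br.
Qed.

(** A row space of maximal rank inside T exhausts T: a vector of T outside it could be added and
    would raise the rank. *)
Lemma rV_subspace_mx D (T : set 'rV[R]_D) : T 0 -> (forall u v, T u -> T v -> T (u + v)) ->
  (forall (a : R) u, T u -> T (a *: u)) ->
  exists W : 'M[R]_D, forall u, T u <-> (u <= W)%MS.
Proof.
move=> T0 TD TZ.
pose P k := `[< exists2 W : 'M[R]_D, (forall u : 'rV_D, (u <= W)%MS -> T u) & \rank W = k >].
have P0 : exists k, P k.
  exists 0%N; apply/asboolP; exists 0; rewrite ?mxrank0// => u.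
  by rewrite submx0 => /eqP ->.
have Pb k : P k -> (k <= D)%N by move=> /asboolP[W _ <-]; exact: rank_leq_row.
case: (ex_maxnP P0 Pb) => k /asboolP[W WT Wk] kmax; exists W => u; split; last exact: WT.
move=> Tu; apply/negPn/negP => uW.
have : P (\rank (W + u)%MS).
  apply/asboolP; exists (W + u)%MS => // u' /sub_addsmxP[[a b] /= ->].
  apply: TD; first by apply: WT; exact: submxMl.
  by rewrite [b]mx11_scalar mul_scalar_mx; exact: TZ.
move=> /kmax; apply/negP; rewrite -ltnNge -Wk; apply: rank_ltmx.
rewrite ltmxE addsmxSl/=; apply: contra uW; apply: submx_trans; exact: addsmxSr.
Qed.

End LieSpans.

(** * Complex matrices through their real and imaginary parts *)

Section ComplexMatrices.
Variables (R : realType).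

Lemma complex_mxE m n (C : 'M[R[i]]_(m, n)) : C = (mRe C)%:CM + 'i *: (mIm C)%:CM.
Proof.
apply/matrixP => i j; rewrite !mxE; case: (C i j) => a b /=.
by apply/eqP; rewrite eq_complex /=; apply/andP; split; apply/eqP; ring.
Qed.

Lemma mReE m n (A B : 'M[R]_(m, n)) : mRe (A%:CM + 'i *: B%:CM) = A.
Proof. by apply/matrixP => i j; rewrite !mxE /=; ring. Qed.

Lemma mImE m n (A B : 'M[R]_(m, n)) : mIm (A%:CM + 'i *: B%:CM) = B.
Proof. by apply/matrixP => i j; rewrite !mxE /=; ring. Qed.

Lemma mReD m n (C C' : 'M[R[i]]_(m, n)) : mRe (C + C') = mRe C + mRe C'.
Proof. by apply/matrixP => i j; rewrite !mxE; case: (C i j); case: (C' i j). Qed.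

Lemma mImD m n (C C' : 'M[R[i]]_(m, n)) : mIm (C + C') = mIm C + mIm C'.
Proof. by apply/matrixP => i j; rewrite !mxE; case: (C i j); case: (C' i j). Qed.

Lemma mReZ m n (z : R[i]) (C : 'M[R[i]]_(m, n)) :
  mRe (z *: C) = complex.Re z *: mRe C - complex.Im z *: mIm C.
Proof. by apply/matrixP => i j; rewrite !mxE; case: z; case: (C i j). Qed.

Lemma mImZ m n (z : R[i]) (C : 'M[R[i]]_(m, n)) :
  mIm (z *: C) = complex.Re z *: mIm C + complex.Im z *: mRe C.
Proof. by apply/matrixP => i j; rewrite !mxE; case: z; case: (C i j). Qed.

Lemma real_mxM m n p (A : 'M[R]_(m, n)) (B : 'M[R]_(n, p)) : (A *m B)%:CM = A%:CM *m B%:CM.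
Proof. exact: map_mxM. Qed.

Lemma real_mxZ m n (a : R) (A : 'M[R]_(m, n)) : (a *: A)%:CM = a%:C *: A%:CM.
Proof. exact: map_mxZ. Qed.

Lemma conj_complex_mx m n (A : 'M[R]_(m, n)) (C : 'M[R[i]]_n) (B : 'M[R]_(n, m)) :
  A%:CM *m C *m B%:CM = (A *m mRe C *m B)%:CM + 'i *: (A *m mIm C *m B)%:CM.
Proof.
by rewrite {1}[C]complex_mxE mulmxDr mulmxDl -scalemxAr -scalemxAl !real_mxM.
Qed.

Definition real_linear_set m n (S : set 'M[R[i]]_(m, n)) := [/\ S 0,
  forall A B, S A -> S B -> S (A + B) & forall (a : R) A, S A -> S (a%:C *: A)].

(** Encoding a matrix by its real and imaginary parts turns S into a row space, whose cokernel
    supplies the equations. In this form membership in S can be differentiated. *)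
Lemma real_linear_set_eqns m n (S : set 'M[R[i]]_(m, n)) : real_linear_set S ->
  exists D (B B' : 'M[R]_(m * n, D)),
    forall C, S C <-> mxvec (mRe C) *m B + mxvec (mIm C) *m B' = 0.
Proof.
move=> [S0 SD SZ]; pose f (u : 'rV[R]_(m * n + m * n)) : 'M[R[i]]_(m, n) :=
  (vec_mx (lsubmx u))%:CM + 'i *: (vec_mx (rsubmx u))%:CM.
have [|u v|a u|W WP] := @rV_subspace_mx R _ [set u | S (f u)].
- by rewrite /= /f !linear0 !map_mx0 scaler0 addr0.
- move=> Su Sv /=; suff -> : f (u + v) = f u + f v by exact: SD.
  by rewrite /f !linearD/= !map_mxD scalerDr addrACA.
- move=> Su /=; suff -> : f (a *: u) = a%:C *: f u by exact: SZ.
  by rewrite /f !linearZ/= !real_mxZ scalerDr !scalerA [_ * a%:C]mulrC.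
exists (m * n + m * n)%N, (usubmx (cokermx W)), (dsubmx (cokermx W)) => C.
rewrite -mul_row_col vsubmxK.
have fC : f (row_mx (mxvec (mRe C)) (mxvec (mIm C))) = C.
  by rewrite /f row_mxKl row_mxKr !mxvecK -complex_mxE.
rewrite -{1}fC; apply: (iff_trans (WP _)); rewrite submxE; split=> /eqP//.
Qed.

End ComplexMatrices.

Lemma imaginary_mul (A : comRingType) (j a c x y : A) : j * j = -1 ->
  (a + j * c) * (x + j * y) = a * x - c * y + j * (a * y + c * x).
Proof.
move=> jj; have -> : (a + j * c) * (x + j * y)
    = a * x + (j * j) * (c * y) + j * (a * y + c * x) by ring.
by rewrite jj; ring.
Qed.

(** * Generators and fibres as conjugates of constant ones *)

Section Generators.
Variables (R : realType) (s : nat) (X : manifold R (2 * s.+1)) (K : almost_sKahler X).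
Local Notation n := (2 * s.+1)%N.
Local Notation N := (extdim n).
Local Notation M := 'M[R[i]]_N.
Implicit Types (p q : X) (x : generator s) (b : bundle) (v : X -> coframe R s).

Definition frame_op (v : coframe R s) : 'M[R]_N := ext_mx (frame_mx v).

(** The generators in the standard coframe; its metric is the Euclidean one, so the adjoint is the
    transpose. *)
Definition std_op x : 'M[R]_N :=
  match x with
  | GenL j k => \sum_i wedge (dy R j i) *m wedge (dy R k i)
  | GenLambda j k => (\sum_i wedge (dy R j i) *m wedge (dy R k i))^T
  | GenV j => wedge (dy R j ord0) *m wedge (dy R j ord_max)
  | GenA j => (wedge (dy R j ord0) *m wedge (dy R j ord_max))^T
  end.

Lemma frame_op_unit G (v : coframe R s) : orthonormal G v -> frame_op v \in unitmx.
Proof. by move=> vG; exact/ext_mx_unit/(frame_mx_unit vG). Qed.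

(** Orthonormality of v makes E an isometry from the Euclidean inner product to the one with Gram
    matrix H, that is E^T *m H *m E = 1; the adjoint for H therefore corresponds to the
    transpose. *)
Lemma adjoint_conj G (v : coframe R s) (A : 'M[R]_N) : orthonormal G v ->
  adjoint G (frame_op v *m A *m invmx (frame_op v))
    = frame_op v *m A^T *m invmx (frame_op v).
Proof.
move=> vG; have Eu := frame_op_unit vG; rewrite /adjoint; set H := ext_mx (invmx G).
set E := frame_op v in Eu *.
have EHE : E^T *m H *m E = 1%:M.
  by rewrite -ext_mx_tr -mulmxA -!ext_mxM frame_mx_orthonormal// ext_mx1.
have ETH : E^T *m H = invmx E by rewrite -[LHS](mulmxK Eu) EHE mul1mx.
have EETH : (E *m E^T) *m H = 1%:M by rewrite -mulmxA ETH mulmxV.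
have HV : invmx H = E *m E^T.
  by have /mulmx1_unit[_ Hu] := EETH; rewrite -[LHS]mul1mx -EETH mulmxK.
rewrite HV !trmx_mul trmx_inv -!mulmxA ETH; congr (_ *m _).
by rewrite !mulmxA mulmxV ?unitmx_tr// mul1mx.
Qed.

Lemma wedge_frame (v : coframe R s) (j : 'I_s.+1) i : frame_mx v \in unitmx ->
  wedge (v i j) = frame_op v *m wedge (dy R j i) *m invmx (frame_op v).
Proof.
by move=> Fu; rewrite /frame_op ext_mx_wedge dy_frame mulmxK// ext_mx_unit.
Qed.

Lemma wedge_frame2 (v : coframe R s) (j k : 'I_s.+1) i l : frame_mx v \in unitmx ->
  wedge (v i j) *m wedge (v l k)
    = frame_op v *m (wedge (dy R j i) *m wedge (dy R k l)) *m invmx (frame_op v).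
Proof.
move=> Fu; rewrite !(wedge_frame _ _ Fu) !mulmxA mulmxKV//.
exact: ext_mx_unit.
Qed.

Lemma generator_opE v x p : adapted (metric K) (omega K) p (v p) ->
  generator_op K v x p = frame_op (v p) *m std_op x *m invmx (frame_op (v p)).
Proof.
move=> [vG vW]; have Fu := frame_mx_unit vG.
have LE j k : L_op K j k p = frame_op (v p) *m
    (\sum_i wedge (dy R j i) *m wedge (dy R k i)) *m invmx (frame_op (v p)).
  rewrite /L_op vW linear_sum/= mulmx_sumr mulmx_suml; apply: eq_bigr => i _.
  by rewrite wedge_form2_wedge2 wedge_frame2.
case: x => [j k|j k|j|j] /=; first exact: LE.
- by rewrite /Lambda_op LE adjoint_conj.
- exact: wedge_frame2.
- by rewrite /A_op /V_op wedge_frame2// adjoint_conj.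
Qed.

Definition gen_sign (d : R) x : R :=
  match x with GenV _ | GenA _ => d | _ => 1 end.

Lemma generator_op_rotate v v' x p (b : 'M[R]_2) : v' p = rotate b (v p) ->
  generator_op K v' x p = gen_sign (rotdet b) x *: generator_op K v x p.
Proof.
move=> vE; case: x => [j k|j k|j|j] /=; rewrite ?scale1r//.
  by rewrite /V_op vE wedge_rotate.
by rewrite /A_op /V_op vE wedge_rotate /adjoint linearZ/= -scalemxAr -scalemxAl.
Qed.

(** For coframes adapted at the same point, this says that they induce the same orientation of
    W_0. *)
Definition alike (v v' : coframe R s) : Prop :=
  wedge2 (v ord0 ord0) (v ord_max ord0) = wedge2 (v' ord0 ord0) (v' ord_max ord0).

Lemma alike_sym (v v' : coframe R s) : alike v v' -> alike v' v.
Proof. by []. Qed.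

Lemma adapted_reflection p (v : coframe R s) : adapted (metric K) (omega K) p v ->
  adapted (metric K) (omega K) p (rotate (reflection R) v).
Proof.
by move=> av; exact: (@adapted_rotate _ _ (metric K p) (fun j k => omega K j k p) _ _ av
  (reflection_orthogonal R)).
Qed.

Hypothesis hs : (2 <= s)%N.

Lemma adapted_rotation p (v v' : coframe R s) : adapted (metric K) (omega K) p v ->
  adapted (metric K) (omega K) p v' ->
  exists b : 'M[R]_2, b *m b^T = 1%:M /\ v' = rotate b v.
Proof.
exact: (@adapted_frames_rotate _ _ (metric K p) (fun j k => omega K j k p)).
Qed.

(** The two area forms differ by the factor det b and do not vanish, so their equality forces det b
    = 1. *)
Lemma alike_generator_op p v v' x : adapted (metric K) (omega K) p (v p) ->
  adapted (metric K) (omega K) p (v' p) -> alike (v p) (v' p) ->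
  generator_op K v' x p = generator_op K v x p.
Proof.
move=> av av' vv'; have [b [bb v'E]] := adapted_rotation av av'.
rewrite (generator_op_rotate x v'E).
suff -> : rotdet b = 1 by case: x => *; rewrite scale1r.
move: vv'; rewrite /alike v'E wedge2_rotate => /esym/eqP.
rewrite -subr_eq0 -[X in _ - X]scale1r -scalerBl scaler_eq0.
by rewrite (negPf (area_form_neq0 av.1)) orbF subr_eq0 => /eqP.
Qed.

Lemma alike_or_reflection p (v v' : coframe R s) : adapted (metric K) (omega K) p v ->
  adapted (metric K) (omega K) p v' -> alike v v' \/ alike v (rotate (reflection R) v').
Proof.
move=> av av'; have [b [bb ->]] := adapted_rotation av av'.
have [d1|d1] := rotdetP bb; [left|right]; rewrite /alike !wedge2_rotate ?rotdet_reflection d1.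
  by rewrite scale1r.
by rewrite scalerA mulN1r opprK scale1r.
Qed.

Lemma not_alike_reflection p (v v' : coframe R s) : adapted (metric K) (omega K) p v ->
  alike v (rotate (reflection R) v') ->
  wedge2 (v' ord0 ord0) (v' ord_max ord0) = - wedge2 (v ord0 ord0) (v ord_max ord0).
Proof. by rewrite /alike wedge2_rotate rotdet_reflection => _ ->; rewrite scaleN1r opprK. Qed.

Definition std_section b x : M := coefficient R b x *: (std_op x)%:CM.

Definition std_alg b : set M :=
  lie_span (@commutator R s) (@reals R) [set std_section b x | x in [set x | listed b x]].

Definition std_fibre b : set M :=
  if b is LC then
    [set C | exists A B, [/\ std_alg LR A, std_alg LR B & C = A + 'i *: B]]
  else std_alg b.

Definition frame_conj (v : coframe R s) (C : M) : M :=
  (frame_op v)%:CM *m C *m (invmx (frame_op v))%:CM.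
Definition frame_unconj (v : coframe R s) (C : M) : M :=
  (invmx (frame_op v))%:CM *m C *m (frame_op v)%:CM.

Lemma frame_conjK G (v : coframe R s) : orthonormal G v -> cancel (frame_conj v) (frame_unconj v).
Proof.
move=> /frame_op_unit Eu C; rewrite /frame_conj /frame_unconj !mulmxA -real_mxM mulVmx//.
by rewrite map_mx1 mul1mx -mulmxA -real_mxM mulVmx// map_mx1 mulmx1.
Qed.

Lemma frame_unconjK G (v : coframe R s) : orthonormal G v -> cancel (frame_unconj v) (frame_conj v).
Proof.
move=> /frame_op_unit Eu C; rewrite /frame_conj /frame_unconj !mulmxA -real_mxM mulmxV//.
by rewrite map_mx1 mul1mx -mulmxA -real_mxM mulmxV// map_mx1 mulmx1.
Qed.

Lemma commutator_conj m (A : 'M[R[i]]_(m, N)) (B : 'M[R[i]]_(N, m)) (C D : M) : B *m A = 1%:M ->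
  A *m commutator C D *m B
    = (A *m C *m B) *m (A *m D *m B) - (A *m D *m B) *m (A *m C *m B).
Proof.
move=> BA; rewrite /commutator mulmxBr mulmxBl !mulmxA.
by rewrite -[A *m C *m B *m A]mulmxA BA mulmx1 -[A *m D *m B *m A]mulmxA BA mulmx1.
Qed.

Lemma frame_conj_linear (v : coframe R s) (a : R[i]) C D :
  frame_conj v (a *: C + D) = a *: frame_conj v C + frame_conj v D.
Proof. by rewrite /frame_conj mulmxDr mulmxDl -scalemxAr -scalemxAl. Qed.

Lemma frame_unconj_linear (v : coframe R s) (a : R[i]) C D :
  frame_unconj v (a *: C + D) = a *: frame_unconj v C + frame_unconj v D.
Proof. by rewrite /frame_unconj mulmxDr mulmxDl -scalemxAr -scalemxAl. Qed.

Lemma frame_conjZ (v : coframe R s) (a : R[i]) C : frame_conj v (a *: C) = a *: frame_conj v C.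
Proof. by rewrite /frame_conj -scalemxAr -scalemxAl. Qed.

Lemma frame_unconjZ (v : coframe R s) (a : R[i]) C :
  frame_unconj v (a *: C) = a *: frame_unconj v C.
Proof. by rewrite /frame_unconj -scalemxAr -scalemxAl. Qed.

Lemma frame_conj_commutator G (v : coframe R s) C D : orthonormal G v ->
  frame_conj v (commutator C D) = commutator (frame_conj v C) (frame_conj v D).
Proof.
move=> /frame_op_unit Eu; apply: commutator_conj.
by rewrite -real_mxM mulVmx// map_mx1.
Qed.

Lemma frame_unconj_commutator G (v : coframe R s) C D : orthonormal G v ->
  frame_unconj v (commutator C D) = commutator (frame_unconj v C) (frame_unconj v D).
Proof.
move=> /frame_op_unit Eu; apply: commutator_conj.
by rewrite -real_mxM mulmxV// map_mx1.
Qed.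

Lemma generator_section_conj b v x p : adapted (metric K) (omega K) p (v p) ->
  generator_section K b v x p = frame_conj (v p) (std_section b x).
Proof.
move=> av; rewrite /generator_section generator_opE// /frame_conj /std_section.
by rewrite !real_mxM -scalemxAr -scalemxAl.
Qed.

(** Conjugation by the frame preserves commutators. Generators taken in any other adapted coframe
    are those of v up to sign, so allowing all coframes adds nothing, and the fibre is the conjugate
    of one fixed algebra. *)
Lemma real_fibreP b p (v : coframe R s) C : adapted (metric K) (omega K) p v ->
  real_fibre K b p (frame_conj v C) <-> std_alg b C.
Proof.
move=> av; have vG := av.1; split=> [|H].
  rewrite -{2}[C](frame_conjK vG); apply: lie_span_map.
  - by rewrite /frame_unconj mulmx0 mul0mx.
  - by move=> A B; have := frame_unconj_linear v 1 A B; rewrite !scale1r.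
  - by move=> a A _; exact: frame_unconjZ.
  - by move=> A B; exact: frame_unconj_commutator vG.
  move=> _ [v' [x [av' bx ->]]].
  have [c [cc v'E]] := adapted_rotation av av'.
  have -> : generator_section K b v' x p
      = (gen_sign (rotdet c) x)%:C *: generator_section K b (fun=> v) x p.
    rewrite /generator_section (@generator_op_rotate (fun=> v) v' x p c v'E) real_mxZ.
    by rewrite !scalerA mulrC.
  rewrite (@generator_section_conj b (fun=> v) x p av).
  rewrite frame_unconjZ (frame_conjK vG); apply: lie_span_scale; first by exists (gen_sign (rotdet c) x).
  by apply: lie_span_gen; exists x.
move: C H; apply: lie_span_map.
- by rewrite /frame_conj mulmx0 mul0mx.
- by move=> A B; have := frame_conj_linear v 1 A B; rewrite !scale1r.
- by move=> a A _; exact: frame_conjZ.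
- by move=> A B; exact: frame_conj_commutator vG.
move=> _ [x bx <-]; apply: lie_span_gen; exists (fun=> v), x; split => //.
by rewrite generator_section_conj.
Qed.

Lemma fibreP b p (v : coframe R s) C : adapted (metric K) (omega K) p v ->
  fibre K b p (frame_conj v C) <-> std_fibre b C.
Proof.
move=> av; have vG := av.1; case: b; try exact: (real_fibreP _ _ av).
split=> [[A [B [HA HB CE]]]|[A [B [HA HB ->]]]].
  exists (frame_unconj v A), (frame_unconj v B); split.
  - by apply/(real_fibreP _ _ av); rewrite (frame_unconjK vG).
  - by apply/(real_fibreP _ _ av); rewrite (frame_unconjK vG).
  by rewrite -[C](frame_conjK vG) CE addrC frame_unconj_linear addrC.
exists (frame_conj v A), (frame_conj v B); split.
- exact/(real_fibreP _ _ av).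
- exact/(real_fibreP _ _ av).
by rewrite addrC frame_conj_linear addrC.
Qed.

Lemma real_scale_reals (a : R) : reals a%:C.
Proof. by exists a. Qed.

Lemma std_alg_real_linear b : real_linear_set (std_alg b).
Proof.
split; [exact: lie_span_0|exact: lie_span_add|].
by move=> a A; apply: lie_span_scale; exact: real_scale_reals.
Qed.

Lemma std_fibre_real_linear b : real_linear_set (std_fibre b).
Proof.
case: b; try exact: std_alg_real_linear.
have [S0 SD SZ] := std_alg_real_linear LR; split.
- by exists 0, 0; rewrite scaler0 addr0.
- move=> _ _ [A [B [HA HB ->]]] [A' [B' [HA' HB' ->]]].
  exists (A + A'), (B + B'); split; [exact: SD HA HA'|exact: SD HB HB'|].
  by rewrite scalerDr addrACA.
move=> a _ [A [B [HA HB ->]]].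
exists (a%:C *: A), (a%:C *: B); split; [exact: SZ HA|exact: SZ HB|].
by rewrite scalerDr !scalerA [_ * 'i]mulrC.
Qed.

Lemma commutatorDl (A A' B : M) : commutator (A + A') B = commutator A B + commutator A' B.
Proof. by rewrite /commutator mulmxDl mulmxDr opprD addrACA. Qed.
Lemma commutatorZl (a : R[i]) (A B : M) : commutator (a *: A) B = a *: commutator A B.
Proof. by rewrite /commutator -scalemxAl -scalemxAr scalerBr. Qed.
Lemma commutatorC (A B : M) : commutator A B = - commutator B A.
Proof. by rewrite /commutator opprB. Qed.
Lemma commutatorDr (A B B' : M) : commutator A (B + B') = commutator A B + commutator A B'.
Proof. by rewrite commutatorC commutatorDl opprD -!commutatorC. Qed.
Lemma commutatorZr (a : R[i]) (A B : M) : commutator A (a *: B) = a *: commutator A B.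
Proof. by rewrite commutatorC commutatorZl -scalerN -commutatorC. Qed.

(* For b = LC, the complexification of the real Lie algebra LR is the complex
   Lie algebra generated by the same generators. *)
Lemma std_fibreE b : std_fibre b =
  lie_span (@commutator R s) (@scalars R b) [set std_section b x | x in [set x | listed b x]].
Proof.
case: b => //.
have genE : [set std_section LC x | x in [set x | listed LC x]]
    = [set std_section LR x | x in [set x | listed LR x]].
  by apply/seteqP; split=> _ [x bx <-]; exists x => //; case: x bx.
rewrite genE; apply/seteqP; split=> [_ [A [B [HA HB ->]]]|].
  have sub : @reals R `<=` setT by [].
  apply: lie_span_add; first exact: (lie_spanW sub HA).
  by apply: lie_span_scale => //; exact: (lie_spanW sub HB).
have [S0 SD SZ] := std_alg_real_linear LR.
have SN A : std_alg LR A -> std_alg LR (- A) by move=> /(SZ (-1)); rewrite rmorphN1 scaleN1r.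
have ii : 'i * 'i = -1 :> R[i] by apply/eqP; rewrite eq_complex /=; apply/andP; split; apply/eqP; ring.
move=> C; elim=> {C} [C [x bx <-]||C D _ HC _ HD|z C _ _ HC|C D _ HC _ HD].
- exists (std_section LR x), 0; split=> //; last by rewrite scaler0 addr0.
  by apply: lie_span_gen; exists x.
- by exists 0, 0; rewrite scaler0 addr0.
- move: HC HD => [A [B [HA HB ->]]] [A' [B' [HA' HB' ->]]].
  exists (A + A'), (B + B'); split; [exact: SD HA HA'|exact: SD HB HB'|].
  by rewrite scalerDr addrACA.
- move: HC => [A [B [HA HB ->]]].
  exists ((complex.Re z)%:C *: A - (complex.Im z)%:C *: B),
    ((complex.Re z)%:C *: B + (complex.Im z)%:C *: A); split.
  + exact: (SD _ _ (SZ _ _ HA) (SN _ (SZ _ _ HB))).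
  + exact: (SD _ _ (SZ _ _ HB) (SZ _ _ HA)).
  have -> : z = (complex.Re z)%:C + 'i * (complex.Im z)%:C.
    by case: z => a c; apply/eqP; rewrite eq_complex /=; apply/andP; split; apply/eqP; ring.
  set a := (complex.Re _)%:C; set c := (complex.Im _)%:C.
  have -> : complex.Re (a + 'i * c) = complex.Re z by rewrite /=; ring.
  have -> : complex.Im (a + 'i * c) = complex.Im z by rewrite /=; ring.
  by apply/matrixP => k l; rewrite -/a -/c !mxE; exact: (imaginary_mul _ _ _ _ ii).
- move: HC HD => [A [B [HA HB ->]]] [A' [B' [HA' HB' ->]]].
  exists (commutator A A' - commutator B B'), (commutator A B' + commutator B A'); split.
  + exact: (SD _ _ (lie_span_br HA HA') (SN _ (lie_span_br HB HB'))).
  + exact: (SD _ _ (lie_span_br HA HB') (lie_span_br HB HA')).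
  rewrite !(commutatorDl, commutatorDr, commutatorZl, commutatorZr) scalerA ii scaleN1r.
  have regroup (x y z w : M) : x + 'i *: y + ('i *: z - w) = x - w + 'i *: (y + z).
    by rewrite scalerDr ['i *: z - w]addrC addrACA.
  exact: regroup.
Qed.

(** What commutes with the generators commutes with the algebra they generate. Here Q stands for the
    matrix between two coframes of the same orientation. *)
Lemma std_fibre_comm b (Q : M) : (forall x, Q *m (std_op x)%:CM = (std_op x)%:CM *m Q) ->
  forall C, std_fibre b C -> Q *m C = C *m Q.
Proof.
move=> QT C; rewrite std_fibreE; elim=> {C} [C [x bx <-]||C D _ HC _ HD|z C _ _ HC|C D _ HC _ HD].
- by rewrite -scalemxAr QT -scalemxAl.
- by rewrite mulmx0 mul0mx.
- by rewrite mulmxDr mulmxDl HC HD.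
- by rewrite -scalemxAr HC -scalemxAl.
- by rewrite /commutator mulmxBr mulmxBl !mulmxA HC HD -!mulmxA HC HD.
Qed.

(* Adapted coframes inducing the same orientation of W_0 differ by an element
   of SO(2), whose conjugation fixes every generator. *)
Lemma alike_frame_conj p (v v' : coframe R s) b C : adapted (metric K) (omega K) p v ->
  adapted (metric K) (omega K) p v' -> alike v v' -> std_fibre b C ->
  frame_conj v' C = frame_conj v C.
Proof.
move=> av av' vv' bC; have Eu := frame_op_unit av.1; have Eu' := frame_op_unit av'.1.
pose Q := invmx (frame_op v) *m frame_op v'.
have QT x : Q *m std_op x = std_op x *m Q.
  have := @alike_generator_op p (fun=> v) (fun=> v') x av av' vv'.
  rewrite (@generator_opE (fun=> v) x p av) (@generator_opE (fun=> v') x p av') => e.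
  have := congr1 (fun T => invmx (frame_op v) *m T *m frame_op v') e.
  by rewrite /Q !mulmxA mulmxKV// mulVmx// mul1mx.
have QC : Q%:CM *m C = C *m Q%:CM.
  by apply: (std_fibre_comm (b := b)) => // x; rewrite -!real_mxM QT.
have v'E : frame_op v' = frame_op v *m Q by rewrite /Q mulKVmx.
have VE : Q *m invmx (frame_op v') = invmx (frame_op v) by rewrite /Q mulmxK.
clearbody Q; rewrite /frame_conj {1}v'E real_mxM -(mulmxA _ Q%:CM C) QC.
by rewrite -VE real_mxM !mulmxA.
Qed.

End Generators.

(** * Smooth adapted frames *)

Section GramSchmidt.
Variables (R : realType) (s : nat).
Local Notation n := (2 * s.+1)%N.
Implicit Types (H b c : 'M[R]_2) (G : 'M[R]_n).

(** For H the Gram matrix of two vectors: the squared length of the part of the second orthogonal to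
    the first. *)
Definition gs_residue H : R :=
  H ord_max ord_max - H ord0 ord_max * H ord0 ord_max * (H ord0 ord0)^-1.

(** The lower triangular matrix of the Gram-Schmidt process, an explicit function of the Gram matrix
    whose smoothness can be read off. *)
Definition gs H : 'M[R]_2 :=
  let r := (Num.sqrt (H ord0 ord0))^-1 in
  let t := (Num.sqrt (gs_residue H))^-1 in
  \matrix_(i, l) if i == ord0 then (if l == ord0 then r else 0)
    else (if l == ord0 then - 1 * (H ord0 ord_max * (H ord0 ord0)^-1) * t else t).

Lemma gs_orthogonal H : H^T = H -> 0 < H ord0 ord0 -> 0 < gs_residue H ->
  gs H *m H *m (gs H)^T = 1%:M.
Proof.
move=> Hs a0 D0; have H10 : H ord_max ord0 = H ord0 ord_max by rewrite -{1}Hs mxE.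
have aV := mulfV (lt0r_neq0 a0).
have rE : (Num.sqrt (H ord0 ord0))^-1 * (Num.sqrt (H ord0 ord0))^-1 * H ord0 ord0 = 1.
  by rewrite -invfM -expr2 sqr_sqrtr ?ltW// mulVf// lt0r_neq0.
have tE : (Num.sqrt (gs_residue H))^-1 * (Num.sqrt (gs_residue H))^-1 * gs_residue H = 1.
  by rewrite -invfM -expr2 sqr_sqrtr ?ltW// mulVf// lt0r_neq0.
have sE i l : (gs H *m H *m (gs H)^T) i l =
    (gs H i ord0 * H ord0 ord0 + gs H i ord_max * H ord_max ord0) * gs H l ord0
    + (gs H i ord0 * H ord0 ord_max + gs H i ord_max * H ord_max ord_max) * gs H l ord_max.
  by rewrite mxE sum_ord2 !mxE !sum_ord2 !mxE.
apply/matrixP => i l; rewrite sE [RHS]mxE H10 {sE}.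
move: rE tE; rewrite /gs /gs_residue; set t := (Num.sqrt (_ - _))^-1.
set r := (Num.sqrt _)^-1; move: aV; set a := H ord0 ord0; set h := H ord0 ord_max.
set k := H ord_max ord_max; set a' := a^-1 => aV rE tE.
clearbody a h k a' r t; have a'E : a' * a = 1 by rewrite mulrC.
move: i l; apply: ord2P; apply: ord2P; rewrite !mxE /= ?mulr1n ?mulr0n.
- by rewrite -[RHS]rE; ring.
- have -> : (r * a + 0 * h) * (-1 * (h * a') * t) + (r * h + 0 * k) * t
    = r * h * t * (1 - a' * a) by ring.
  by rewrite a'E subrr mulr0.
- have -> : (-1 * (h * a') * t * a + t * h) * r + (-1 * (h * a') * t * h + t * k) * 0
    = r * h * t * (1 - a' * a) by ring.
  by rewrite a'E subrr mulr0.
- rewrite -[RHS]tE.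
  have -> : (-1 * (h * a') * t * a + t * h) * (-1 * (h * a') * t)
      + (-1 * (h * a') * t * h + t * k) * t
    = t * t * (k - h * h * a' - h * h * a' * (1 - a' * a)) by ring.
  by rewrite a'E subrr mulr0 subr0.
Qed.

Lemma rotdetM b c : rotdet (b *m c) = rotdet b * rotdet c.
Proof. by rewrite /rotdet !mxE !sum_ord2; ring. Qed.

Lemma rotdet1 : rotdet (1%:M : 'M[R]_2) = 1.
Proof. by rewrite /rotdet !mxE /= !mulr1n !mulr0n mulr1 mulr0 subr0. Qed.

(** With B the inverse of b one has H = B *m B^T: the first entry is the squared length of a nonzero
    row of B, and the residue is (det B)^2 divided by this entry. *)
Lemma gram_pos b H : b *m H *m b^T = 1%:M ->
  [/\ H^T = H, 0 < H ord0 ord0 & 0 < gs_residue H].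
Proof.
move=> bH; have /mulmx1_unit[bHu bTu] := bH; have bu : b \in unitmx by rewrite -unitmx_tr.
pose B := invmx b; have HE : H = B *m B^T.
  have := congr1 (fun A => B *m A *m B^T) bH; rewrite mulmx1 => <-.
  by rewrite /B !mulmxA mulVmx// mul1mx -mulmxA -trmx_mul mulVmx// trmx1 mulmx1.
have dB : rotdet B != 0.
  have : rotdet B * rotdet b = 1 by rewrite -rotdetM mulVmx// rotdet1.
  by move/eqP; apply: contraTneq => ->; rewrite mul0r eq_sym oner_eq0.
have H00 : H ord0 ord0 = B ord0 ord0 ^+ 2 + B ord0 ord_max ^+ 2.
  by rewrite HE mxE sum_ord2 !mxE !expr2.
have a0 : 0 < H ord0 ord0.
  rewrite lt_neqAle H00 addr_ge0 ?sqr_ge0// andbT eq_sym paddr_eq0 ?sqr_ge0//.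
  rewrite !sqrf_eq0; apply: contra dB => /andP[/eqP x0 /eqP y0].
  by rewrite /rotdet x0 y0 !mul0r subr0.
split=> //; first by rewrite HE trmx_mul trmxK.
have -> : gs_residue H = rotdet B ^+ 2 * (H ord0 ord0)^-1.
  have -> : rotdet B ^+ 2 = H ord0 ord0 * H ord_max ord_max - H ord0 ord_max * H ord0 ord_max.
    by rewrite HE !mxE !sum_ord2 !mxE /rotdet; ring.
  by rewrite /gs_residue mulrBl [H ord0 ord0 * _]mulrC mulfK ?lt0r_neq0.
by rewrite mulr_gt0 ?invr_gt0// exprn_even_gt0.
Qed.

(** The inner products of dx_1 and dx_2 for the metric on covectors. *)
Definition gram G : 'M[R]_2 :=
  \matrix_(i, l) (dy R (@ord0 s) i *m invmx G *m (dy R (@ord0 s) l)^T) 0 0.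

Definition darboux_form (j : 'I_s.+1) : 'M[R]_n := \sum_i wedge2 (dy R ord0 i) (dy R j i).

(* The adapted coframe obtained from dx_0, dx_1 by orthonormalization and
   contraction with the forms omega_0j, in Darboux coordinates where the metric
   has the matrix G. *)
Definition darboux_coframe G : coframe R s := fun i j =>
  let e0 := \sum_l gs (gram G) i l *: dy R ord0 l in
  if j == ord0 then e0 else e0 *m invmx G *m darboux_form j.

Lemma darboux_coframe_adapted G W v : (2 <= s)%N -> adapted_form G W v ->
  (forall j, j != ord0 -> W ord0 j = darboux_form j) ->
  [/\ adapted_form G W (darboux_coframe G), 0 < gram G ord0 ord0 & 0 < gs_residue (gram G)].
Proof.
move=> hs av Wd; have [vG vW] := av.
have su : frame_mx (@std_coframe R s) \in unitmx by rewrite frame_mx_std unitmx1.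
have [j j0|b bE] := coframe_span hs su vG; first by rewrite -vW Wd.
have bH : b *m gram G *m b^T = 1%:M.
  apply/matrixP => i l; have vil := vG i ord0 l ord0; rewrite eqxx andbT in vil.
  rewrite [RHS]mxE -vil !bE [(\sum_l _)^T]linear_sum/= !mulmx_suml summxE [LHS]mxE.
  transitivity (\sum_m \sum_k b i k * gram G k m * b l m).
    by apply: eq_bigr => m _; rewrite mxE mulr_suml mxE.
  rewrite exchange_big; apply: eq_bigr => k _.
  rewrite mulmx_sumr summxE; apply: eq_bigr => m _.
  by rewrite mulmx_scale_gram !mxE; ring.
have [Hs a0 D0] := gram_pos bH; split => //.
have bu : b \in unitmx by have /mulmx1_unit[_] := bH; rewrite unitmx_tr.
pose c := gs (gram G) *m invmx b.
have gc : gs (gram G) = c *m b by rewrite /c mulmxKV.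
clearbody c.
have cc : c *m c^T = 1%:M.
  rewrite -(gs_orthogonal Hs a0 D0) gc trmx_mul !mulmxA -[c *m b *m gram G]mulmxA.
  by rewrite -[c *m (b *m gram G) *m b^T]mulmxA bH mulmx1.
suff -> : darboux_coframe G = rotate c v by exact: adapted_rotate.
have e0 i : \sum_l gs (gram G) i l *: dy R (@ord0 s) l = \sum_l c i l *: v l ord0.
  under [RHS]eq_bigr do rewrite bE scaler_sumr.
  rewrite exchange_big/=; apply: eq_bigr => l _; rewrite gc mxE scaler_suml.
  by apply: eq_bigr => k _; rewrite scalerA.
apply/funext => i; apply/funext => k; rewrite /darboux_coframe /rotate e0.
case: eqVneq => [->//|k0]; rewrite !mulmx_suml; apply: eq_bigr => l _.
by rewrite -!scalemxAl -Wd// -(adapted_contract l av k0).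
Qed.

(** The dimension m is free because two sources occur: the coordinates of a chart, and the n * n
    entries of the metric matrix itself. *)
Lemma smooth_near_darboux_coframe m (G : 'rV[R]_m -> 'M[R]_n) (x : 'rV[R]_m) :
  smooth_near G x -> G x \in unitmx -> 0 < gram (G x) ord0 ord0 ->
  0 < gs_residue (gram (G x)) ->
  smooth_near (fun y => frame_mx (darboux_coframe (G y))) x.
Proof.
move=> sG Gu a0 D0.
have near_pos (f : 'rV[R]_m -> R) : smooth_near f x -> 0 < f x -> \near x, 0 < f x.
  by move=> sf f0; exact: (cvgr_gt _ (smooth_near_continuous sf)).
have nz (f : 'rV[R]_m -> R) : smooth_near f x -> 0 < f x -> \near x, f x != 0.
  by move=> sf f0; apply: filterS (near_pos f sf f0) => y; exact: lt0r_neq0.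
have Gun : \near x, G x \in unitmx.
  move: Gu; rewrite unitmxE unitfE => d0.
  have dn : \forall y \near x, \det (G y) != 0.
    exact: (cvgr_neq0 _ (smooth_near_continuous (smooth_near_det sG)) d0).
  by apply: filterS dn => y; rewrite unitmxE unitfE.
have sV := smooth_near_invmx Gun sG.
have sH i l : smooth_near (fun y => gram (G y) i l) x.
  under eq_fun do rewrite mxE.
  apply: (iffLR (smooth_near_mxP _ _)); apply: smooth_near_mulmx; last exact: smooth_near_cst.
  by apply: smooth_near_mulmx => //; exact: smooth_near_cst.
have aV := smooth_nearV (nz _ (sH _ _) a0) (sH ord0 ord0).
have sD : smooth_near (fun y => gs_residue (gram (G y))) x.
  apply: smooth_nearD => //; apply: smooth_nearN; apply: smooth_nearM => //.
  exact: smooth_nearM.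
have sqV (f : 'rV[R]_m -> R) : smooth_near f x -> 0 < f x ->
    smooth_near (fun y => (Num.sqrt (f y))^-1) x.
  move=> sf f0; have sq := smooth_near_sqrt (near_pos f sf f0) sf.
  by apply: smooth_nearV => //; apply: nz => //; rewrite sqrtr_gt0.
have sgs i l : smooth_near (fun y => gs (gram (G y)) i l) x.
  under eq_fun do rewrite mxE.
  case: (i == ord0); case: (l == ord0).
  - exact: (sqV _ (sH ord0 ord0)).
  - exact: smooth_near_cst.
  - apply: smooth_nearM; last exact: (sqV _ sD).
    by apply: smooth_nearM; [exact: smooth_near_cst|exact: smooth_nearM].
  - exact: (sqV _ sD).
apply: smooth_near_sum => i _; apply: smooth_near_sum => j _.
apply: smooth_near_mulmx; first exact: smooth_near_cst.
have se0 : smooth_near (fun y => \sum_l gs (gram (G y)) i l *: dy R (@ord0 s) l) x.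
  apply: smooth_near_sum => l _; apply/smooth_near_mxP => p q.
  under eq_fun do rewrite mxE.
  by apply: smooth_nearM => //; exact: smooth_near_cst.
rewrite /darboux_coframe; case: (j == ord0) => //.
apply: smooth_near_mulmx; last exact: smooth_near_cst.
exact: smooth_near_mulmx.
Qed.

Lemma orthonormal_unit G (v : coframe R s) : orthonormal G v -> G \in unitmx.
Proof.
move=> /frame_mx_orthonormal/mulmx1_unit[FGu _].
rewrite -unitmx_inv.
have : frame_mx v *m invmx G \in unitmx by [].
by rewrite unitmx_mul => /andP[].
Qed.

Lemma invmx_congr (C G : 'M[R]_n) : C \in unitmx -> G \in unitmx ->
  invmx (C^T *m G *m C) = invmx C *m invmx G *m (invmx C)^T.
Proof.
move=> Cu Gu; have CTu : C^T \in unitmx by rewrite unitmx_tr.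
have E : (C^T *m G *m C) *m (invmx C *m invmx G *m (invmx C)^T) = 1%:M.
  by rewrite trmx_inv !mulmxA !mulmxK// mulmxV.
by have /mulmx1_unit[Au _] := E; rewrite -[LHS]mulmx1 -E mulKmx.
Qed.

(** With C = [cojac d q] this moves adaptedness between the cotangent space at q and the components
    in the chart d. *)
Lemma adapted_form_congr (C G : 'M[R]_n) W (v : coframe R s) : C \in unitmx -> G \in unitmx ->
  adapted_form G W v <->
  adapted_form (C^T *m G *m C) (fun j k => C^T *m W j k *m C) (fun i j => v i j *m C).
Proof.
move=> Cu Gu.
have oE i j i' j' : (v i j *m C) *m invmx (C^T *m G *m C) *m (v i' j' *m C)^T
    = v i j *m invmx G *m (v i' j')^T.
  by rewrite invmx_congr// trmx_mul !mulmxA mulmxK// trmx_inv mulmxKV// unitmx_tr.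
have wE j k : \sum_i wedge2 (v i j *m C) (v i k *m C)
    = C^T *m (\sum_i wedge2 (v i j) (v i k)) *m C.
  by rewrite mulmx_sumr mulmx_suml; apply: eq_bigr => i _; exact: wedge2_mulmx.
split=> -[vG vW]; split=> [i j i' j'|j k].
- by rewrite oE vG.
- by rewrite wE vW.
- by rewrite -oE vG.
- have := vW j k; rewrite wE => /(congr1 (fun A => invmx C^T *m A *m invmx C)).
  by rewrite !mulmxA mulVmx ?unitmx_tr// !mul1mx !mulmxK.
Qed.

End GramSchmidt.

(** * Smooth adapted frames and orientations of W_0 *)

Section SmoothFrames.
Variables (R : realType) (s : nat) (X : manifold R (2 * s.+1)) (K : almost_sKahler X).
Local Notation n := (2 * s.+1)%N.
Local Notation N := (extdim n).
Implicit Types (p q : X) (c d : chart R n X) (v : X -> coframe R s) (U O : set X).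
Hypothesis hs : (2 <= s)%N.

Definition frame_in v c q : 'M[R]_n := frame_mx (v q) *m cojac c q.

Definition smooth_frame O v := [/\ open O,
  forall q, O q -> adapted (metric K) (omega K) q (v q) &
  forall c q, atlas c -> O q -> dom c q ->
    smooth_near (fun x => frame_in v c (icoord c x)) (c q)].

Lemma metric_unit q : metric K q \in unitmx.
Proof. by have [v [vG _]] := omega_adapted K q; exact: orthonormal_unit vG. Qed.

Lemma bil_in_unit (b : X -> 'M[R]_n) c q : smooth_chart c -> dom c q -> b q \in unitmx ->
  bil_in b c q \in unitmx.
Proof.
by move=> sc cq bu; rewrite /bil_in !unitmx_mul unitmx_tr !(cojac_unit sc cq) bu.
Qed.

Lemma frame_in_trans v c d q : atlas c -> smooth_chart d -> dom c q -> dom d q ->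
  frame_in v c q = frame_in v d q *m (trans_jac c d q)^T.
Proof. by move=> ac sd cq dq; rewrite /frame_in (cojac_trans ac sd cq dq) mulmxA. Qed.

(** Smoothness of a field is expressed in charts of the atlas, while Darboux charts are merely
    compatible with it. The components in d are obtained by solving the transformation law, whose
    Jacobian is smooth and invertible. *)
Lemma bil_in_smooth_near (b : X -> 'M[R]_n) c d p : smooth_field setT (bil_in b) ->
  atlas c -> smooth_chart d -> dom c p -> dom d p ->
  smooth_near (fun x => bil_in b d (icoord c x)) (c p).
Proof.
move=> sb ac sd cp dp; have cd := compatible_charts_sym (smooth_chart_compatible sd ac).
have sJ := smooth_trans_jac cd cp dp.
have nd := near_icoord cp (near_dom dp).
have Ju : \forall x \near c p, trans_jac c d (icoord c x) \in unitmx.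
  by apply: filterS nd => x [dx cx _]; exact: trans_jac_unit.
have sJV := smooth_near_invmx Ju sJ.
have sc := iffLR (smooth_fieldP _ (openT : open (setT : set X))) sb c p ac I cp.
apply: smooth_near_eq (smooth_near_mulmx (smooth_near_mulmx sJV sc) (smooth_near_trmx sJV)).
apply: filterS (filterI nd Ju) => x [[dx cx _] Jxu].
rewrite (bil_in_trans b ac sd cx dx) trmx_inv !mulmxA mulVmx// mul1mx.
by rewrite mulmxK// unitmx_tr.
Qed.

(* The frame is a smooth function of the matrix of the metric alone, hence its
   derivative vanishes where that of the metric does. *)
Lemma darboux_frame d : darboux (omega K) d -> exists v, smooth_frame (dom d) v /\
  (forall p c w, dom d p -> atlas c -> dom c p ->
     (forall w, Defs.dcomp (bil_in (metric K)) d p w = 0) ->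
     'D_w (fun x => frame_in v d (icoord c x)) (c p) = 0).
Proof.
move=> [sd dW]; pose G q := bil_in (metric K) d q.
pose v q : coframe R s := fun i j => darboux_coframe (G q) i j *m invmx (cojac d q).
have vd q : dom d q -> frame_in v d q = frame_mx (darboux_coframe (G q)).
  move=> dq; have Cu := cojac_unit sd dq.
  by rewrite /frame_in /v -frame_mxM mulmxKV.
have ad q : dom d q -> [/\ adapted (metric K) (omega K) q (v q),
    G q \in unitmx, 0 < gram (G q) ord0 ord0 & 0 < gs_residue (gram (G q))].
  move=> dq; have Cu := cojac_unit sd dq; have [v0 av0] := omega_adapted K q.
  have Gu := metric_unit q.
  have ad0 := iffLR (adapted_form_congr (fun j k => omega K j k q) v0 Cu Gu) av0.
  have Wd j : j != ord0 -> (cojac d q)^T *m omega K ord0 j q *m cojac d q = darboux_form R j.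
    by move=> j0; exact: dW.
  have [ad1 a0 D0] := darboux_coframe_adapted hs ad0 Wd.
  split => //; last exact: bil_in_unit.
  apply: (iffRL (adapted_form_congr (fun j k => omega K j k q) (v q) Cu Gu)).
  have -> : (fun i j => v q i j *m cojac d q) = darboux_coframe (G q).
    by apply/funext => i; apply/funext => j; rewrite /v mulmxKV.
  exact: ad1.
have sG c p : atlas c -> dom c p -> dom d p -> smooth_near (fun x => G (icoord c x)) (c p).
  by move=> ac cp dp; exact: (bil_in_smooth_near (metric_smooth K)).
have near_vd c p : dom c p -> dom d p ->
    \forall x \near c p, frame_mx (darboux_coframe (G (icoord c x))) = frame_in v d (icoord c x).
  by move=> cp dp; apply: filterS (near_icoord cp (near_dom dp)) => x [dx _ _]; rewrite vd.
exists v; split; first split.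
- exact: dom_open.
- by move=> q /ad[].
- move=> c q ac dq cq; have cd := compatible_charts_sym (smooth_chart_compatible sd ac).
  have [_ Gu a0 D0] := ad q dq.
  have sF : smooth_near (fun x => frame_mx (darboux_coframe (G (icoord c x)))) (c q).
    by apply: smooth_near_darboux_coframe; rewrite ?coordK//; exact: sG.
  apply: smooth_near_eq (smooth_near_mulmx sF (smooth_near_trmx (smooth_trans_jac cd cq dq))).
  apply: filterS (near_icoord cq (near_dom dq)) => x [dx cx _].
  by rewrite (frame_in_trans v ac sd cx dx) vd.
move=> p c w dp ac cp dg; have dc := smooth_chart_compatible sd ac.
have cd := compatible_charts_sym dc.
have [_ Gu a0 D0] := ad p dp.
have dGc : differentiable (fun x => G (icoord c x)) (c p) := smooth_near_diff (sG c p ac cp dp).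
have DG : 'D_w (fun x => G (icoord c x)) (c p) = 0.
  have dGd := differentiable_chart_change dc dp cp dGc.
  by rewrite (chart_derive_change w cd cp dp dGd); exact: dg.
pose Phi (y : 'rV[R]_(n * n)) : 'M[R]_n := frame_mx (darboux_coframe (vec_mx y : 'M[R]_n)).
have GE x : vec_mx (mxvec (G x)) = G x by rewrite mxvecK.
have dPhi : differentiable Phi (mxvec (G (icoord c (c p)))).
  apply: smooth_near_diff; apply: smooth_near_darboux_coframe; rewrite ?GE ?coordK//.
  apply: (@smooth_near_linear_mx R (n * n) _ _ _ _ vec_mx id) => k.
  apply: Ck_near_id.
have dmG := differentiable_linear_mx mxvec dGc.
have -> : 'D_w (fun x => frame_in v d (icoord c x)) (c p)
    = 'D_w (Phi \o (fun x => mxvec (G (icoord c x)))) (c p).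
  apply/esym/near_eq_derive; apply: filterS (near_vd c p cp dp) => x <-.
  by rewrite /Phi /= GE.
rewrite (derive_comp _ dmG dPhi) (derive_linear_mx mxvec w dGc) DG linear0.
exact: derive0.
Qed.

Lemma exists_smooth_frame p : exists O v, O p /\ smooth_frame O v.
Proof.
have [d dp dd] := omega_darboux K p; have [v [sv _]] := darboux_frame dd.
by exists (dom d), v.
Qed.

Lemma area_in (v : X -> coframe R s) c q :
  bil_in (fun q => wedge2 (v q ord0 ord0) (v q ord_max ord0)) c q
  = wedge2 (dy R ord0 ord0 *m frame_in v c q) (dy R ord0 ord_max *m frame_in v c q).
Proof. by rewrite /frame_in !mulmxA !dy_frame wedge2_mulmx. Qed.

Lemma smooth_frame_orients O v : smooth_frame O v -> orients K O v.
Proof.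
move=> [oO av sv]; split => //; apply/(Ck_fieldP _ _ oO) => c q ac Oq cq.
under eq_fun do rewrite area_in /wedge2.
have sF := sv c q ac Oq cq.
have sd i : smooth_near (fun x => dy R (@ord0 s) i *m frame_in v c (icoord c x)) (c q).
  by apply: smooth_near_mulmx => //; exact: smooth_near_cst.
have st i l := smooth_near_mulmx (smooth_near_trmx (sd i)) (sd l).
apply: (smooth_nearD (st _ _) _ 0%N).
exact: (smooth_near_linear_mx (@GRing.opp _) (st _ _)).
Qed.

Lemma orients_reflection U v : open U -> orients K U v ->
  orients K U (fun q => rotate (reflection R) (v q)).
Proof.
move=> oU [av cv]; split => [q Uq|]; first exact/adapted_reflection/av.
apply/(Ck_fieldP _ _ oU) => c q ac Uq cq.
have c0 := iffLR (Ck_fieldP _ _ oU) cv c q ac Uq cq.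
have -> : (fun x => bil_in (fun q => wedge2 (rotate (reflection R) (v q) ord0 ord0)
      (rotate (reflection R) (v q) ord_max ord0)) c (icoord c x))
    = (fun x => - bil_in (fun q => wedge2 (v q ord0 ord0) (v q ord_max ord0)) c (icoord c x)).
  apply/funext => x; rewrite /bil_in wedge2_rotate rotdet_reflection scaleN1r.
  by rewrite mulmxN mulNmx.
by apply: filterS c0 => x; exact: continuousN.
Qed.

(** Some entry of the common area form at q is nonzero, so by continuity the sum of this entry over
    both forms is nonzero near q. Opposite orientations would make the sum vanish. *)
Lemma orients_alike_near U U' v v' q : open U -> open U' -> orients K U v -> orients K U' v' ->
  U q -> U' q -> alike (v q) (v' q) -> \forall q \near q, alike (v q) (v' q).
Proof.
move=> oU oU' [av cv] [av' cv'] Uq U'q vv'; pose c := chart_at q.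
have ac : atlas c := chart_at_atlas q; have cq : dom c q := chart_at_dom q.
have bq b : bil_in b c q = b q := bil_in_chart_at b q.
clearbody c.
pose F (v : X -> coframe R s) x :=
  bil_in (fun q => wedge2 (v q ord0 ord0) (v q ord_max ord0)) c (icoord c x).
have cF : {for c q, continuous (F v)}.
  exact: (nbhs_singleton (iffLR (Ck_fieldP _ _ oU) cv c q ac Uq cq)).
have cF' : {for c q, continuous (F v')}.
  exact: (nbhs_singleton (iffLR (Ck_fieldP _ _ oU') cv' c q ac U'q cq)).
have FE u : F u (c q) = wedge2 (u q ord0 ord0) (u q ord_max ord0).
  by rewrite /F (coordK cq) bq.
have FE' : F v' (c q) = F v (c q) by rewrite (FE v') (FE v) vv'.
have [k [l Fkl]] : exists k l, F v (c q) k l != 0.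
  apply: contrapT => H; have := area_form_neq0 (av q Uq).1; rewrite -(FE v) => /eqP; apply.
  apply/matrixP => k l; apply/eqP/negPn/negP; rewrite [X in _ != X]mxE => kl.
  by apply: H; exists k, l.
have c1 := iffLR (continuous_mxP _ _) cF k l; have c2 := iffLR (continuous_mxP _ _) cF' k l.
have c12 := continuousD c1 c2.
have n0 : \forall x \near c q, F v x k l + F v' x k l != 0.
  have n1 : F v (c q) k l + F v' (c q) k l != 0 by rewrite FE' -mulr2n mulrn_eq0.
  exact: (cvgr_neq0 _ c12 n1).
have Uq' : \forall q \near q, U q by exact: open_nbhs_nbhs.
have U'q' : \forall q \near q, U' q by exact: open_nbhs_nbhs.
apply: filterS (filterI (near_coord cq n0) (filterI (near_dom cq) (filterI Uq' U'q'))).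
move=> q' [nq [cq' [Uq0 U'q0]]].
have [//|op] := alike_or_reflection hs (av _ Uq0) (av' _ U'q0).
have e := not_alike_reflection (av _ Uq0) op.
move: nq; rewrite /F coordK// /bil_in e mulmxN mulNmx [X in _ + X]mxE subrr eqxx.
by [].
Qed.

Lemma orients_alike U U' v v' q : open U -> open U' -> orients K U v -> orients K U' v' ->
  U q -> U' q -> (\forall q \near q, alike (v q) (v' q)) \/
    (\forall q \near q, alike (v q) (rotate (reflection R) (v' q))).
Proof.
move=> oU oU' ov ov' Uq U'q.
have [a|a] := alike_or_reflection hs (ov.1 _ Uq) (ov'.1 _ U'q); [left|right].
  exact: (orients_alike_near oU oU' ov ov').
exact: (orients_alike_near oU oU' ov (orients_reflection oU' ov')).
Qed.

Lemma smooth_frame_reflection O v : smooth_frame O v ->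
  smooth_frame O (fun q => rotate (reflection R) (v q)).
Proof.
move=> [oO av sv]; split => // [q Oq|c q ac Oq cq]; first exact/adapted_reflection/av.
apply: smooth_near_eq (smooth_near_mulmx (smooth_near_cst
  (frame_mx (rotate (reflection R) (@std_coframe R s))) (c q)) (sv c q ac Oq cq)).
by near=> x; rewrite /frame_in [in RHS]frame_mx_rotate mulmxA.
Unshelve. all: by end_near. Qed.

End SmoothFrames.

(** * The flat connection *)

Section SecondOrder.
Variables (R : realType) (n : nat).
Local Notation E := 'rV[R]_n.

Lemma smooth_near_derive_mx m p (f : E -> 'M[R]_(m, p)) (Z : E -> E) x :
  smooth_near f x -> smooth_near Z x -> smooth_near (fun y => 'D_(Z y) f y) x.
Proof.
move=> sf sZ; have df := smooth_near_differentiable sf.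
apply/smooth_near_mxP => i j.
apply: smooth_near_eq (smooth_near_derive (iffLR (smooth_near_mxP _ _) sf i j) sZ).
by apply: filterS df => y dfy; rewrite (derive_mx_entry _ _ _ dfy).
Qed.

(** The Leibniz rule for D_Z f = sum_k Z^k d_k f. It separates the first-order term, which
    contributes to the bracket, from the second-order term, where the direction is frozen. *)
Lemma derive_along_field m p (f : E -> 'M[R]_(m, p)) (Z : E -> E) x w :
  smooth_near f x -> smooth_near Z x ->
  'D_w (fun y => 'D_(Z y) f y) x
    = 'D_('D_w Z x) f x + 'D_w (fun y => 'D_(Z x) f y) x.
Proof.
move=> sf sZ; have df := smooth_near_differentiable sf.
have sfe i j := iffLR (smooth_near_mxP _ _) sf i j.
have sZe i := iffLR (smooth_near_mxP _ _) sZ 0 i.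
have sd (W : E -> E) := smooth_near_derive_mx (Z := W) sf.
have near_e (W : E -> E) i j :
    \forall y \near x, ('D_(W y) f y) i j = \sum_k W y 0 k * 'D_(delta_mx 0 k) (fun z => f z i j) y.
  apply: filterS df => y dfy; rewrite (derive_mx_entry _ _ _ dfy).
  have dfe := iffLR (differentiable_mxP _ _) dfy i j.
  by rewrite (derive_sum_dir _ dfe).
have ds : differentiable (fun y => 'D_(Z y) f y) x := smooth_near_diff (sd Z sZ).
have ds' : differentiable (fun y => 'D_(Z x) f y) x.
  exact: (smooth_near_diff (sd (fun=> Z x) (smooth_near_cst (Z x) x))).
have dfx := nbhs_singleton df; have dZx := smooth_near_diff sZ.
apply/matrixP => i j.
have L1 := etrans (derive_mx_entry w i j ds) (near_eq_derive w (near_e Z i j)).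
have L2 := etrans (derive_mx_entry w i j ds') (near_eq_derive w (near_e (fun=> Z x) i j)).
have dfe := iffLR (differentiable_mxP _ _) dfx i j.
have L3 := etrans (derive_mx_entry ('D_w Z x) i j dfx) (derive_sum_dir ('D_w Z x) dfe).
have dZk k : differentiable (fun y => Z y 0 k) x := smooth_near_diff (sZe k).
have dck k : differentiable (fun y : E => Z x 0 k) x := differentiable_cst (Z x 0 k : R) x.
have dfk k : differentiable (fun y => 'D_(delta_mx 0 k) (fun z => f z i j) y) x.
  exact: (smooth_near_diff (smooth_near_partial k (sfe i j))).
have S1 := derive_sum_fun w (fun k => differentiableM (dZk k) (dfk k)).
have S2 := derive_sum_fun w (fun k => differentiableM (dck k) (dfk k)).
apply: (etrans L1); apply: (etrans S1); rewrite [RHS]mxE.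
apply: esym; apply: (etrans (congr2 +%R L3 (etrans L2 S2))); rewrite -big_split/=.
apply: eq_bigr => k _.
have P1 := is_derive_scalar_mul w (dZk k) (dfk k).
have P2 := is_derive_scalar_mul w (dck k) (dfk k).
apply: esym; apply: (etrans P1); apply: (congr2 +%R).
  by congr (_ * _); exact: (esym (derive_mx_entry w 0 k dZx)).
apply: esym; apply: (etrans P2).
by rewrite [X in X * _ + _](derive_cst (Z x 0 k : R)) mul0r add0r.
Qed.

Lemma derive_swap_mx m p (f : E -> 'M[R]_(m, p)) x u v : smooth_near f x ->
  'D_v (fun z => 'D_u f z) x = 'D_u (fun z => 'D_v f z) x.
Proof.
move=> sf; have df := smooth_near_differentiable sf.
have sfe i j := iffLR (smooth_near_mxP _ _) sf i j.
have near_e (w : E) i j : \forall y \near x, 'D_w (fun z => f z i j) y = ('D_w f y) i j.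
  by apply: filterS df => y dfy; rewrite (derive_mx_entry _ _ _ dfy).
have sd (w : E) : smooth_near (fun y => 'D_w f y) x.
  apply/smooth_near_mxP => i j; exact: smooth_near_eq (near_e w i j) (smooth_near_dir w (sfe i j)).
apply/matrixP => i j.
have L1 := etrans (derive_mx_entry v i j (smooth_near_diff (sd u)))
  (esym (near_eq_derive v (near_e u i j))).
have L2 := etrans (derive_mx_entry u i j (smooth_near_diff (sd v)))
  (esym (near_eq_derive u (near_e v i j))).
exact: (etrans L1 (etrans (derive_swap u v (sfe i j)) (esym L2))).
Qed.

(** The second-order terms cancel by symmetry; the remaining first-order ones are the derivative
    along the bracket. *)
Lemma lie_bracket_derive m p (f : E -> 'M[R]_(m, p)) (Y Z : E -> E) x :
  smooth_near f x -> smooth_near Y x -> smooth_near Z x ->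
  'D_(Y x) (fun y => 'D_(Z y) f y) x - 'D_(Z x) (fun y => 'D_(Y y) f y) x
    - 'D_('D_(Y x) Z x - 'D_(Z x) Y x) f x = 0.
Proof.
move=> sf sY sZ; have df := smooth_near_diff sf.
have L1 := derive_along_field (Y x) sf sZ; have L2 := derive_along_field (Z x) sf sY.
have C := derive_swap_mx (Z x) (Y x) sf.
have L3 : 'D_('D_(Y x) Z x - 'D_(Z x) Y x) f x
    = 'D_('D_(Y x) Z x) f x - 'D_('D_(Z x) Y x) f x by rewrite !(deriveE _ df) linearB.
have alg (a b c : 'M[R]_(m, p)) : (a + c) - (b + c) - (a - b) = 0.
  by apply/matrixP => i j; rewrite !mxE; ring.
rewrite [X in X - _ - _]L1 [X in _ - X - _]L2 [X in _ - X]L3 C; exact: alg.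
Qed.

Lemma derive0_cst_near m p (f : E -> 'M[R]_(m, p)) x : (\near x, differentiable f x) ->
  (\forall y \near x, forall w, 'D_w f y = 0) -> \forall y \near x, f y = f x.
Proof.
move=> df f0; have H : \forall y \near x, differentiable f y /\ forall w, 'D_w f y = 0.
  exact: (filterI df f0).
have /nbhs_ballP[e /= e0 xe] := H.
apply/nbhs_ballP; exists e => //= y xy; apply/matrixP => i j.
apply: (@derive0_ball_cst R n (fun z => f z i j) x e _ _ y xy).
  by move=> z /xe[dz _]; exact: (iffLR (differentiable_mxP _ _) dz).
by move=> z w /xe[dz z0]; rewrite -(derive_mx_entry _ _ _ dz) z0 mxE.
Qed.

End SecondOrder.

Lemma complex_mxD (R : realType) m p (A A' B B' : 'M[R]_(m, p)) :
  (A + A')%:CM + 'i *: (B + B')%:CM = (A%:CM + 'i *: B%:CM) + (A'%:CM + 'i *: B'%:CM).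
Proof. by rewrite !map_mxD scalerDr addrACA. Qed.

Lemma complex_mx_linear (R : realType) m p (a : R) (A A' B B' : 'M[R]_(m, p)) :
  (a *: A + A')%:CM + 'i *: (a *: B + B')%:CM
    = a%:C *: (A%:CM + 'i *: B%:CM) + (A'%:CM + 'i *: B'%:CM).
Proof.
by rewrite complex_mxD !real_mxZ scalerDr !scalerA [a%:C * 'i]mulrC.
Qed.

(** * Differentiation of complex matrix fields on the manifold *)

Section ComplexDerivative.
Variables (R : realType) (n m : nat) (X : manifold R n).
Local Notation M := 'M[R[i]]_m.
Implicit Types (g h : X -> M) (c d : chart R n X) (p q : X) (w : 'rV[R]_n).

Definition csmooth g c p := smooth_near (fun x => mRe (g (icoord c x))) (c p) /\
  smooth_near (fun x => mIm (g (icoord c x))) (c p).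

(** Here pi stands for the real or the imaginary part, so that each rule is proved once for both. *)
Definition dpart (pi : M -> 'M[R]_m) g c p w : 'M[R]_m :=
  'D_w (fun x => pi (g (icoord c x))) (c p).

Definition cderive g c p w : M :=
  (dpart mRe g c p w)%:CM + 'i *: (dpart mIm g c p w)%:CM.

Definition dparts pi g c p := differentiable (fun x => pi (g (icoord c x)) : 'M[R]_m) (c p).

Lemma csmooth_diff g c p : csmooth g c p -> dparts mRe g c p /\ dparts mIm g c p.
Proof. by move=> [s1 s2]; split; [exact: smooth_near_diff s1|exact: smooth_near_diff s2]. Qed.

Lemma dpart_near_eq pi g h c p w : dom c p -> (\forall q \near p, g q = h q) ->
  dpart pi g c p w = dpart pi h c p w.
Proof.
move=> cp gh; apply: near_eq_derive.
by apply: filterS (near_icoord cp gh) => x [-> _ _].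
Qed.

Lemma cderive_near_eq g h c p w : dom c p -> (\forall q \near p, g q = h q) ->
  cderive g c p w = cderive h c p w.
Proof.
by move=> cp gh; rewrite /cderive (dpart_near_eq _ w cp gh) (dpart_near_eq _ w cp gh).
Qed.

Lemma cderive_linear_dir g c p (a : R) w w' : csmooth g c p ->
  cderive g c p (a *: w + w') = a%:C *: cderive g c p w + cderive g c p w'.
Proof.
move=> /csmooth_diff[d1 d2]; rewrite /cderive.
have L pi : dparts pi g c p ->
    dpart pi g c p (a *: w + w') = a *: dpart pi g c p w + dpart pi g c p w'.
  by move=> d; exact: (derive_linear_dir _ _ _ d).
rewrite (L _ d1) (L _ d2); exact: complex_mx_linear.
Qed.

Lemma dpartD pi g h c p w : (forall C D, pi (C + D) = pi C + pi D) ->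
  dparts pi g c p -> dparts pi h c p ->
  dpart pi (fun q => g q + h q) c p w = dpart pi g c p w + dpart pi h c p w.
Proof.
move=> piD d e; rewrite /dpart; under eq_fun do rewrite piD.
exact: (deriveD (diff_derivable (v := w) d) (diff_derivable (v := w) e)).
Qed.

Lemma cderiveD g h c p w : csmooth g c p -> csmooth h c p ->
  cderive (fun q => g q + h q) c p w = cderive g c p w + cderive h c p w.
Proof.
move=> /csmooth_diff[d1 d2] /csmooth_diff[e1 e2]; rewrite /cderive.
rewrite (dpartD w (@mReD _ _ _) d1 e1) (dpartD w (@mImD _ _ _) d2 e2).
exact: complex_mxD.
Qed.

Lemma dpart_comb pi pi1 pi2 (a b : R) (z : R[i]) g c p w :
  (forall C, pi (z *: C) = a *: pi1 C + b *: pi2 C) ->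
  dparts pi1 g c p -> dparts pi2 g c p ->
  dpart pi (fun q => z *: g q) c p w = a *: dpart pi1 g c p w + b *: dpart pi2 g c p w.
Proof.
move=> piZ d1 d2; rewrite /dpart; under eq_fun do rewrite piZ.
have v1 := diff_derivable (v := w) d1; have v2 := diff_derivable (v := w) d2.
have H := deriveD (derivableZ (k := a) v1) (derivableZ (k := b) v2).
exact: (etrans H (congr2 +%R (deriveZ a v1) (deriveZ b v2))).
Qed.

Lemma cderiveZ (z : R[i]) g c p w : csmooth g c p ->
  cderive (fun q => z *: g q) c p w = z *: cderive g c p w.
Proof.
move=> /csmooth_diff[d1 d2]; rewrite /cderive.
have reZ (C : M) : mRe (z *: C) = complex.Re z *: mRe C + (- complex.Im z) *: mIm C.
  by rewrite mReZ scaleNr.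
rewrite (dpart_comb w reZ d1 d2) (dpart_comb w (@mImZ _ _ _ z) d2 d1).
by rewrite [RHS]complex_mxE mReZ mImZ mReE mImE scaleNr.
Qed.

Lemma dpart_mulmx pi (A B : 'M[R]_m) g c p w :
  (forall C, pi (A%:CM *m C *m B%:CM) = A *m pi C *m B) -> dparts pi g c p ->
  dpart pi (fun q => A%:CM *m g q *m B%:CM) c p w = A *m dpart pi g c p w *m B.
Proof.
move=> piM d; rewrite /dpart; under eq_fun do rewrite piM.
exact: (derive_mulmx_cst A B w d).
Qed.

Lemma cderive_mulmx (A B : 'M[R]_m) g c p w : csmooth g c p ->
  cderive (fun q => A%:CM *m g q *m B%:CM) c p w = A%:CM *m cderive g c p w *m B%:CM.
Proof.
move=> /csmooth_diff[d1 d2].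
have reM (C : M) : mRe (A%:CM *m C *m B%:CM) = A *m mRe C *m B.
  by rewrite conj_complex_mx mReE.
have imM (C : M) : mIm (A%:CM *m C *m B%:CM) = A *m mIm C *m B.
  by rewrite conj_complex_mx mImE.
rewrite /cderive (dpart_mulmx w reM d1) (dpart_mulmx w imM d2).
by rewrite conj_complex_mx mReE mImE.
Qed.

Lemma dpart_real_mul pi (u : X -> R) g c p w :
  (forall (a : R) (C : M), pi (a%:C *: C) = a *: pi C) -> dparts pi g c p ->
  differentiable (fun x => u (icoord c x)) (c p) -> dom c p ->
  dpart pi (fun q => (u q)%:C *: g q) c p w
    = 'D_w (fun x => u (icoord c x)) (c p) *: pi (g p) + u p *: dpart pi g c p w.
Proof.
move=> piZ d du cp; rewrite /dpart; under eq_fun do rewrite piZ.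
have dFe i j := iffLR (differentiable_mxP _ _) d i j.
have duF : differentiable (fun x => u (icoord c x) *: pi (g (icoord c x))) (c p).
  apply/differentiable_mxP => i j; under eq_fun do rewrite mxE.
  exact: (differentiableM du (dFe i j)).
apply/matrixP => i j; apply: (etrans (derive_mx_entry w i j duF)).
under eq_fun do rewrite mxE.
apply: (etrans (is_derive_scalar_mul w du (dFe i j))).
rewrite (coordK cp) [RHS]mxE [X in _ = X + _]mxE [X in _ = _ + X]mxE.
by congr (_ + _ * _); exact: (esym (derive_mx_entry w i j d)).
Qed.

Lemma cderive_real_mul (u : X -> R) g c p w : csmooth g c p ->
  differentiable (fun x => u (icoord c x)) (c p) -> dom c p ->
  cderive (fun q => (u q)%:C *: g q) c p w
    = ('D_w (fun x => u (icoord c x)) (c p))%:C *: g p + (u p)%:C *: cderive g c p w.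
Proof.
move=> /csmooth_diff[d1 d2] du cp; rewrite /cderive.
have reE (a : R) (C : M) : mRe (a%:C *: C) = a *: mRe C by rewrite mReZ /= scale0r subr0.
have imE (a : R) (C : M) : mIm (a%:C *: C) = a *: mIm C by rewrite mImZ /= scale0r addr0.
rewrite (dpart_real_mul w reE d1 du cp) (dpart_real_mul w imE d2 du cp).
move: ('D_w _ _) (dpart _ _ _ _ _) (dpart _ _ _ _ _) => a A B.
rewrite {3}[g p]complex_mxE.
rewrite !map_mxD !real_mxZ !scalerDr !scalerA ['i * (u p)%:C]mulrC ['i * a%:C]mulrC.
by rewrite addrACA.
Qed.

Lemma cderive_cst (C : M) c p w : cderive (fun=> C) c p w = 0.
Proof.
have e pi : dpart pi (fun=> C) c p w = 0 by exact: (derive_cst (pi C)).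
by rewrite /cderive !e map_mx0 scaler0 addr0.
Qed.

Lemma cderive_chart_change g c d p w : compatible_charts c d -> dom c p -> dom d p ->
  csmooth g d p -> cderive g c p w = cderive g d p (w *m trans_jac c d p).
Proof.
move=> cd cp dp /csmooth_diff[d1 d2]; rewrite /cderive.
have L pi : dparts pi g d p -> dpart pi g c p w = dpart pi g d p (w *m trans_jac c d p).
  by move=> dd; exact: (chart_derive_change (F := fun q => pi (g q)) w cd cp dp dd).
by rewrite (L _ d1) (L _ d2).
Qed.

(** The linear equations of S hold for g near p, hence, differentiated, for its derivative at p. *)
Lemma cderive_in (S : set M) g c p w : real_linear_set S -> dom c p -> csmooth g c p ->
  (\forall q \near p, S (g q)) -> S (cderive g c p w).
Proof.
move=> /real_linear_set_eqns[D [B [B' SE]]] cp /csmooth_diff[d1 d2] Sg.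
apply/SE; rewrite /cderive mReE mImE.
have L pi (C : 'M[R]_(m * m, D)) : dparts pi g c p ->
    differentiable (fun x => mxvec (pi (g (icoord c x))) *m C) (c p) /\
    mxvec (dpart pi g c p w) *m C = 'D_w (fun x => mxvec (pi (g (icoord c x))) *m C) (c p).
  move=> d; have dv := differentiable_linear_mx mxvec d.
  split; first exact: (differentiable_linear_mx (mulmxr C) dv).
  apply: esym; apply: (etrans (derive_linear_mx (mulmxr C) w dv)).
  exact: (congr1 (mulmxr C) (derive_linear_mx mxvec w d)).
have [c1 e1] := L _ B d1; have [c2 e2] := L _ B' d2; rewrite e1 e2.
have D12 := deriveD (diff_derivable (v := w) c1) (diff_derivable (v := w) c2).
apply: (etrans (esym D12)).
have z : \forall x \near c p, mxvec (mRe (g (icoord c x))) *m B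
    + mxvec (mIm (g (icoord c x))) *m B' = 0.
  by apply: filterS (near_icoord cp Sg) => x [/SE].
exact: (etrans (near_eq_derive w z) (derive_cst (0 : 'rV[R]_D) _ _)).
Qed.

End ComplexDerivative.

(** * Derivatives of components in a smooth frame *)

Section Connection.
Variables (R : realType) (s : nat) (X : manifold R (2 * s.+1)) (K : almost_sKahler X).
Local Notation n := (2 * s.+1)%N.
Local Notation N := (extdim n).
Local Notation M := 'M[R[i]]_N.
Implicit Types (p q : X) (c d : chart R n X) (v : X -> coframe R s) (U O : set X).
Implicit Types (b : bundle) (f g h : X -> M) (w : 'rV[R]_n).
Hypothesis hs : (2 <= s)%N.

Definition unframe v f q : M := frame_unconj (v q) (f q).

Definition frame_in_op v c q : 'M[R]_N := ext_mx (frame_in v c q).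

Lemma frame_in_opE v c q : frame_in_op v c q = ext_mx (cojac c q) *m frame_op (v q).
Proof. by rewrite /frame_in_op ext_mxM. Qed.

Lemma frame_in_op_unit v c q : smooth_chart c -> dom c q ->
  adapted (metric K) (omega K) q (v q) -> frame_in_op v c q \in unitmx.
Proof.
move=> sc cq av; apply: ext_mx_unit.
by rewrite unitmx_mul (frame_mx_unit av.1) cojac_unit.
Qed.

Lemma end_in_frame v c q (T : X -> 'M[R]_N) (A : 'M[R]_N) : smooth_chart c -> dom c q ->
  adapted (metric K) (omega K) q (v q) ->
  T q = frame_op (v q) *m A *m invmx (frame_op (v q)) ->
  end_in T c q = frame_in_op v c q *m A *m invmx (frame_in_op v c q).
Proof.
move=> sc cq av TE; have Pu := ext_mx_unit (cojac_unit sc cq).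
have Eu := frame_op_unit av.1; have Fu := frame_in_op_unit sc cq av.
rewrite /end_in TE; apply: (can_inj (mulmxK Fu)); rewrite mulmxKV//.
rewrite {1}frame_in_opE !mulmxA mulmxKV// [frame_in_op v c q]frame_in_opE.
by rewrite mulmxKV.
Qed.

(** Components in the frame and in the chart differ by conjugation with the frame matrix in that
    chart, which is smooth; this transfers smoothness from one to the other. *)
Lemma unframe_part v f c q (pi : M -> 'M[R]_N) : smooth_chart c -> dom c q ->
  adapted (metric K) (omega K) q (v q) ->
  (forall (A B : 'M[R]_N) C, pi (A%:CM *m C *m B%:CM) = A *m pi C *m B) ->
  pi (unframe v f q) =
    invmx (frame_in_op v c q) *m end_in (fun q => pi (f q)) c q *m frame_in_op v c q.
Proof.
move=> sc cq av piM; have Fu := frame_in_op_unit sc cq av; have Eu := frame_op_unit av.1.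
rewrite (@end_in_frame v c q _ (pi (unframe v f q)) sc cq av).
  by rewrite !mulmxA mulVmx// mul1mx mulmxKV.
by rewrite /unframe /frame_unconj piM !mulmxA mulmxV// mul1mx mulmxK.
Qed.

Lemma mRe_mulmx (A B : 'M[R]_N) (C : M) : mRe (A%:CM *m C *m B%:CM) = A *m mRe C *m B.
Proof. by rewrite conj_complex_mx mReE. Qed.

Lemma mIm_mulmx (A B : 'M[R]_N) (C : M) : mIm (A%:CM *m C *m B%:CM) = A *m mIm C *m B.
Proof. by rewrite conj_complex_mx mImE. Qed.

Lemma smooth_frame_in_op O v c q : smooth_frame K O v -> atlas c -> O q -> dom c q ->
  smooth_near (fun x => frame_in_op v c (icoord c x)) (c q).
Proof. by move=> [_ _ sv] ac Oq cq; exact/smooth_near_ext_mx/sv. Qed.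

Lemma near_frame O v c q : smooth_frame K O v -> O q -> dom c q ->
  \forall x \near c q, [/\ O (icoord c x), dom c (icoord c x), c (icoord c x) = x &
    adapted (metric K) (omega K) (icoord c x) (v (icoord c x))].
Proof.
move=> [oO av _] Oq cq; have On : \forall q \near q, O q by exact: open_nbhs_nbhs.
by apply: filterS (near_icoord cq On) => x [Ox cx xE]; split => //; exact: av.
Qed.

Lemma near_frame_in_op_unit O v c q : smooth_frame K O v -> atlas c -> O q -> dom c q ->
  \forall x \near c q, frame_in_op v c (icoord c x) \in unitmx.
Proof.
move=> sv ac Oq cq; apply: filterS (near_frame sv Oq cq) => x [_ cx _ ax].
exact: frame_in_op_unit (atlas_smooth_chart ac) cx ax.
Qed.

Lemma csmooth_unframe U O v f c q : smooth_frame K O v -> open U -> smooth_cend U f ->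
  atlas c -> U q -> O q -> dom c q -> csmooth (unframe v f) c q.
Proof.
move=> sv oU [sre sim] ac Uq Oq cq; have sc := atlas_smooth_chart ac.
have sF := smooth_frame_in_op sv ac Oq cq.
have uF := near_frame_in_op_unit sv ac Oq cq; have sFV := smooth_near_invmx uF sF.
have L pi : (forall (A B : 'M[R]_N) C, pi (A%:CM *m C *m B%:CM) = A *m pi C *m B) ->
    smooth_end U (fun q => pi (f q)) ->
    smooth_near (fun x => pi (unframe v f (icoord c x))) (c q).
  move=> piM sT; have sTc := iffLR (smooth_fieldP _ oU) sT c q ac Uq cq.
  apply: smooth_near_eq (smooth_near_mulmx (smooth_near_mulmx sFV sTc) sF).
  apply: filterS (near_frame sv Oq cq) => x [_ cx _ ax].
  by rewrite (unframe_part f sc cx ax piM).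
by split; apply: L => //; [exact: mRe_mulmx|exact: mIm_mulmx].
Qed.

Lemma smooth_end_frame U (T : X -> 'M[R]_N) : open U ->
  (forall c q, atlas c -> U q -> dom c q -> exists O v (A : 'rV[R]_n -> 'M[R]_N),
    [/\ smooth_frame K O v, O q, smooth_near A (c q) &
     \forall x \near c q, T (icoord c x) =
       frame_op (v (icoord c x)) *m A x *m invmx (frame_op (v (icoord c x)))]) ->
  smooth_end U T.
Proof.
move=> oU H; apply/(smooth_fieldP _ oU) => c q ac Uq cq; have sc := atlas_smooth_chart ac.
have [D [v [A [sv Oq sA TE]]]] := H c q ac Uq cq.
have sF := smooth_frame_in_op sv ac Oq cq.
have uF := near_frame_in_op_unit sv ac Oq cq; have sFV := smooth_near_invmx uF sF.
apply: smooth_near_eq (smooth_near_mulmx (smooth_near_mulmx sF sA) sFV).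
apply: filterS (filterI TE (near_frame sv Oq cq)) => x [Tx [_ cx _ ax]].
by rewrite (end_in_frame sc cx ax Tx).
Qed.

Lemma smooth_cend_frame U f : open U ->
  (forall c q, atlas c -> U q -> dom c q -> exists O v (A B : 'rV[R]_n -> 'M[R]_N),
    [/\ smooth_frame K O v, O q, smooth_near A (c q), smooth_near B (c q) &
     \forall x \near c q, f (icoord c x) =
       frame_conj (v (icoord c x)) ((A x)%:CM + 'i *: (B x)%:CM)]) ->
  smooth_cend U f.
Proof.
move=> oU H; split; apply: smooth_end_frame => // c q ac Uq cq;
  have [D [v [A [B [sv Oq sA sB fE]]]]] := H c q ac Uq cq; exists D, v.
- exists A; split=> //; apply: filterS fE => x ->.
  by rewrite /frame_conj mRe_mulmx mReE.
- exists B; split=> //; apply: filterS fE => x ->.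
  by rewrite /frame_conj mIm_mulmx mImE.
Qed.

Lemma section_std b U f v q : section_over K b U f -> U q ->
  adapted (metric K) (omega K) q (v q) -> std_fibre b (unframe v f q).
Proof.
move=> [_ fb] Uq av; apply/(fibreP hs _ _ av).
by rewrite (frame_unconjK av.1); exact: fb.
Qed.

Lemma alike_unframe b U f v v' q : section_over K b U f -> U q ->
  adapted (metric K) (omega K) q (v q) -> adapted (metric K) (omega K) q (v' q) ->
  alike (v q) (v' q) -> unframe v' f q = unframe v f q.
Proof.
move=> sf Uq av av' vv'; have bC := section_std sf Uq av.
have e := alike_frame_conj hs av av' vv' bC.
have fq : f q = frame_conj (v q) (unframe v f q) by rewrite (frame_unconjK av.1).
by rewrite {1}/unframe fq -e (frame_conjK av'.1).
Qed.

(** The derivative for which operators with constant components in v are parallel. *)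
Definition frame_derivative v p w f : M :=
  frame_conj (v p) (cderive (unframe v f) (chart_at p) p w).

Lemma near_open U q : open U -> U q -> \forall q \near q, U q.
Proof. by move=> oU Uq; exact: open_nbhs_nbhs. Qed.

(** Near p both frames give the same components. Their derivative lies again in [std_fibre b], on
    which conjugation by the two frames agrees. *)
Lemma frame_derivative_alike b U O O' v v' p w f : open U -> U p -> section_over K b U f ->
  smooth_frame K O v -> smooth_frame K O' v' -> O p -> O' p ->
  (\forall q \near p, alike (v q) (v' q)) ->
  frame_derivative v' p w f = frame_derivative v p w f.
Proof.
move=> oU Up sf sv sv' Op O'p vv'; have [oO av _] := sv; have [oO' av' _] := sv'.
have cp := chart_at_dom p; have ac := chart_at_atlas p.
have nE : \forall q \near p, unframe v' f q = unframe v f q.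
  apply: filterS (filterI vv' (filterI (near_open oU Up)
    (filterI (near_open oO Op) (near_open oO' O'p)))) => q [vq [Uq [Oq O'q]]].
  exact: alike_unframe sf Uq (av _ Oq) (av' _ O'q) vq.
rewrite /frame_derivative (cderive_near_eq w cp nE).
apply: (alike_frame_conj hs (av _ Op) (av' _ O'p) (nbhs_singleton vv') (b := b)).
apply: (cderive_in w (std_fibre_real_linear R s b) cp).
  exact: csmooth_unframe sv oU sf.1 ac Up Op cp.
apply: filterS (filterI (near_open oU Up) (near_open oO Op)) => q [Uq Oq].
exact: section_std sf Uq (av _ Oq).
Qed.

Definition reflection_op : 'M[R]_N := ext_mx (frame_mx (rotate (reflection R) (@std_coframe R s))).

Lemma frame_op_reflection (u : coframe R s) :
  frame_op (rotate (reflection R) u) = frame_op u *m reflection_op.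
Proof. by rewrite /frame_op frame_mx_rotate ext_mxM. Qed.

(* The reflected frame differs from the frame by a constant matrix. *)
Lemma frame_derivative_reflection b U O v p w f : open U -> U p -> section_over K b U f ->
  smooth_frame K O v -> O p ->
  frame_derivative (fun q => rotate (reflection R) (v q)) p w f = frame_derivative v p w f.
Proof.
move=> oU Up sf sv Op; have [oO av _] := sv.
have cp := chart_at_dom p; have ac := chart_at_atlas p.
have Eu := frame_op_unit (av _ Op).1.
have Eu' := frame_op_unit (adapted_reflection (av _ Op)).1.
have Ru : reflection_op \in unitmx.
  by move: Eu'; rewrite frame_op_reflection unitmx_mul => /andP[].
have opV q : O q -> invmx (frame_op (v q) *m reflection_op)
    = invmx reflection_op *m invmx (frame_op (v q)).
  move=> Oq; have Equ := frame_op_unit (av _ Oq).1.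
  rewrite -(mulmx_invM Equ Ru) mulmxA mulVmx// mul1mx//.
have nE : \forall q \near p, unframe (fun q => rotate (reflection R) (v q)) f q
    = (invmx reflection_op)%:CM *m unframe v f q *m reflection_op%:CM.
  apply: filterS (near_open oO Op) => q Oq.
  by rewrite /unframe /frame_unconj frame_op_reflection opV// !real_mxM !mulmxA.
rewrite /frame_derivative (cderive_near_eq w cp nE).
have sg := csmooth_unframe sv oU sf.1 ac Up Op cp.
rewrite (cderive_mulmx _ _ w sg) /frame_conj frame_op_reflection opV// !real_mxM !mulmxA.
have rr : reflection_op%:CM *m (invmx reflection_op)%:CM = 1%:M.
  by rewrite -real_mxM mulmxV// map_mx1.
have cancel (P r r' C Q : M) : r *m r' = 1%:M ->
    P *m r *m r' *m C *m r *m r' *m Q = P *m C *m Q.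
  move=> e; rewrite -[P *m r *m r']mulmxA e mulmx1.
  by rewrite -[P *m C *m r *m r']mulmxA e mulmx1.
exact: cancel.
Qed.

Lemma frame_derivative_indep b U O O' v v' p w f : open U -> U p -> section_over K b U f ->
  smooth_frame K O v -> smooth_frame K O' v' -> O p -> O' p ->
  frame_derivative v' p w f = frame_derivative v p w f.
Proof.
move=> oU Up sf sv sv' Op O'p.
have ov := smooth_frame_orients sv; have ov' := smooth_frame_orients sv'.
have [oO _ _] := sv; have [oO' _ _] := sv'.
have [a|a] := orients_alike hs oO oO' ov ov' Op O'p.
  exact: (frame_derivative_alike w oU Up sf sv sv' Op O'p a).
rewrite -(frame_derivative_reflection w oU Up sf sv' O'p).
exact: (frame_derivative_alike w oU Up sf sv (smooth_frame_reflection sv') Op O'p a).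
Qed.

End Connection.

Lemma complex_mx_comb (R : realType) m p (S T W : 'M[R[i]]_(m, p))
    (A B C A' B' C' : 'M[R]_(m, p)) :
  S = A%:CM + 'i *: A'%:CM -> T = B%:CM + 'i *: B'%:CM -> W = C%:CM + 'i *: C'%:CM ->
  A - B - C = 0 -> A' - B' - C' = 0 -> S - T - W = 0.
Proof.
move=> -> -> -> e e'; have <- : (A - B - C)%:CM + 'i *: (A' - B' - C')%:CM = 0.
  by rewrite e e' !map_mx0 scaler0 addr0.
by rewrite opprD [X in X + _ = _]addrACA opprD [LHS]addrACA !map_mxB !scalerBr.
Qed.

(** * The connection, its curvature and its flat sections *)

Section FlatConnection.
Variables (R : realType) (s : nat) (X : manifold R (2 * s.+1)) (K : almost_sKahler X).
Local Notation n := (2 * s.+1)%N.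
Local Notation N := (extdim n).
Local Notation M := 'M[R[i]]_N.
Implicit Types (p q : X) (c d : chart R n X) (v : X -> coframe R s) (U O : set X).
Implicit Types (b : bundle) (f g h : X -> M) (w : 'rV[R]_n).
Hypothesis hs : (2 <= s)%N.
Variable fr : X -> X -> coframe R s.
Hypothesis frP : forall p, exists O, O p /\ smooth_frame K O (fr p).

(** The frames [fr p] at different points are chosen independently; [covd_frame] allows one frame to
    be used throughout a neighbourhood. *)
Definition covd : covariant_derivative X := fun p w f => frame_derivative (fr p) p w f.

Lemma covd_frame b U O v p w f : open U -> U p -> section_over K b U f ->
  smooth_frame K O v -> O p -> covd p w f = frame_derivative v p w f.
Proof.
move=> oU Up sf sv Op; have [D [Dp sv']] := frP p.
exact: (frame_derivative_indep hs w oU Up sf sv sv' Op Dp).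
Qed.

Lemma csmooth_at b U f p : open U -> U p -> section_over K b U f ->
  csmooth (unframe (fr p) f) (chart_at p) p.
Proof.
move=> oU Up sf; have [D [Dp sv]] := frP p.
exact: csmooth_unframe sv oU sf.1 (chart_at_atlas p) Up Dp (chart_at_dom p).
Qed.

Lemma frame_at_adapted p : adapted (metric K) (omega K) p (fr p p).
Proof. by have [D [Dp [_ av _]]] := frP p; exact: av. Qed.

Lemma covd_fibre b U f p w : open U -> U p -> section_over K b U f ->
  fibre K b p (covd p w f).
Proof.
move=> oU Up sf; have [D [Dp sv]] := frP p; have [oD av _] := sv.
apply/(fibreP hs _ _ (av _ Dp)).
apply: (cderive_in w (std_fibre_real_linear R s b) (chart_at_dom p)).
  exact: csmooth_at oU Up sf.
apply: filterS (filterI (near_open oU Up) (near_open oD Dp)) => q [Uq Dq].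
exact: (section_std hs sf Uq (av _ Dq)).
Qed.

Lemma covd_near p w f g : (\forall q \near p, unframe (fr p) f q = g q) ->
  covd p w f = frame_conj (fr p p) (cderive g (chart_at p) p w).
Proof.
by move=> e; rewrite /covd /frame_derivative (cderive_near_eq w (chart_at_dom p) e).
Qed.

Lemma covd_local U f h p w : open U -> U p -> (forall q, U q -> f q = h q) ->
  covd p w f = covd p w h.
Proof.
move=> oU Up fh; apply: covd_near.
by apply: filterS (near_open oU Up) => q Uq; rewrite /unframe fh.
Qed.

(** The definition uses the chart [chart_at p], which changes abruptly with p. To let p vary, one
    chart c is fixed, in which the tangent vector w has components w *m jac c p. *)
Lemma covd_chart b U O v f c p w : open U -> U p -> section_over K b U f ->
  smooth_frame K O v -> O p -> atlas c -> dom c p ->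
  covd p w f = frame_conj (v p) (cderive (unframe v f) c p (w *m jac c p)).
Proof.
move=> oU Up sf sv Op ac cp; rewrite (covd_frame w oU Up sf sv Op).
have cc := atlas_compatible (chart_at_atlas p) ac.
have sg := csmooth_unframe sv oU sf.1 ac Up Op cp.
by rewrite /frame_derivative (cderive_chart_change w cc (chart_at_dom p) cp sg).
Qed.

Lemma smooth_near_vec U (Y : X -> 'rV[R]_n) c p : open U -> smooth_field U (vec_in Y) ->
  atlas c -> U p -> dom c p -> smooth_near (fun x => vec_in Y c (icoord c x)) (c p).
Proof. by move=> oU sY ac Up cp; exact: (iffLR (smooth_fieldP _ oU) sY). Qed.

Lemma covd_smooth b U f (Y : X -> 'rV[R]_n) : open U -> section_over K b U f ->
  smooth_field U (vec_in Y) -> smooth_cend U (fun p => covd p (Y p) f).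
Proof.
move=> oU sf sY; apply: (smooth_cend_frame (K := K)) => // c q ac Uq cq.
have [D [Dq sv]] := frP q; set v := fr q in sv.
have [s1 s2] := csmooth_unframe sv oU sf.1 ac Uq Dq cq.
have sYc := smooth_near_vec oU sY ac Uq cq.
exists D, v, (fun x => 'D_(vec_in Y c (icoord c x)) (fun y => mRe (unframe v f (icoord c y))) x),
  (fun x => 'D_(vec_in Y c (icoord c x)) (fun y => mIm (unframe v f (icoord c y))) x).
split => //; [exact: smooth_near_derive_mx|exact: smooth_near_derive_mx|].
apply: filterS (filterI (near_icoord cq (near_open oU Uq)) (near_frame sv Dq cq)).
move=> x [[Ux _ _] [Dx cx xE _]].
by rewrite (covd_chart (Y (icoord c x)) oU Ux sf sv Dx ac cx) /cderive /dpart xE.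
Qed.

Lemma frame_conjD (u : coframe R s) (A B : M) :
  frame_conj u (A + B) = frame_conj u A + frame_conj u B.
Proof. by rewrite /frame_conj mulmxDr mulmxDl. Qed.

Lemma frame_conj0 (u : coframe R s) : frame_conj u (0 : M) = 0.
Proof. by rewrite /frame_conj mulmx0 mul0mx. Qed.

Lemma covd_connection b : is_connection K b covd.
Proof.
have cs U f p := @csmooth_at b U f p; split.
- by move=> U f p w oU Up sf; exact: covd_fibre oU Up sf.
- by move=> U f h p w oU Up _ _; exact: covd_local.
- move=> U f p a w w' oU Up sf; rewrite /covd /frame_derivative.
  by rewrite (cderive_linear_dir _ _ _ (cs _ _ _ oU Up sf)) frame_conj_linear.
- move=> U f h p w oU Up sf sh.
  rewrite (@covd_near p w (f + h) (fun q => unframe (fr p) f q + unframe (fr p) h q)).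
    by rewrite (cderiveD w (cs _ _ _ oU Up sf) (cs _ _ _ oU Up sh)) frame_conjD.
  near=> q.
  by rewrite /unframe /frame_unconj -[(f + h) q]/(f q + h q) mulmxDr mulmxDl.
- move=> U f p w z oU Up sf _.
  rewrite (@covd_near p w (z *: f) (fun q => z *: unframe (fr p) f q)).
    by rewrite (cderiveZ z w (cs _ _ _ oU Up sf)) frame_conjZ.
  by near=> q; rewrite /unframe -frame_unconjZ.
- move=> U f u p w oU Up sf su.
  have du : differentiable (fun x => u (icoord (chart_at p) x)) (chart_at p p).
    have := iffLR (smooth_fieldP _ oU) su (chart_at p) p (chart_at_atlas p) Up (chart_at_dom p).
    exact: smooth_near_diff.
  have fp : f p = frame_conj (fr p p) (unframe (fr p) f p).
    by rewrite /unframe (frame_unconjK (frame_at_adapted p).1).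
  rewrite (@covd_near p w _ (fun q => (u q)%:C *: unframe (fr p) f q)).
    rewrite (cderive_real_mul w (cs _ _ _ oU Up sf) du (chart_at_dom p)).
    by rewrite frame_conjD !frame_conjZ -fp.
  by near=> q; rewrite /unframe -frame_unconjZ.
- by move=> U f Y oU sf sY; exact: covd_smooth oU sf sY.
Unshelve. all: by end_near. Qed.

Lemma cderive_bracket g c p (Y Z : X -> 'rV[R]_n) : dom c p -> csmooth g c p ->
  smooth_near (fun x => vec_in Y c (icoord c x)) (c p) ->
  smooth_near (fun x => vec_in Z c (icoord c x)) (c p) ->
  cderive (fun q => cderive g c q (vec_in Z c q)) c p (vec_in Y c p)
    - cderive (fun q => cderive g c q (vec_in Y c q)) c p (vec_in Z c p)
    - cderive g c p (Defs.dcomp (vec_in Z) c p (vec_in Y c p)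
        - Defs.dcomp (vec_in Y) c p (vec_in Z c p)) = 0.
Proof.
move=> cp [s1 s2] sY sZ; pose Bc (B : X -> 'rV[R]_n) x := vec_in B c (icoord c x).
pose part (pi : M -> 'M[R]_N) x := pi (g (icoord c x)).
have cE B w : cderive (fun q => cderive g c q (vec_in B c q)) c p w
    = ('D_w (fun x => 'D_(Bc B x) (part mRe) x) (c p))%:CM
      + 'i *: ('D_w (fun x => 'D_(Bc B x) (part mIm) x) (c p))%:CM.
  rewrite /cderive; have nc := near_icoord cp (near_dom cp).
  have L (pi : M -> 'M[R]_N) (pi' : M -> 'M[R]_N) :
      (forall q, pi' (cderive g c q (vec_in B c q)) = dpart pi g c q (vec_in B c q)) ->
      dpart pi' (fun q => cderive g c q (vec_in B c q)) c p w
        = 'D_w (fun x => 'D_(Bc B x) (part pi) x) (c p).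
    move=> pik; apply: near_eq_derive; apply: filterS nc => x [_ _ xE].
    by rewrite pik /dpart xE.
  rewrite (L mRe); last by move=> q; rewrite /cderive mReE.
  by rewrite (L mIm) // => q; rewrite /cderive mImE.
have zre := lie_bracket_derive s1 sY sZ; have zim := lie_bracket_derive s2 sY sZ.
rewrite (coordK cp) in zre zim.
exact: (complex_mx_comb (cE Z (vec_in Y c p)) (cE Y (vec_in Z c p)) (erefl _) zre zim).
Qed.

Lemma covd_flat b : flat K b covd.
Proof.
move=> U f Y Z p oU Up sf sY sZ.
have [D [Dp sv]] := frP p; have [oD av _] := sv.
have ac := chart_at_atlas p; have cp := chart_at_dom p.
have nUD : \forall q \near p, [/\ U q, D q & dom (chart_at p) q].
  by apply: filterS (filterI (near_open oU Up) (filterI (near_open oD Dp) (near_dom cp))) => q [? []].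
pose k (B : X -> 'rV[R]_n) q := cderive (unframe (fr p) f) (chart_at p) q (vec_in B (chart_at p) q).
(* Near p the components of the inner derivative are directional derivatives of the components of f,
   in one fixed chart and frame; this leaves a computation with ordinary derivatives. *)
have uk B : \forall q \near p, unframe (fr p) (fun q => covd q (B q) f) q = k B q.
  apply: filterS nUD => q [Uq Dq cq].
  by rewrite {1}/unframe (covd_chart (B q) oU Uq sf sv Dq ac cq) (frame_conjK (av _ Dq).1).
have EZ := @covd_near p (Y p) (fun q => covd q (Z q) f) (k Z) (uk Z).
have EY := @covd_near p (Z p) (fun q => covd q (Y q) f) (k Y) (uk Y).
have sg := csmooth_unframe sv oU sf.1 ac Up Dp cp.
have H := cderive_bracket cp sg (smooth_near_vec oU sY ac Up cp) (smooth_near_vec oU sZ ac Up cp).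
rewrite !vec_in_chart_at in H.
have sub3 (A B C A' B' C' : M) : A = frame_conj (fr p p) A' -> B = frame_conj (fr p p) B' ->
    C = frame_conj (fr p p) C' -> A' - B' - C' = 0 -> A - B - C = 0.
  move=> -> -> -> e; rewrite -[RHS](frame_conj0 (fr p p)) -e.
  by rewrite /frame_conj !mulmxBr !mulmxBl.
exact: (sub3 _ _ _ _ _ _ EZ EY (erefl _) H).
Qed.

(** Each way of building C from the standard generators builds a field from the generator fields.
    The two correspond only over U, where v is adapted. The next lemma is the converse. *)
Lemma lie_span_section F b U v (C : M) : orients K U v ->
  lie_span (@commutator R s) F [set std_section R b x | x in [set x | listed b x]] C ->
  exists2 h, lie_span (@fcommutator R s X) F
      [set generator_section K b v x | x in [set x | listed b x]] h
    & forall q, U q -> h q = frame_conj (v q) C.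
Proof.
move=> [av _]; elim=> {C} [_ [x bx <-]||A B _ [hA sA EA] _ [hB sB EB]
  |a A Fa _ [hA sA EA]|A B _ [hA sA EA] _ [hB sB EB]].
- exists (generator_section K b v x); first by apply: lie_span_gen; exists x.
  by move=> q Uq; rewrite generator_section_conj//; exact: av.
- by exists 0; [exact: lie_span_0|move=> q _; rewrite frame_conj0].
- exists (hA + hB); first exact: lie_span_add.
  by move=> q Uq; rewrite frame_conjD -(EA _ Uq) -(EB _ Uq).
- exists (a *: hA); first exact: lie_span_scale.
  by move=> q Uq; rewrite frame_conjZ -(EA _ Uq).
- exists (fcommutator hA hB); first exact: lie_span_br.
  by move=> q Uq; rewrite (frame_conj_commutator _ _ (av _ Uq).1) -(EA _ Uq) -(EB _ Uq).
Qed.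

Lemma lie_span_const F b U v h : orients K U v ->
  lie_span (@fcommutator R s X) F
      [set generator_section K b v x | x in [set x | listed b x]] h ->
  exists2 C, lie_span (@commutator R s) F [set std_section R b x | x in [set x | listed b x]] C
    & forall q, U q -> h q = frame_conj (v q) C.
Proof.
move=> [av _]; elim=> {h} [_ [x bx <-]||A B _ [hA sA EA] _ [hB sB EB]
  |a A Fa _ [hA sA EA]|A B _ [hA sA EA] _ [hB sB EB]].
- exists (std_section R b x); first by apply: lie_span_gen; exists x.
  by move=> q Uq; rewrite generator_section_conj//; exact: av.
- by exists 0; [exact: lie_span_0|move=> q _; rewrite frame_conj0].
- exists (hA + hB); first exact: lie_span_add.
  by move=> q Uq; rewrite frame_conjD -(EA _ Uq) -(EB _ Uq).
- exists (a *: hA); first exact: lie_span_scale.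
  by move=> q Uq; rewrite frame_conjZ -(EA _ Uq).
- exists (commutator hA hB); first exact: lie_span_br.
  by move=> q Uq; rewrite (frame_conj_commutator _ _ (av _ Uq).1) -(EA _ Uq) -(EB _ Uq).
Qed.

(** An orientation v may fail to be smooth; near q it is replaced by a smooth frame, reflected if
    its orientation is the opposite one. *)
Lemma exists_alike_smooth_frame U v q : open U -> orients K U v -> U q ->
  exists O u, [/\ smooth_frame K O u, O q & \forall q \near q, alike (u q) (v q)].
Proof.
move=> oU ov Uq; have [D [u [Dq su]]] := exists_smooth_frame K hs q; have [oD _ _] := su.
have [a|a] := orients_alike hs oU oD ov (smooth_frame_orients su) Uq Dq.
  by exists D, u; split => //; apply: filterS a => r; exact: alike_sym.
exists D, (fun q => rotate (reflection R) (u q)); split => //.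
  exact: smooth_frame_reflection.
by apply: filterS a => r; exact: alike_sym.
Qed.

Lemma const_flat_section b U v f C : open U -> orients K U v -> std_fibre b C ->
  (forall q, U q -> f q = frame_conj (v q) C) -> flat_section K b covd U f.
Proof.
move=> oU ov bC fE; have [av _] := ov.
have nu D u q : smooth_frame K D u -> D q -> U q -> (\forall q \near q, alike (u q) (v q)) ->
    \forall q \near q, f q = frame_conj (u q) C.
  move=> [oD au _] Dq Uq uv.
  apply: filterS (filterI uv (filterI (near_open oU Uq) (near_open oD Dq))) => r [ur [Ur Dr]].
  by rewrite fE//; exact: (alike_frame_conj hs (au _ Dr) (av _ Ur) ur bC).
have sf : section_over K b U f.
  split => [|q Uq]; last by rewrite fE//; apply/(fibreP hs _ _ (av _ Uq)).
  apply: (smooth_cend_frame (K := K)) => // c q ac Uq cq.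
  have [D [u [su Dq uv]]] := exists_alike_smooth_frame oU ov Uq.
  exists D, u, (fun=> mRe C), (fun=> mIm C); split => //; try exact: smooth_near_cst.
  apply: filterS (near_icoord cq (nu _ _ _ su Dq Uq uv)) => x [-> _ _].
  by rewrite -complex_mxE.
split=> // q w Uq; have [D [u [su Dq uv]]] := exists_alike_smooth_frame oU ov Uq.
have [oD au _] := su.
rewrite (covd_frame w oU Uq sf su Dq) /frame_derivative.
have e : \forall q \near q, unframe u f q = C.
  apply: filterS (filterI (nu _ _ _ su Dq Uq uv) (near_open oD Dq)) => r [fC Dr].
  by rewrite /unframe fC (frame_conjK (au _ Dr).1).
rewrite (cderive_near_eq (h := fun=> C) w (chart_at_dom q) e) cderive_cst.
exact: frame_conj0.
Qed.

(** Near each point the components in v are those in a smooth frame of the same orientation, whose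
    derivatives vanish by flatness. They are thus locally constant, and U is connected. *)
Lemma flat_section_const b U v f : open U -> connected U -> orients K U v ->
  flat_section K b covd U f -> forall p q, U p -> U q -> unframe v f p = unframe v f q.
Proof.
move=> oU cU ov [sf f0] p q Up Uq; have [av _] := ov.
apply: (locally_constant_connected oU cU) => // {p q Up Uq} q Uq.
have [D [u [su Dq uv]]] := exists_alike_smooth_frame oU ov Uq; have [oD au _] := su.
have ac := chart_at_atlas q; have cq := chart_at_dom q.
have nE : \forall r \near q, unframe v f r = unframe u f r.
  apply: filterS (filterI uv (filterI (near_open oU Uq) (near_open oD Dq))) => r [ur [Ur Dr]].
  exact: (alike_unframe hs sf Ur (au _ Dr) (av _ Ur) ur).
move: (chart_at q) ac cq => c ac cq.
have [s1 s2] := csmooth_unframe su oU sf.1 ac Uq Dq cq.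
have d0 : \forall x \near c q, forall w,
    dpart mRe (unframe u f) c (icoord c x) w = 0 /\ dpart mIm (unframe u f) c (icoord c x) w = 0.
  apply: filterS (filterI (near_icoord cq (near_open oU Uq)) (near_frame su Dq cq)).
  move=> x [[Ux _ _] [Dx cx xE _]] w.
  have ju := jac_unit (atlas_smooth_chart ac) cx.
  (* This is the tangent vector whose components in the chart c are w. *)
  have := f0 (icoord c x) (w *m invmx (jac c (icoord c x))) Ux.
  rewrite (covd_chart _ oU Ux sf su Dx ac cx) mulmxKV// -[RHS](frame_conj0 (u (icoord c x))).
  move/(can_inj (frame_conjK (au _ Dx).1)) => c0; split.
    by have := congr1 mRe c0; rewrite /cderive mReE map_mx0.
  by have := congr1 mIm c0; rewrite /cderive mImE map_mx0.
have cst (pi : M -> 'M[R]_N) : smooth_near (fun x => pi (unframe u f (icoord c x))) (c q) ->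
    (\forall x \near c q, forall w, dpart pi (unframe u f) c (icoord c x) w = 0) ->
    \forall x \near c q, pi (unframe u f (icoord c x)) = pi (unframe u f (icoord c (c q))).
  move=> spi dpi; apply: (@derive0_cst_near _ _ _ _ (fun x => pi (unframe u f (icoord c x)))).
    exact: smooth_near_differentiable.
  apply: filterS (filterI dpi (near_icoord cq (near_dom cq))) => x [dx [_ _ xE]] w.
  by have := dx w; rewrite /dpart xE.
have r1 : \forall x \near c q, forall w, dpart mRe (unframe u f) c (icoord c x) w = 0.
  by apply: filterS d0 => x d0x w; exact: (d0x w).1.
have r2 : \forall x \near c q, forall w, dpart mIm (unframe u f) c (icoord c x) w = 0.
  by apply: filterS d0 => x d0x w; exact: (d0x w).2.
have c12 : \forall r \near q,
    mRe (unframe u f (icoord c (c r))) = mRe (unframe u f (icoord c (c q))) /\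
    mIm (unframe u f (icoord c (c r))) = mIm (unframe u f (icoord c (c q))).
  pose P x := mRe (unframe u f (icoord c x)) = mRe (unframe u f (icoord c (c q))) /\
    mIm (unframe u f (icoord c x)) = mIm (unframe u f (icoord c (c q))).
  apply: (near_coord (P := P) cq); exact: (filterI (cst _ s1 r1) (cst _ s2 r2)).
apply: filterS (filterI nE (filterI c12 (near_dom cq))) => r [rE [[e1 e2] cr]].
rewrite rE (nbhs_singleton nE); move: e1 e2; rewrite (coordK cr) (coordK cq) => e1 e2.
by rewrite [LHS]complex_mxE e1 e2 -complex_mxE.
Qed.

Lemma covd_natural b : natural K b covd.
Proof.
move=> U v oU cU ov f; split=> [ff|[h hspan fh]].
  have [[p Up]|U0] := pselect (U !=set0); last first.
    (* A connected U may be empty; any field then agrees on it with 0. *)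
    by exists 0; [exact: lie_span_0|move=> p Up; case: U0; exists p].
  have [sf _] := ff; have [av _] := ov.
  have bC := section_std hs sf Up (av _ Up); rewrite std_fibreE in bC.
  have [h hspan hE] := lie_span_section ov bC; exists h => // q Uq.
  rewrite (hE _ Uq) -(flat_section_const oU cU ov ff Uq Up).
  by rewrite (frame_unconjK (av _ Uq).1).
have [C CS hE] := lie_span_const ov hspan.
apply: (const_flat_section oU ov (C := C)); first by rewrite std_fibreE.
by move=> q Uq; rewrite fh// hE.
Qed.

End FlatConnection.

(** The algebra of the Koszul formula for the metric J J^T, with H the derivatives of J and D those
    of the metric. The symmetry of H leaves of the three terms only twice the entry (b, e) of H_a
    J^T, and J^T (J J^T)^-1 = J^-1. *)
Lemma koszul_flat (F : numFieldType) n (J : 'M[F]_n) (H D : 'I_n -> 'M[F]_n) a b k :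
  J \in unitmx -> (forall e f l, H e f l = H f e l) ->
  (forall e, D e = H e *m J^T + J *m (H e)^T) ->
  2^-1 * \sum_(e < n) invmx (J *m J^T) k e * (D a b e + D b a e - D e a b)
    = (H a *m invmx J) b k.
Proof.
move=> Ju symH DE.
have -> : H a *m invmx J = H a *m J^T *m (invmx (J *m J^T))^T.
  have JTu : J^T \in unitmx by rewrite unitmx_tr.
  rewrite trmx_inv trmx_mul trmxK -mulmxA; congr (_ *m _).
  by rewrite mulmx_invM.
rewrite [RHS]mxE mulr_sumr; apply: eq_bigr => e _; rewrite [X in _ = _ * X]mxE.
rewrite [LHS]mulrCA [RHS]mulrC [in RHS]mxE; congr (_ * _).
rewrite !DE !mxE -!big_split/= -sumrB mulr_sumr; apply: eq_bigr => l _.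
rewrite !mxE (symH b a) (symH e a) (symH e b).
by field.
Qed.

(** * The Levi-Civita connection *)

Lemma derive_congruence (R : realType) m n (J G : 'rV[R]_m -> 'M[R]_n) x w :
  differentiable J x -> differentiable G x -> G x = 1%:M -> 'D_w G x = 0 ->
  'D_w (fun y => J y *m G y *m (J y)^T) x = 'D_w J x *m (J x)^T + J x *m ('D_w J x)^T.
Proof.
move=> dJ dG G1 DG; have dJT := differentiable_linear_mx trmx dJ.
have DJG : 'D_w (fun y => J y *m G y) x = 'D_w J x.
  apply: etrans (derive_mulmx _ dJ dG) _; move: ('D_w G x) DG => _ ->.
  by move: ('D_w J x) => A; rewrite G1 mulmx0 addr0 mulmx1.
apply: etrans (derive_mulmx _ (differentiable_mulmx dJ dG) dJT) _.
move: ('D_w (fun y => J y *m G y) x) DJG => _ ->.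
have := derive_linear_mx trmx w dJ; move: ('D_w (fun y => (J y)^T) x) => _ ->.
by move: ('D_w J x) => A; rewrite G1 mulmx1.
Qed.

Lemma derive_near_ext_conj (R : realType) k m (V : 'rV[R]_k -> 'M[R]_m)
    (A : 'M[R]_(extdim m)) f x w :
  (\near x, V x \in unitmx) -> smooth_near V x ->
  (\forall y \near x, f y = ext_mx (V y) *m A *m invmx (ext_mx (V y))) ->
  let B := ext_der (invmx (V x) *m 'D_w V x) in 'D_w f x = B *m f x - f x *m B.
Proof.
move=> Vu sV fE /=; have fx := nbhs_singleton fE; rewrite [in RHS]fx.
exact: etrans (near_eq_derive w fE) (derive_ext_conj A w Vu sV).
Qed.

Section LeviCivita.
Variables (R : realType) (s : nat) (X : manifold R (2 * s.+1)) (K : almost_sKahler X).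
Local Notation n := (2 * s.+1)%N.
Local Notation N := (extdim n).
Implicit Types (p q : X) (c d : chart R n X) (v : X -> coframe R s) (U O : set X) (w : 'rV[R]_n).
Hypothesis hs : (2 <= s)%N.

Lemma ext_derN m (A : 'M[R]_m) : ext_der (- A) = - ext_der A.
Proof.
rewrite /ext_der -sumrN; apply: eq_bigr => i _.
by rewrite linearN/= linearN/= mulNmx.
Qed.

(* In a chart d the metric is the identity to first order, so with phi the change
   of coordinates from [chart_at p] to d and J its Jacobian matrix the metric is
   J J^T to first order, and the Koszul formula gives
   Gamma^k_{ab} = sum_l (d_a d_b phi^l) (J^-1)_{lk}. *)
Lemma christoffel_flat p d a b k : dom d p -> smooth_chart d ->
  bil_in (metric K) d p = 1%:M ->
  (forall w, Defs.dcomp (bil_in (metric K)) d p w = 0) ->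
  let J x := trans_jac (chart_at p) d (icoord (chart_at p) x) in
  christoffel (metric K) p a b k
    = ('D_(delta_mx 0 a) J (chart_at p p) *m invmx (J (chart_at p p))) b k.
Proof.
move=> dp sd g1 g0 J.
have gp : metric K p = bil_in (metric K) (chart_at p) p by rewrite bil_in_chart_at.
rewrite /christoffel /Defs.dcomp gp.
have ac := chart_at_atlas p; have cp := chart_at_dom p.
move: (chart_at p) ac cp @J => c ac cp J.
have dc := smooth_chart_compatible sd ac; have cd := compatible_charts_sym dc.
have sJ : smooth_near J (c p) := smooth_trans_jac cd cp dp.
have dJ := smooth_near_diff sJ; have dJT := smooth_near_diff (smooth_near_trmx sJ).
have sG : smooth_near (fun x => bil_in (metric K) d (icoord c x)) (c p).
  exact: (bil_in_smooth_near (metric_smooth K)).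
have dG := smooth_near_diff sG.
have DG w : 'D_w (fun x => bil_in (metric K) d (icoord c x)) (c p) = 0.
  have dGd := differentiable_chart_change dc dp cp dG.
  by rewrite (chart_derive_change w cd cp dp dGd); exact: g0.
have gE : \forall x \near c p, bil_in (metric K) c (icoord c x)
    = J x *m bil_in (metric K) d (icoord c x) *m (J x)^T.
  apply: filterS (near_icoord cp (near_dom dp)) => x [dx cx _].
  exact: bil_in_trans.
have Jp : J (c p) = trans_jac c d p by rewrite /J coordK.
have Ju : J (c p) \in unitmx by rewrite Jp; exact: trans_jac_unit.
have gcE : bil_in (metric K) c p = J (c p) *m (J (c p))^T.
  by rewrite Jp (bil_in_trans _ ac sd cp dp) g1 mulmx1.
pose H e := 'D_(delta_mx 0 e) J (c p).
have dgE e : 'D_(delta_mx 0 e) (fun x => bil_in (metric K) c (icoord c x)) (c p)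
    = H e *m (J (c p))^T + J (c p) *m (H e)^T.
  apply: etrans (near_eq_derive _ gE) _.
  by apply: (derive_congruence dJ dG _ (DG _)); rewrite coordK.
have symH e f l : H e f l = H f e l.
  have st := smooth_trans cd cp dp.
  have JE i : \forall x \near c p, row i (J x) = 'D_(delta_mx 0 i) (fun y => d (icoord c y)) x.
    apply: filterS (near_icoord cp (near_dom dp)) => x [dx cx xE].
    by rewrite rowE -(trans_derive _ cd cx dx) xE.
  have DE i i' : row i (H i')
      = 'D_(delta_mx 0 i') (fun x => 'D_(delta_mx 0 i) (fun y => d (icoord c y)) x) (c p).
    by apply: etrans (esym (derive_linear_mx (row i) _ dJ)) _; exact: near_eq_derive (JE i).
  have : row f (H e) = row e (H f).
    exact: etrans (DE f e) (etrans (derive_swap_mx _ _ st) (esym (DE e f))).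
  by move: (H e) (H f) => A B /matrixP/(_ 0 l); rewrite [LHS]mxE [RHS]mxE.
rewrite gcE; exact: koszul_flat Ju symH dgE.
Qed.

(** Every smooth frame is allowed: vanishing of the covariant derivative uses the frame of the chart
    adapted to p, smoothness an arbitrary one. *)
Definition locally_constant_in_frames p (T : X -> 'M[R]_N) := forall O u,
  smooth_frame K O u -> O p -> exists A, \forall q \near p,
    T q = frame_op (u q) *m A *m invmx (frame_op (u q)).

(** With J the Jacobian from the preferred chart to the adapted one, both the Christoffel symbols
    ([christoffel_flat]) and the logarithmic derivative of the frame matrix V are given by (dJ)
    J^-1. One yields the connection term of T, the other the derivative of T, as commutators of
    opposite sign. *)
Lemma levi_civita_eq0 p T w : sKahler K -> locally_constant_in_frames p T ->
  levi_civita (metric K) T p w = 0.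
Proof.
move=> sK Tc; have [d [dp dd g1 g0]] := sK p; have [u [su du]] := darboux_frame hs dd.
have sd := dd.1; have [A TE] := Tc _ _ su dp; have [_ au _] := su.
rewrite /levi_civita /Defs.dcomp.
have Gam a b k := christoffel_flat a b k dp sd g1 g0.
have ac := chart_at_atlas p; have cp := chart_at_dom p.
have TpE : end_in T (chart_at p) p = T p.
  by rewrite /end_in cojac_chart_at ext_mx1 mul1mx invmx1 mulmx1.
move: (chart_at p) ac cp Gam TpE => c ac cp Gam TpE; have sc := atlas_smooth_chart ac.
have dc := smooth_chart_compatible sd ac; have cd := compatible_charts_sym dc.
pose V x := frame_in u c (icoord c x).
pose J x := trans_jac c d (icoord c x).
have nf := near_frame su dp cp.
have sJ : smooth_near J (c p) := smooth_trans_jac cd cp dp.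
have dJ := smooth_near_diff sJ.
have sV : smooth_near V (c p) by have [_ _] := su; exact.
have Vu : \forall x \near c p, V x \in unitmx.
  apply: filterS nf => x [_ cx _ ax].
  by rewrite unitmx_mul (frame_mx_unit ax.1) cojac_unit.
have Ju : J (c p) \in unitmx by rewrite /J coordK//; exact: trans_jac_unit.
have nT : \forall x \near c p, end_in T c (icoord c x) = ext_mx (V x) *m A *m invmx (ext_mx (V x)).
  apply: filterS (filterI nf (near_icoord cp TE)) => x [[_ cx _ ax] [Tx _ _]].
  exact: (end_in_frame sc cx ax Tx).
(* In the adapted chart d the frame matrix has zero derivative at p, so V varies only through the
   factor J^T of its transformation law. *)
have DV : 'D_w V (c p) = V (c p) *m ((invmx (J (c p)))^T *m ('D_w J (c p))^T).
  have sVJ : smooth_near (fun x => V x *m invmx (J x)^T) (c p).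
    apply: smooth_near_mulmx sV (smooth_near_invmx _ (smooth_near_trmx sJ)).
    apply: filterS (near_icoord cp (near_dom dp)) => x [dx cx _].
    by rewrite unitmx_tr; exact: trans_jac_unit.
  have VdE : \forall x \near c p, V x *m invmx (J x)^T = frame_in u d (icoord c x).
    apply: filterS (near_icoord cp (near_dom dp)) => x [dx cx _].
    by rewrite /V (frame_in_trans u ac sd cx dx) mulmxK// unitmx_tr trans_jac_unit.
  have sVd := smooth_near_eq VdE sVJ.
  have VE : \forall x \near c p, V x = frame_in u d (icoord c x) *m (J x)^T.
    apply: filterS (near_icoord cp (near_dom dp)) => x [dx cx _].
    exact: frame_in_trans.
  have D0 := du p c w dp ac cp g0.
  have Vp := nbhs_singleton VE.
  apply: etrans (near_eq_derive _ VE) _.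
  apply: etrans (derive_mulmx _ (smooth_near_diff sVd) (differentiable_linear_mx trmx dJ)) _.
  move: ('D_w (fun x => frame_in u d (icoord c x)) (c p)) D0 => _ ->.
  rewrite mul0mx add0r.
  have := derive_linear_mx trmx w dJ; move: ('D_w (fun y => (J y)^T) (c p)) => _ ->.
  rewrite Vp -mulmxA; congr (_ *m _); move: ('D_w J (c p)) => B.
  by rewrite mulmxA -trmx_mul mulVmx// trmx1 mul1mx.
have GE : \matrix_(k, b) - \sum_(a < n) w 0 a * christoffel (metric K) p a b k
    = - (invmx (V (c p)) *m 'D_w V (c p)).
  rewrite DV mulKmx ?(nbhs_singleton Vu)// (derive_sum_dir w dJ) -trmx_mul.
  have := fun a b k => Gam a b k : christoffel (metric K) p a b k
    = ('D_(delta_mx 0 a) J (c p) *m invmx (J (c p))) b k.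
  move: (fun a => 'D_(delta_mx 0 a) J (c p)) => H HE.
  apply/matrixP => k b; rewrite mulmx_suml.
  rewrite [LHS]mxE [RHS]mxE [X in _ = - X]mxE summxE; congr (- _).
  by apply: eq_bigr => a _; rewrite -scalemxAl [RHS]mxE HE.
have := derive_near_ext_conj w Vu sV nT.
rewrite coordK// TpE GE ext_derN.
move: ('D_w (fun x => end_in T c (icoord c x)) (c p)) => DT ->.
move: (ext_der _) => B.
by rewrite mulNmx mulmxN -opprD addrN.
Qed.

Lemma parallel_locally_constant U T : sKahler K -> open U ->
  (forall p, U p -> locally_constant_in_frames p T) -> parallel (metric K) U T.
Proof.
move=> sK oU TU; split=> [|p w Up]; last exact: levi_civita_eq0 sK (TU p Up).
apply: (smooth_end_frame (K := K)) => // c q ac Uq cq.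
have [D [u [Dq su]]] := exists_smooth_frame K hs q.
have [A TE] := TU q Uq _ _ su Dq.
exists D, u, (fun=> A); split=> //; first exact: smooth_near_cst.
by apply: filterS (near_icoord cq TE) => x [].
Qed.

(** Near p the operators of v agree with those of the smooth frame u, or differ from them by the
    constant sign of a reflection, according to the orientations. *)
Lemma generator_locally_constant U v x p : open U -> orients K U v -> U p ->
  locally_constant_in_frames p (generator_op K v x).
Proof.
move=> oU ov Up D u su Dp; have [oD au _] := su; have [av _] := ov.
have nD := near_open oD Dp; have nU := near_open oU Up.
have [uv|uv] := orients_alike hs oU oD ov (smooth_frame_orients su) Up Dp.
  exists (@std_op R s x); apply: filterS (filterI uv (filterI nD nU)) => q [uvq [Dq Uq]].
  rewrite -(generator_opE x (au _ Dq)); symmetry.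
  exact: (alike_generator_op hs x (av _ Uq) (au _ Dq) uvq).
exists (gen_sign (rotdet (reflection R)) x *: @std_op R s x).
apply: filterS (filterI uv (filterI nD nU)) => q [uvq [Dq Uq]].
rewrite -scalemxAr -scalemxAl -(generator_opE x (au _ Dq)).
have e := alike_generator_op hs (v := v) (v' := fun q => rotate (reflection R) (u q)) x (av _ Uq)
  (adapted_reflection (au _ Dq)) uvq.
by rewrite -e; exact: generator_op_rotate.
Qed.

Lemma L_op_locally_constant j k p : locally_constant_in_frames p (L_op K j k).
Proof.
move=> D u [oD au _] Dp; exists (@std_op R s (GenL j k)).
by apply: filterS (near_open oD Dp) => q Dq; exact: (generator_opE (GenL j k) (au _ Dq)).
Qed.

Lemma Lambda_op_locally_constant j k p : locally_constant_in_frames p (Lambda_op K j k).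
Proof.
move=> D u [oD au _] Dp; exists (@std_op R s (GenLambda j k)).
by apply: filterS (near_open oD Dp) => q Dq; exact: (generator_opE (GenLambda j k) (au _ Dq)).
Qed.

End LeviCivita.

Theorem proposition8p1 (R : realType) (s : nat) (hs : (2 <= s)%N)
    (X : manifold R (2 * s.+1)) (K : almost_sKahler X) :
  (exists D : bundle -> covariant_derivative X,
     (forall b, is_connection K b (D b) /\ flat K b (D b) /\ natural K b (D b)) /\
     (forall b b', compatible K b b' (D b) (D b'))) /\
  (sKahler K ->
     (forall j k, j != k ->
        parallel (metric K) setT (L_op K j k) /\
        parallel (metric K) setT (Lambda_op K j k)) /\
     (forall (U : set X) (v : X -> coframe R s), open U -> orients K U v ->
        forall j, parallel (metric K) U (V_op v j) /\
                  parallel (metric K) U (A_op K v j))).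
Proof.
split=> [|sK]; last split.
- have /choice[fr frP] : forall p, exists v, exists O, O p /\ smooth_frame K O v.
    by move=> p; have [D [v [Dp sv]]] := exists_smooth_frame K hs p; exists v, D.
  (* One operator serves all the bundles, so compatibility holds by reflexivity. *)
  exists (fun=> covd fr); split=> [b|b b' _ U f p w _ _ _ //].
  split; first exact: covd_connection.
  by split; [exact: covd_flat|exact: covd_natural].
- move=> j k _; split; apply: (parallel_locally_constant hs sK openT) => p _.
    exact: L_op_locally_constant.
  exact: Lambda_op_locally_constant.
- move=> U v oU ov j; split; apply: (parallel_locally_constant hs sK oU) => p Up.
    exact: (generator_locally_constant hs (GenV j) oU ov Up).
  exact: (generator_locally_constant hs (GenA j) oU ov Up).
Qed.
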